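(* Let $Y^0$ and $Z^0$ be independent random samples from $PD(1)$, and let $(Y^t,Z^t)$ be their evolution under the coupling kernel $\tilde M$. Let $t_0\in\mathbb{N}_+$ and let $q$ be uniform on $\{0,1,\dots,t_0-1\}$, independent of the chain. Then for each $\rho>0$, $$\mathbf{P}\bigl[\max\{y_1^q,z_1^q\}>\rho\bigr]\le C\,\rho^{-1}(\log t_0)^{-1},$$ with $C$ a universal constant.
   Context: $\Omega=\{y\in[0,1]^{\mathbb{N}_+}:\sum_iy_i=1,\ y_1\ge y_2\ge\cdots\}$. $PD(1)$: with $U_1,U_2,\dots$ i.i.d. uniform on $[0,1]$, $x_1=U_1$, $x_j=U_j(1-\sum_{i<j}x_i)$; $PD(1)$ is the law of $(x_j)$ sorted nonincreasingly. Matching: for $Y,Z\in\Omega$ and $i\in\mathbb{N}_+$, let $H=\{j:Z_j=Y_i\}$ and $k=|\{j\le i:Y_j=Y_i\}|$; $f_{Y,Z}(i)=0$ if $|H|<k$, else the $k$-th smallest element of $H$. $I(Y,Z)=\{i:f_{Y,Z}(i)\ne0\}$ (matched entries), $Q(Y,Z)=\sum_{i\in I(Y,Z)}Y_i$. Kernel $\tilde M$: let $\tilde Y$ partition $[0,1]$ into closed intervals of lengths $Y_i$, those with $i\in I(Y,Z)$ tiling $[1-Q,1]$ and the rest tiling $[0,1-Q]$, each in increasing index order; $\tilde Z$ likewise. Take $u,v$ independent uniform on $[0,1]$; $a,a'$ with $u\in\tilde Y_a,u\in\tilde Z_{a'}$. $\hat Y$: move $\tilde Y_a$ to $[0,Y_a]$,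 shift intervals to its left right by $Y_a$, keep those to its right; $\hat Z$ likewise. $b,b'$ with $v\in\hat Y_b$, $v\in\hat Z_{b'}$. If $a\neq b$, $Y'$ merges $Y_a,Y_b$ into $Y_a+Y_b$; if $a=b$, $Y'$ splits $Y_a$ into $v$ and $Y_a-v$; resort. $Z'$ likewise from $a',b',v$. New state $(Y',Z')$. $y_1^t$ is the largest entry $Y^t_i$ with $i\notin I(Y^t,Z^t)$ and $z_1^t$ the largest entry $Z^t_j$ with $j\notin I(Z^t,Y^t)$ ($0$ if none). *)

(* Defs.v *)
From HB Require Import structures.
From mathcomp Require Import all_boot all_order all_algebra.
From mathcomp Require Import all_classical all_reals all_analysis.
From mathcomp Require Import finmap.
From Stdlib Require Import ClassicalEpsilon.

Set Implicit Arguments.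
Unset Strict Implicit.
Unset Printing Implicit Defensive.

Import Order.TTheory GRing.Theory Num.Theory.
Local Open Scope classical_set_scope.
Local Open Scope ring_scope.

(* Elements of Omega are represented as sequences  y : nat -> R,
   with the paper's entry y_i (i >= 1) being  y (i-1). *)

Section Defs.
Variable R : realType.

(* [choose_spec d P]: the element x satisfying P when it exists (all uses below
   have P with at most one solution); otherwise a fixed default. *)
Definition choose_spec (A : Type) (d : A) (P : A -> Prop) : A :=
  epsilon (inhabits d) P.

Definition atleast (x : nat -> R) (r : R) (n : nat) : Prop :=
  exists s : seq nat, [/\ uniq s, size s = n & forall j, j \in s -> x j = r].

(* y is the nonincreasing rearrangement of x: nonnegative, nonincreasing and
   with the same multiplicities of every positive value (zeros fill up). *)
Definition is_sortdesc (x y : nat -> R) : Prop :=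
  [/\ forall i, 0 <= y i, forall i, y i.+1 <= y i &
      forall r n, 0 < r -> (atleast y r n <-> atleast x r n)].

Definition sortdesc (x : nat -> R) : nat -> R :=
  choose_spec x (is_sortdesc x).

(* stick breaking: x_j = U_j (1 - sum_{i<j} x_i) *)
Fixpoint stick_rem (U : nat -> R) (n : nat) : R :=
  match n with
  | 0 => 1
  | n.+1 => stick_rem U n - U n * stick_rem U n
  end.
Definition stick (U : nat -> R) (j : nat) : R := U j * stick_rem U j.

Definition PD1_sample (U : nat -> R) : nat -> R := sortdesc (stick U).

Definition match_rank (Y : nat -> R) (i : nat) : nat :=
  count (fun j => Y j == Y i) (iota 0 i.+1).
Definition matched (Y Z : nat -> R) (i : nat) : Prop :=
  atleast Z (Y i) (match_rank Y i).

Definition Qmatch (Y Z : nat -> R) : R :=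
  limn (fun n => \sum_(i < n | `[< matched Y Z i >]) Y i).

Definition tleft (Y Z : nat -> R) (i : nat) : R :=
  if `[< matched Y Z i >] then
    1 - Qmatch Y Z + \sum_(j < i | `[< matched Y Z j >]) Y j
  else \sum_(j < i | ~~ `[< matched Y Z j >]) Y j.

Definition least (P : nat -> Prop) : nat :=
  choose_spec 0%N (fun n => P n /\ forall m, P m -> (n <= m)%N).

(* index a with u in \tilde Y_a (ties, of probability 0, broken by least index) *)
Definition idx_a (Y Z : nat -> R) (u : R) : nat :=
  least (fun i => tleft Y Z i <= u <= tleft Y Z i + Y i).

Definition hleft (Y Z : nat -> R) (u : R) (i : nat) : R :=
  let a := idx_a Y Z u in
  if i == a then 0
  else if tleft Y Z i < tleft Y Z a then tleft Y Z i + Y a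
  else tleft Y Z i.

Definition idx_b (Y Z : nat -> R) (u v : R) : nat :=
  least (fun i => hleft Y Z u i <= v <= hleft Y Z u i + Y i).

(* merge Y_a, Y_b into Y_a + Y_b (slot b becomes 0; zeros are padding) *)
Definition merge_seq (Y : nat -> R) (a b : nat) : nat -> R :=
  fun i => if i == a then Y a + Y b else if i == b then 0 else Y i.

Definition split_seq (Y : nat -> R) (a : nat) (v : R) : nat -> R :=
  fun i => match i with
           | 0 => Y a - v
           | i'.+1 => if i' == a then v else Y i'
           end.

Definition new_seq (Y Z : nat -> R) (u v : R) : nat -> R :=
  let a := idx_a Y Z u in
  let b := idx_b Y Z u v in
  if a != b then sortdesc (merge_seq Y a b) else sortdesc (split_seq Y a v).

Definition Mstep (s : (nat -> R) * (nat -> R)) (u v : R) :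
    (nat -> R) * (nat -> R) :=
  (new_seq s.1 s.2 u v, new_seq s.2 s.1 u v).

Fixpoint chain (UY UZ uu vv : nat -> R) (t : nat) : (nat -> R) * (nat -> R) :=
  match t with
  | 0 => (PD1_sample UY, PD1_sample UZ)
  | t'.+1 => Mstep (chain UY UZ uu vv t') (uu t') (vv t')
  end.

(* y_1 : largest Y_i with i not in I(Y,Z), 0 if none;  z_1 = unmatched_max Z Y *)
Definition unmatched_max (Y Z : nat -> R) : R :=
  choose_spec 0 (fun r =>
    (exists i, [/\ ~ matched Y Z i, r = Y i & forall j, ~ matched Y Z j -> Y j <= Y i])
    \/ ((forall i, matched Y Z i) /\ r = 0)).

End Defs.

Definition mutually_independent d (T : measurableType d) (R : realType)
    (P : probability T R) (I : choiceType) (E : I -> set (set T)) : Prop :=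
  forall (J : {fset I}) (A : I -> set T),
    (forall i, i \in J -> E i (A i)) ->
    P (\bigcap_(i in [set` J]) A i) = (\prod_(i <- J) P (A i))%E.

(* Main.v *)
(* A step of the coupling removes the unmatched pieces hit by [u] or [v] and
   creates at most as many new ones. Hence the number [N] of unmatched pieces
   larger than [1/t0] decreases along the chain, up to the rare steps that hit a
   piece smaller than [1/t0], and it drops by two when [u] and [v] hit four
   unmatched pieces. As [E N_0 = O(log t0)], such drops are rare. Four unmatched
   pieces larger than [r] make a drop within two steps likely, so the expected
   number of unmatched pieces larger than [r], summed over [t < t0], is at most
   [4 t0 + O(r^-5 log t0)].

   When the largest unmatched piece exceeds [rho], for every scale [2^-k <= rho]
   a step creates with probability at least [rho 2^-(k+1)] an unmatched piece of
   size in [(2^-(k+1), 2^-k)]. Give weight [2^k] to pieces of that size. With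
   [c log t0] scales down to [r = t0^-c], the weight created at such a time is of
   order [rho log t0], whereas the expected weight removed by a step is at most
   twice the number of unmatched pieces larger than [r], which is bounded on
   average. Comparing both over [t < t0] bounds the number of times at which the
   largest unmatched piece exceeds [rho] by [O(t0 / (rho log t0))]. *)

Require Import Defs.
From HB Require Import structures.
From mathcomp Require Import all_boot all_order all_algebra.
From mathcomp Require Import all_classical all_reals all_analysis.
From mathcomp Require Import finmap measurable_realfun ring lra zify.
From Stdlib Require ClassicalEpsilon.
Import Order.TTheory GRing.Theory Num.Theory.
Import numFieldNormedType.Exports.
Set Implicit Arguments.
Unset Strict Implicit.
Unset Printing Implicit Defensive.
Local Open Scope classical_set_scope.
Local Open Scope ring_scope.

(** * Sequences of Omega and their rearrangement *)

(** Matching depends on multiplicities only: the two sides together have [|mult Y r - mult Z r|]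
    unmatched entries of value [r]. A step is therefore followed value by value, without tracking
    indices. A new piece may by chance equal an unmatched entry of the other side and be matched
    with it. So a step only yields upper bounds for nonnegative weights of unmatched pieces, whereas
    births require a lower bound for the weight [phi] of unmatched pieces. The way out is to follow
    [2^k1 N - N_phi], which is nonnegative because [phi <= 2^k1]: accidental matches can only lower
    it. Hits of pieces smaller than [1/t0] are rare because the expected mass of these pieces is
    [O(log t0 / t0)]: stick breaking starts with that much, and a step adds at most [4/t0^2] in
    expectation, since [v] has to cut within [2/t0] of an end of the piece that it splits. The
    smallest scale is about [t0^(-1/10)], because the error [r^-5 log t0] then is of order
    [t0^(1/2) log t0], hence [O(t0)]. *)

Section Sequences.
Variable R : realType.
Implicit Types (x y Y Z : nat -> R) (r : R).

Definition submult x y := forall r n, 0 < r -> atleast x r n -> atleast y r n.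

(** Since [atleast] speaks of one value at a time, the induction takes out all the indices of the
    list that carry the value of its head, and pairs them in one go. *)
Lemma submult_inj x y (s : seq nat) : submult x y -> uniq s ->
  (forall i, i \in s -> 0 < x i) ->
  exists s', uniq s' /\ perm_eq (map y s') (map x s).
Proof.
move=> xy; move: {2}(size s) (leqnn (size s)) => n.
elim: n s => [|n IH] [|i s] //=; try by exists [::].
rewrite ltnS => ssn us ps.
set r := x i; set l := i :: s.
have us' : uniq l by [].
pose s1 := seq.filter (fun j => x j == r) l.
pose s2 := seq.filter (predC (fun j => x j == r)) l.
have r0 : 0 < r by apply: ps; rewrite inE eqxx.
have [t [ut st tr]] : atleast y r (size s1).
  apply: xy => //; exists s1; split=> //; first exact: filter_uniq.
  by move=> j; rewrite mem_filter => /andP[/eqP].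
have [|||t' [ut' pt']] := IH s2.
- rewrite /s2 /= eqxx /=; apply: leq_trans ssn.
  by rewrite size_filter count_size.
- exact: filter_uniq.
- by move=> j; rewrite mem_filter => /andP[_]; exact: ps.
exists (t ++ t'); split.
  rewrite cat_uniq ut ut' /= andbT; apply/hasPn => j jt'; apply/negP => jt.
  have : y j \in map x s2 by rewrite -(perm_mem pt'); apply: map_f.
  move=> /mapP[k]; rewrite mem_filter /= => /andP[/negP kr _] yk.
  by apply: kr; rewrite -yk (tr _ jt).
rewrite map_cat.
have -> : map y t = map x s1.
  have -> : map y t = nseq (size t) r.
    rewrite -(size_map y t); apply/all_pred1P/allP => z /mapP[j jt ->] /=.
    by rewrite (tr _ jt).
  rewrite st -(size_map x s1); apply/esym/all_pred1P/allP => z /mapP[j].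
  by rewrite mem_filter => /andP[/eqP xj _] -> /=; rewrite xj.
apply: (@perm_trans _ (map x s1 ++ map x s2)).
  by rewrite perm_cat2l.
by rewrite -map_cat; exact: (perm_map x (permEl (perm_filterC _ l))).
Qed.

Lemma sum_uniq_le (s : seq nat) (M : nat) (g : nat -> R) :
  uniq s -> (forall i, i \in s -> (i < M)%N) -> (forall i, 0 <= g i) ->
  \sum_(i <- s) g i <= \sum_(i < M) g i.
Proof.
move=> us sM g0.
rewrite -(big_mkord xpredT g) /index_iota subn0.
have ss : perm_eq (iota 0 M) (s ++ seq.filter (fun i => i \notin s) (iota 0 M)).
  apply: uniq_perm; first exact: iota_uniq.
    rewrite cat_uniq us filter_uniq ?iota_uniq // andbT /=.
    by apply/hasPn => j; rewrite mem_filter => /andP[].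
  move=> j; rewrite mem_cat mem_filter mem_iota /= add0n.
  by case: (boolP (j \in s)) => //= js; rewrite sM.
rewrite (perm_big _ ss) /= big_cat /= lerDl.
exact: sumr_ge0.
Qed.

Lemma seq_bounded (s : seq nat) : exists M, forall i, i \in s -> (i < M)%N.
Proof.
elim: s => [|i s [M IH]]; first by exists 0%N.
exists (maxn i.+1 M) => j; rewrite inE leq_max => /orP[/eqP ->|/IH ->].
  by rewrite ltnSn.
by rewrite orbT.
Qed.

Lemma submult_sum_le x y (f : R -> R) n : submult x y ->
  (forall r, 0 <= f r) -> (forall r, r <= 0 -> f r = 0) ->
  exists M, \sum_(i < n) f (x i) <= \sum_(i < M) f (y i).
Proof.
move=> xy f0 fn.
pose s := seq.filter (fun i => 0 < x i) (iota 0 n).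
have [||s' [us' ps']] := @submult_inj x y s xy.
- exact/filter_uniq/iota_uniq.
- by move=> i; rewrite mem_filter => /andP[].
have [M sM] := seq_bounded s'; exists M.
apply: le_trans (sum_uniq_le us' sM (fun i => f0 (y i))).
rewrite -(big_map y xpredT f) (perm_big _ ps') big_map big_filter.
rewrite -(big_mkord xpredT (fun i => f (x i))) /index_iota subn0.
rewrite (bigID (fun i => 0 < x i)) /= [X in _ + X]big1 ?addr0 //.
by move=> i; rewrite -leNgt => /fn.
Qed.

Definition sumsto x (l : R) := (fun n => \sum_(i < n) x i) @ \oo --> l.

Lemma sum_ord_le x m n : (forall i, 0 <= x i) -> (m <= n)%N ->
  \sum_(i < m) x i <= \sum_(i < n) x i.
Proof.
move=> x0 mn.
rewrite -(big_mkord xpredT x) /index_iota subn0.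
by apply: sum_uniq_le => //; [exact: iota_uniq | move=> i; rewrite mem_iota /= add0n => /leq_trans; apply].
Qed.

Lemma sumsto_nneg x l : (forall i, 0 <= x i) ->
  sumsto x l <-> (forall n, \sum_(i < n) x i <= l) /\
                 (forall e, 0 < e -> exists n, l - e < \sum_(i < n) x i).
Proof.
move=> x0.
have mon : nondecreasing_seq (fun n => \sum_(i < n) x i).
  by move=> m n mn; exact: sum_ord_le.
split=> [xl|[ub lb]].
  split=> [n|e e0].
    have <- : limn (fun n => \sum_(i < n) x i) = l by apply/cvg_lim.
    by apply: nondecreasing_cvgn_le => //; apply/cvg_ex; exists l.
  move/cvgrPdist_lt: xl => /(_ _ e0) [N _ /(_ N)] /= /(_ (leqnn N)) h.
  exists N; move: h; rewrite ltr_norml; lra.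
apply/cvgrPdist_lt => e e0.
have [n hn] := lb _ e0.
exists n => // m /= nm.
have := ub m; have := mon _ _ nm => /= h1 h2.
rewrite ltr_norml; lra.
Qed.

Lemma sumsto_mult x y l : (forall i, 0 <= x i) -> (forall i, 0 <= y i) ->
  submult x y -> submult y x -> sumsto x l -> sumsto y l.
Proof.
move=> x0 y0 xy yx /(sumsto_nneg _ x0)[ub lb]; apply/(sumsto_nneg _ y0).
(* The positive part satisfies the condition of [submult_sum_le] on nonpositive arguments and
   changes nothing on nonnegative entries. *)
pose f r : R := Num.max r 0.
have f0 r : 0 <= f r by rewrite le_max lexx orbT.
have fn r : r <= 0 -> f r = 0 by move=> ?; exact/max_idPr.
have fE (z : nat -> R) n : (forall i, 0 <= z i) -> \sum_(i < n) f (z i) = \sum_(i < n) z i.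
  by move=> z0; apply: eq_bigr => i _; exact/max_idPl.
split=> [n|e e0].
  have [M] := submult_sum_le n yx f0 fn.
  by rewrite !fE // => h; exact: (le_trans h (ub M)).
have [n hn] := lb _ e0.
have [M] := submult_sum_le n xy f0 fn.
by rewrite !fE // => h; exists M; exact: (lt_le_trans hn h).
Qed.

Definition Om Y := [/\ forall i, 0 <= Y i, forall i, Y i.+1 <= Y i & sumsto Y 1].

Lemma Om_ge0 Y i : Om Y -> 0 <= Y i. Proof. by case. Qed.

Lemma Om_noninc Y i j : Om Y -> (i <= j)%N -> Y j <= Y i.
Proof.
case=> _ h _; elim: j => [|j IH]; first by rewrite leqn0 => /eqP ->.
by rewrite leq_eqVlt => /orP[/eqP ->//|/IH]; exact: le_trans.
Qed.

Lemma Om_sum_le1 Y n : Om Y -> \sum_(i < n) Y i <= 1.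
Proof. by case=> h _ /(sumsto_nneg _ h)[]. Qed.

(** The first [i.+1] entries are all at least [Y i]. This bound later turns every sum over the
    entries above a threshold into a finite sum. *)
Lemma Om_mul_le1 Y i : Om Y -> i.+1%:R * Y i <= 1.
Proof.
move=> oY; apply: le_trans (Om_sum_le1 i.+1 oY).
rewrite -[X in X%:R * _](card_ord i.+1) mulr_natl -sumr_const.
by apply: ler_sum => j _; apply: Om_noninc => //; rewrite -ltnS.
Qed.

Lemma Om_le1 Y i : Om Y -> Y i <= 1.
Proof.
move=> oY; have := Om_mul_le1 0 oY; rewrite mul1r; apply: le_trans.
exact: Om_noninc.
Qed.

(* On [Om] an entry equal to [r > 0] has index at most [1/r], so nothing is missed. *)
Definition mult Y r : nat := count (fun i => Y i == r) (iota 0 (Num.truncn r^-1).+1).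

Lemma Om_index_lt Y r i : Om Y -> 0 < r -> r <= Y i -> (i < (Num.truncn r^-1).+1)%N.
Proof.
move=> oY r0 rY.
have h : i.+1%:R <= r^-1.
  rewrite -(ler_pM2r r0) mulVf ?gt_eqF //.
  by apply: le_trans (Om_mul_le1 i oY); rewrite ler_wpM2l.
have : i.+1%:R < (Num.truncn r^-1).+1%:R :> R.
  by apply: le_lt_trans h _; exact: truncnS_gt.
by rewrite ltr_nat => /ltnW.
Qed.

Lemma atleast_count x r N n : (forall i, x i = r -> (i < N)%N) ->
  atleast x r n <-> (n <= count (fun i => x i == r) (iota 0 N))%N.
Proof.
move=> hN; split=> [[s [us <- sr]]|].
  rewrite -size_filter; apply: uniq_leq_size => // i si.
  by rewrite mem_filter sr // eqxx mem_iota /= add0n hN // sr.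
rewrite -size_filter => h.
exists (take n (seq.filter (fun i => x i == r) (iota 0 N))); split.
- by rewrite take_uniq // filter_uniq // iota_uniq.
- by rewrite size_takel.
- by move=> j /mem_take; rewrite mem_filter => /andP[/eqP].
Qed.

Lemma atleast_mult Y r n : Om Y -> 0 < r -> atleast Y r n <-> (n <= mult Y r)%N.
Proof.
move=> oY r0; apply: atleast_count => i ri.
by apply: (Om_index_lt oY r0); rewrite ri.
Qed.

Lemma eq_mult (m n : nat) : (forall k, (k <= m)%N <-> (k <= n)%N) -> m = n.
Proof.
by move=> h; apply/eqP; rewrite eqn_leq; apply/andP; split; apply/h.
Qed.

Lemma mult_sort x Y r N : Om Y -> 0 < r -> is_sortdesc x Y ->
  (forall i, x i = r -> (i < N)%N) ->
  mult Y r = count (fun i => x i == r) (iota 0 N).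
Proof.
move=> oY r0 [_ _ h] hN; apply: eq_mult => k.
apply: (iff_trans (iff_sym (atleast_mult _ oY r0))).
by apply: (iff_trans (h _ _ r0)); exact: atleast_count.
Qed.

Lemma mult_count Y r N : Om Y -> 0 < r -> (forall i, r <= Y i -> (i < N)%N) ->
  mult Y r = count (fun i => Y i == r) (iota 0 N).
Proof.
move=> oY r0 hN; apply: eq_mult => k.
apply: (iff_trans (iff_sym (atleast_mult _ oY r0))).
by apply: atleast_count => i ri; apply: hN; rewrite ri.
Qed.

(** Exactly the condition for a rearrangement to exist ([is_sortdesc_sortable], [sortdesc_exists]).
    Both directions serve measurability, where the set on which [sortdesc] takes its default value
    has to be described. *)
Definition sortable x := forall j, 0 < x j ->
  exists N, forall i, x j < x i -> (i < N)%N.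

(** Pigeonhole: [x j] appears as some [y m]. If infinitely many entries of [x] exceeded it, [m.+1]
    of them would reappear in [y] above [y m], where only the [m] indices below [m] are
    available. *)
Lemma is_sortdesc_sortable x y : is_sortdesc x y -> sortable x.
Proof.
move=> [y0 yd h] j xj.
have [s [us ss sr]] : atleast y (x j) 1.
  by apply/h => //; exists [:: j]; split=> // i; rewrite inE => /eqP ->.
case: s us ss sr => [|m [|? ?]] //= _ _ sr.
have ym : y m = x j by apply: sr; rewrite inE.
have ydl a b : (a <= b)%N -> y b <= y a.
  elim: b => [|b IH]; first by rewrite leqn0 => /eqP ->.
  by rewrite leq_eqVlt => /orP[/eqP ->//|/IH]; exact: le_trans.
apply: contrapT => H.
have H' N : exists i, (N <= i)%N /\ x j < x i.
  apply: contrapT => hN; apply: H; exists N => i xi.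
  by rewrite ltnNge; apply/negP => Ni; apply: hN; exists i.
have [s [us ss sx]] : exists s, [/\ uniq s, size s = m.+1 & forall i, i \in s -> x j < x i].
  elim: m.+1 => [|k [s [us ss sx]]]; first by exists [::].
  have [M sM] := seq_bounded s.
  have [i [Mi xi]] := H' M.
  exists (i :: s); split=> /=.
  - by rewrite us andbT; apply/negP => /sM; rewrite ltnNge Mi.
  - by rewrite ss.
  - by move=> k'; rewrite inE => /orP[/eqP ->//|]; exact: sx.
have xy : submult x y by move=> r n r0; rewrite h.
have [i si|s' [us' ps']] := submult_inj xy us.
  exact: lt_trans xj (sx _ si).
have : (size s' <= size (iota 0 m))%N.
  apply: uniq_leq_size => // i is'; rewrite mem_iota add0n /=.
  have : y i \in map x s by rewrite -(perm_mem ps'); exact: map_f.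
  move=> /mapP[k /sx xk yk]; rewrite ltnNge; apply/negP => mi.
  by move: (ydl _ _ mi); rewrite ym yk leNgt xk.
by rewrite size_iota -(size_map y) (perm_size ps') size_map ss ltnn.
Qed.

Section SortExists.
Variable x : nat -> R.

(** Ties are broken by the index, so that the order is strict and total; the sorted sequence puts
    each positive entry at the position given by its number of predecessors. *)
Let before i j := (x j < x i) || ((x i == x j) && (i < j)%N).

Let before_trans i j k : before i j -> before j k -> before i k.
Proof.
move=> /orP[h1|/andP[/eqP h1 h1']] /orP[h2|/andP[/eqP h2 h2']]; apply/orP.
- by left; exact: lt_trans h2 h1.
- by left; rewrite -h2.
- by left; rewrite h1.
- by right; rewrite h1 h2 eqxx (ltn_trans h1' h2').
Qed.

Let before_irr i : before i i = false.
Proof. by rewrite /before ltxx ltnn andbF. Qed.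

Let before_total i j : i != j -> before i j || before j i.
Proof. by rewrite /before; case: ltgtP => //= _; rewrite neq_ltn. Qed.

Let rank j k := exists s, [/\ uniq s, size s = k & forall i, (i \in s) = before i j].

Let rank_fun j k k' : rank j k -> rank j k' -> k = k'.
Proof.
move=> [s [us <- hs]] [s' [us' <- hs']].
by apply/perm_size/uniq_perm => // i; rewrite hs hs'.
Qed.

Let rank_lt i j k l : before i j -> rank i k -> rank j l -> (k < l)%N.
Proof.
move=> ij [s [us <- hs]] [s' [us' <- hs']].
have : (size (i :: s) <= size s')%N.
  apply: uniq_leq_size; first by rewrite /= us hs before_irr.
  by move=> m; rewrite inE hs hs' => /orP[/eqP ->//|/before_trans]; apply.
by [].
Qed.

Let rank_inj i j k : rank i k -> rank j k -> i = j.
Proof.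
move=> ri rj; apply/eqP/negPn/negP => /before_total/orP[h|h].
  by have := rank_lt h ri rj; rewrite ltnn.
by have := rank_lt h rj ri; rewrite ltnn.
Qed.

Let before_max (s : seq nat) : s != [::] ->
  exists2 m, m \in s & forall i, i \in s -> i != m -> before i m.
Proof.
elim: s => // i s IH _; have [->|sn] := eqVneq s [::].
  by exists i => [|k]; rewrite in_cons in_nil orbF ?eqxx // => ->.
have [m ms hm] := IH sn.
have [im|/before_total/orP[h|h]] := eqVneq i m.
- exists m; first by rewrite in_cons ms orbT.
  move=> k; rewrite in_cons => /orP[/eqP ->|]; last exact: hm.
  by rewrite im eqxx.
- exists m; first by rewrite in_cons ms orbT.
  by move=> k; rewrite in_cons => /orP[/eqP -> //|]; exact: hm.
- exists i; first by rewrite in_cons eqxx.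
  move=> k; rewrite in_cons => /orP[/eqP ->|ks _]; first by rewrite eqxx.
  have [-> //|km] := eqVneq k m.
  exact: before_trans (hm _ ks km) h.
Qed.

(** The last of the predecessors of [j] has one predecessor less. Hence the occupied positions have
    no gaps, which makes the sorted sequence nonincreasing. *)
Let rank_pred j k : rank j k.+1 -> exists2 i, before i j & rank i k.
Proof.
move=> [s [us ss hs]].
have [|m ms hm] := @before_max s; first by case: (s) ss.
have mj : before m j by rewrite -hs.
exists m => //; exists (rem m s); split.
- exact: rem_uniq.
- by rewrite size_rem // ss.
- move=> i; rewrite mem_rem_uniq // inE /=; apply/andP/idP => [[im /hm]|im].
    by apply.
  split; last by rewrite hs; exact: before_trans im mj.
  by apply/eqP => im'; move: im; rewrite im' before_irr.
Qed.

Hypothesis sx : sortable x.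

Let rank_ex j : 0 < x j -> exists k, rank j k.
Proof.
move=> /sx[N hN].
pose s := seq.filter (fun i => before i j) (iota 0 (maxn N j)).
exists (size s), s; split=> //; first exact/filter_uniq/iota_uniq.
move=> i; rewrite mem_filter mem_iota /= add0n leq_max.
apply/andP/idP => [[]//|bij]; split=> //.
by move: bij => /orP[/hN ->//|/andP[_ ->]]; rewrite orbT.
Qed.

Let good k j := 0 < x j /\ rank j k.

Let y k := match pselect (exists j, good k j) with
  | left e => x (sval (cid e)) | right _ => 0 end.

Let y_good k j : good k j -> y k = x j.
Proof.
move=> kj; rewrite /y; case: pselect => [e|[]]; last by exists j.
by case: cid => i [i0 ik] /=; congr x; exact: rank_inj ik kj.2.
Qed.

Let y_gt0 k : 0 < y k -> exists2 j, good k j & y k = x j.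
Proof.
rewrite {1}/y; case: pselect => [[j gj] _|]; last by rewrite ltxx.
by exists j => //; exact: y_good.
Qed.

Lemma sortdesc_exists : exists y, is_sortdesc x y.
Proof.
exists y.
have y0 k : 0 <= y k.
  by rewrite /y; case: pselect => // e; case: cid => j /= [j0 _]; exact: ltW.
split=> //.
  move=> k; have [->//|yk] := eqVneq (y k.+1) 0.
  have [|j [j0 jk] ->] := @y_gt0 k.+1; first by rewrite lt_def yk y0.
  have [i ij ik] := rank_pred jk.
  have xij : x j <= x i by move: ij => /orP[/ltW //|/andP[/eqP ->]].
  by rewrite (@y_good k i) //; split=> //; exact: lt_le_trans j0 xij.
move=> r n r0; split=> [[s [us sn sr]]|[s [us sn sr]]].
- have gex k : exists j, k \in s -> good k j /\ x j = r.
    have [ks|] := boolP (k \in s); last by exists 0%N.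
    have [|j gj yj] := @y_gt0 k; first by rewrite sr.
    by exists j; rewrite -yj sr.
  have [g hg] := choice gex.
  exists (map g s); split; last 1 first.
  + by move=> _ /mapP[k /hg[_ xr] ->].
  + rewrite map_inj_in_uniq // => k l /hg[[_ rk] _] /hg[[_ rl] _] gkl.
    by move: rk; rewrite gkl => /rank_fun; apply.
  + by rewrite size_map.
- have fex j : exists k, j \in s -> rank j k.
    have [js|] := boolP (j \in s); last by exists 0%N.
    have [|k rk] := @rank_ex j; first by rewrite sr.
    by exists k.
  have [f hf] := choice fex.
  exists (map f s); split; last 1 first.
  + move=> _ /mapP[j js ->]; rewrite (@y_good _ j) ?sr //.
    by split; [rewrite sr | exact: hf].
  + rewrite map_inj_in_uniq // => i j /hf ri /hf rj fij.
    by move: ri; rewrite fij => /rank_inj; apply.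
  + by rewrite size_map.
Qed.

End SortExists.

Lemma sortdescP x : sortable x -> is_sortdesc x (sortdesc x).
Proof. by move=> /sortdesc_exists ex; exact: ClassicalEpsilon.epsilon_spec. Qed.

Lemma sumsto_sortable x l : (forall i, 0 <= x i) -> sumsto x l -> sortable x.
Proof.
move=> x0 /(sumsto_nneg _ x0)[ub lb] j xj.
have [N hN] := lb _ xj; exists N => i xji; rewrite ltnNge; apply/negP => Ni.
have := ub i.+1; rewrite big_ord_recr /=; have := sum_ord_le x0 Ni; lra.
Qed.

Lemma Om_sortdesc x : (forall i, 0 <= x i) -> sumsto x 1 -> Om (sortdesc x).
Proof.
move=> x0 sx; have [y0 yd h] := sortdescP (sumsto_sortable x0 sx).
split=> //; apply: sumsto_mult sx => //.
  by move=> r n r0; rewrite h.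
by move=> r n r0; rewrite h.
Qed.

End Sequences.

(** * Matching *)

Section Matching.
Variable R : realType.
Implicit Types (x y Y Z : nat -> R) (r : R).

Definition mt Y Z : pred nat := fun i => `[< matched Y Z i >].
Arguments mt : simpl never.

Lemma tleftE Y Z i : tleft Y Z i =
  if mt Y Z i then 1 - Qmatch Y Z + \sum_(j < i | mt Y Z j) Y j
  else \sum_(j < i | ~~ mt Y Z j) Y j.
Proof. by []. Qed.

Lemma mtE Y Z i : Om Z -> 0 < Y i ->
  mt Y Z i = (match_rank Y i <= mult Z (Y i))%N.
Proof.
move=> oZ Yi; apply/asboolP/idP; by move/(atleast_mult _ oZ Yi).
Qed.

Lemma iota0S n : iota 0 n.+1 = rcons (iota 0 n) n.
Proof. by rewrite -addn1 iotaD add0n cats1. Qed.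

Lemma count_iotaS (p : pred nat) n :
  count p (iota 0 n.+1) = (count p (iota 0 n) + p n)%N.
Proof. by rewrite iota0S -cats1 count_cat /= addn0. Qed.

Lemma match_rankS Y r n : Y n = r ->
  match_rank Y n = (count (fun j => Y j == r) (iota 0 n)).+1.
Proof. by move=> yr; rewrite /match_rank count_iotaS yr eqxx addn1. Qed.

(** The [k]-th occurrence of [r] in [Y] is matched exactly when [k <= mult Z r]. From here on
    matched and unmatched entries are handled through multiplicities. *)
Lemma count_matched Y Z r n : Om Z -> 0 < r ->
  count (fun i => (Y i == r) && mt Y Z i) (iota 0 n) =
  minn (count (fun i => Y i == r) (iota 0 n)) (mult Z r).
Proof.
move=> oZ r0; elim: n => [|n IH]; first by rewrite /= min0n.
rewrite !count_iotaS IH; have [yr|_] := eqVneq (Y n) r; last by rewrite /= !addn0.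
by rewrite /= mtE ?yr // (match_rankS yr); lia.
Qed.

Lemma count_unmatched Y Z r n : Om Z -> 0 < r ->
  count (fun i => (Y i == r) && ~~ mt Y Z i) (iota 0 n) =
  (count (fun i => Y i == r) (iota 0 n) - mult Z r)%N.
Proof.
move=> oZ r0; elim: n => [|n IH]; first by [].
rewrite !count_iotaS IH; have [yr|_] := eqVneq (Y n) r; last by rewrite /= !addn0.
by rewrite /= mtE ?yr // (match_rankS yr); lia.
Qed.

Lemma match_rank_le Y a : Om Y -> 0 < Y a -> (match_rank Y a <= mult Y (Y a))%N.
Proof.
move=> oY Ya; apply/(atleast_mult _ oY Ya).
exists [seq j <- iota 0 a.+1 | Y j == Y a]; split.
- exact/filter_uniq/iota_uniq.
- by rewrite size_filter.
- by move=> j; rewrite mem_filter => /andP[/eqP].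
Qed.

Lemma unmatched_seq Y Z r (s : seq nat) : Om Y -> Om Z -> 0 < r -> uniq s ->
  (forall i, i \in s -> Y i = r /\ ~~ mt Y Z i) ->
  (size s <= mult Y r - mult Z r)%N.
Proof.
move=> oY oZ r0 us hs.
have [N sN] := seq_bounded s.
pose M := maxn N (Num.truncn r^-1).+1.
have -> : mult Y r = count (fun i => Y i == r) (iota 0 M).
  by apply: mult_count => // i /(Om_index_lt oY r0) h; rewrite leq_max h orbT.
rewrite -count_unmatched // -size_filter; apply: uniq_leq_size => // i si.
have [h1 h2] := hs _ si.
by rewrite mem_filter /= h1 eqxx h2 /= mem_iota /= add0n leq_max sN.
Qed.

Lemma unmatched_ex Y Z r k : Om Y -> Om Z -> 0 < r ->
  (k <= mult Y r - mult Z r)%N ->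
  exists s, [/\ uniq s, size s = k & forall i, i \in s -> Y i = r /\ ~~ mt Y Z i].
Proof.
move=> oY oZ r0; rewrite {1}/mult -count_unmatched // -size_filter => h.
set l := seq.filter _ _ in h.
exists (take k l); split.
- by rewrite take_uniq // filter_uniq // iota_uniq.
- by rewrite size_takel.
- by move=> i /mem_take; rewrite mem_filter => /andP[/andP[/eqP -> ->]].
Qed.

Definition keep (p : pred nat) Y i : R := if p i then Y i else 0.

Lemma keep_ge0 p Y : (forall i, 0 <= Y i) -> forall i, 0 <= keep p Y i.
Proof. by move=> Y0 i; rewrite /keep; case: ifP. Qed.

Lemma sum_keep p Y n : \sum_(i < n) keep p Y i = \sum_(i < n | p i) Y i.
Proof. by rewrite [RHS]big_mkcond. Qed.

Lemma sumsto_lim Y : (forall i, 0 <= Y i) -> (forall n, \sum_(i < n) Y i <= 1) ->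
  sumsto Y (limn (fun n => \sum_(i < n) Y i)).
Proof.
move=> Y0 Y1; apply: nondecreasing_is_cvgn.
  by move=> m n mn; exact: sum_ord_le.
by exists 1 => _ [n _ <-].
Qed.

Lemma keep_le p Y n : (forall i, 0 <= Y i) ->
  \sum_(i < n) keep p Y i <= \sum_(i < n) Y i.
Proof. by move=> Y0; apply: ler_sum => i _; rewrite /keep; case: ifP. Qed.

Lemma sumsto_matched Y Z : Om Y -> sumsto (keep (mt Y Z) Y) (Qmatch Y Z).
Proof.
move=> oY; have [Y0 _ _] := oY.
have -> : Qmatch Y Z = limn (fun n => \sum_(i < n) keep (mt Y Z) Y i).
  by rewrite /Qmatch; congr (limn _); apply/funext => n; rewrite sum_keep.
apply: sumsto_lim => [|n]; first exact: keep_ge0.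
exact: le_trans (keep_le _ _ Y0) (Om_sum_le1 _ oY).
Qed.

Lemma sumsto_unmatched Y Z : Om Y ->
  sumsto (keep (fun i => ~~ mt Y Z i) Y) (1 - Qmatch Y Z).
Proof.
move=> oY; have [_ _ sY] := oY.
rewrite /sumsto.
have -> : (fun n => \sum_(i < n) keep (fun i => ~~ mt Y Z i) Y i) =
  (fun n => \sum_(i < n) Y i - \sum_(i < n) keep (mt Y Z) Y i).
  apply/funext => n; rewrite -sumrB; apply: eq_bigr => i _.
  by rewrite /keep; case: (mt Y Z i) => /=; rewrite ?subr0 ?subrr.
exact: (cvgB sY (@sumsto_matched Y Z oY)).
Qed.

Lemma atleast_keep_matched Y Z r n : Om Y -> Om Z -> 0 < r ->
  atleast (keep (mt Y Z) Y) r n <-> (n <= minn (mult Y r) (mult Z r))%N.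
Proof.
move=> oY oZ r0.
pose N := (Num.truncn r^-1).+1.
rewrite {1}/mult -count_matched //.
have -> : count (fun i => (Y i == r) && mt Y Z i) (iota 0 N) =
          count (fun i => keep (mt Y Z) Y i == r) (iota 0 N).
  apply: eq_count => i; rewrite /keep /=.
  by case: ifP => _; rewrite ?andbT // andbF lt_eqF.
apply: atleast_count => i; rewrite /keep; case: ifP => _ h.
  by apply: (Om_index_lt oY r0); rewrite h.
by rewrite -h ltxx in r0.
Qed.

Lemma submult_keep Y Z : Om Y -> Om Z ->
  submult (keep (mt Y Z) Y) (keep (mt Z Y) Z).
Proof.
move=> oY oZ r n r0 /(atleast_keep_matched _ oY oZ r0) h.
by apply/(atleast_keep_matched _ oZ oY r0); rewrite minnC.
Qed.

(** On both sides the matched entries form the same multiset, with multiplicities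
    [minn (mult Y r) (mult Z r)]. *)
Lemma Qmatch_sym Y Z : Om Y -> Om Z -> Qmatch Y Z = Qmatch Z Y.
Proof.
move=> oY oZ; have [Y0 _ _] := oY; have [Z0 _ _] := oZ.
have h : sumsto (keep (mt Z Y) Z) (Qmatch Y Z).
  apply: (@sumsto_mult _ (keep (mt Y Z) Y)); try exact: keep_ge0.
  - exact: submult_keep.
  - exact: submult_keep.
  - exact: sumsto_matched.
exact: (cvg_unique _ h (@sumsto_matched Z Y oZ)).
Qed.

Lemma match_rank_ex Z r k n : (0 < k <= count (fun i => Z i == r) (iota 0 n))%N ->
  exists2 i, Z i = r & match_rank Z i = k.
Proof.
elim: n => [|n IH]; first by case: k.
rewrite count_iotaS; have [zr|_] := eqVneq (Z n) r; last by rewrite addn0.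
have [kc|kc] := leqP k (count (fun i => Z i == r) (iota 0 n)).
  by move=> /andP[k0 _]; apply: IH; rewrite k0.
move=> /andP[k0 k1]; exists n => //; rewrite (match_rankS zr).
by move: k0 kc k1; rewrite /= addn1; lia.
Qed.

(** The partner is the entry of equal value and equal rank among its copies. As the matched parts of
    the two tilings thus agree interval by interval, a point of the matched part hits equal entries
    on both sides. *)
Lemma matched_corr Y Z a : Om Y -> Om Z -> 0 < Y a -> mt Y Z a ->
  exists a', [/\ Z a' = Y a, mt Z Y a' & tleft Z Y a' = tleft Y Z a].
Proof.
move=> oY oZ Ya ma; set r := Y a in Ya *.
have kZ : (match_rank Y a <= mult Z r)%N by rewrite -mtE.
have [|a' za' ka'] := @match_rank_ex Z r (match_rank Y a) (Num.truncn r^-1).+1.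
  by rewrite kZ andbT (@match_rankS _ r).
have ma' : mt Z Y a' by rewrite mtE ?za' // ka'; exact: match_rank_le.
exists a'; split=> //.
rewrite !tleftE ma ma' (Qmatch_sym oY oZ); congr (_ + _).
have E W V n : \sum_(j < n | mt W V j) W j =
    \sum_(z <- map W (seq.filter (mt W V) (iota 0 n))) z.
  by rewrite big_map big_filter -(big_mkord (mt W V) W) /index_iota subn0.
rewrite !E; apply: perm_big; apply/allP => r' r'in.
have r'r : r <= r'.
  move: r'in; rewrite mem_cat => /orP[] /mapP[j]; rewrite mem_filter mem_iota /= add0n.
    by move=> /andP[_ /ltnW ja] ->; rewrite -za'; exact: Om_noninc.
  by move=> /andP[_ /ltnW ja] ->; exact: Om_noninc.
have r'0 : 0 < r' := lt_le_trans Ya r'r.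
have C W V n : Om V -> count_mem r' (map W (seq.filter (mt W V) (iota 0 n))) =
   minn (count (fun i => W i == r') (iota 0 n)) (mult V r').
  by move=> oV; rewrite -count_matched // count_map count_filter.
rewrite /= !C //; apply/eqP.
(* Of the value [r] itself, both sides have placed one copy less than the common rank; of a larger
   value, both have already placed all the matched copies. *)
move: r'r; rewrite le_eqVlt => /orP[/eqP rr'|rr'].
  rewrite -rr'.
  have cY : (count (fun i => Y i == r) (iota 0 a)).+1 = match_rank Y a by rewrite (@match_rankS _ r).
  have cZ : (count (fun i => Z i == r) (iota 0 a')).+1 = match_rank Z a' by rewrite (@match_rankS _ r).
  have := match_rank_le oY Ya; rewrite -/r; lia.
have M W b : Om W -> W b = r -> count (fun i => W i == r') (iota 0 b) = mult W r'.
  move=> oW wb; rewrite -(mult_count oW r'0) // => i ri.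
  rewrite ltnNge; apply/negP => /(Om_noninc oW); rewrite wb => h.
  by move: (le_trans ri h); rewrite leNgt rr'.
by rewrite !M // minnC.
Qed.

End Matching.
Arguments mt {R} Y Z : simpl never.

Lemma leastP (P : nat -> Prop) : (exists n, P n) -> P (least P).
Proof.
move=> [n Pn].
have ex : exists n, `[< P n >] by exists n; exact/asboolP.
have : exists n, P n /\ forall m, P m -> (n <= m)%N.
  case: (ex_minnP ex) => m /asboolP Pm hm; exists m; split=> // k Pk.
  by apply: hm; exact/asboolP.
by move=> /(ClassicalEpsilon.epsilon_spec (inhabits 0%N))[].
Qed.

(** * The tilings and the indices a, b *)

Section Geometry.
Variable R : realType.
Implicit Types (L Y Z : nat -> R) (u v : R).

Definition inb L Y u i := L i < u < L i + Y i.

Definition ntied L Y u := forall i, u != L i /\ u != L i + Y i.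

Lemma ntied_inb L Y u i : ntied L Y u -> L i <= u <= L i + Y i -> inb L Y u i.
Proof.
move=> /(_ i)[h1 h2] /andP[h3 h4].
by rewrite /inb !lt_neqAle h3 h4 h2 eq_sym h1.
Qed.

Lemma inb_gt0 L Y u i : inb L Y u i -> 0 < Y i.
Proof. by rewrite /inb => /andP[]; lra. Qed.

Section OneSide.
Variables (Y Z : nat -> R).
Hypotheses (oY : Om Y) (oZ : Om Z).
Let s := 1 - Qmatch Y Z.
Let Y0 i : 0 <= Y i := Om_ge0 i oY.

Lemma tleft_unmatched i : ~~ mt Y Z i -> 0 <= tleft Y Z i /\ tleft Y Z i + Y i <= s.
Proof.
move=> mi; rewrite tleftE (negbTE mi); split; first by apply: sumr_ge0.
have [ub _] := (sumsto_nneg _ (keep_ge0 _ Y0)).1 (@sumsto_unmatched _ Y Z oY).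
by have := ub i.+1; rewrite big_ord_recr /= sum_keep /keep mi.
Qed.

Lemma tleft_matched i : mt Y Z i -> s <= tleft Y Z i /\ tleft Y Z i + Y i <= 1.
Proof.
move=> mi; rewrite tleftE mi; split; first by rewrite lerDl; apply: sumr_ge0.
have [ub _] := (sumsto_nneg _ (keep_ge0 _ Y0)).1 (@sumsto_matched _ Y Z oY).
have := ub i.+1; rewrite big_ord_recr /= sum_keep /keep /= mi; lra.
Qed.

Lemma unmatched_mass_ge0 : 0 <= s <= 1.
Proof.
have [ub _] := (sumsto_nneg _ (keep_ge0 _ Y0)).1 (@sumsto_matched _ Y Z oY).
have [ub' _] := (sumsto_nneg _ (keep_ge0 _ Y0)).1 (@sumsto_unmatched _ Y Z oY).
have := ub 0%N; have := ub' 0%N; rewrite !big_ord0 /s; lra.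
Qed.

Lemma tleft_ge0 i : 0 <= tleft Y Z i.
Proof.
have [/tleft_matched[+ _]|/tleft_unmatched[//]] := boolP (mt Y Z i).
by apply: le_trans; have /andP[] := unmatched_mass_ge0.
Qed.

Lemma tright_le1 i : tleft Y Z i + Y i <= 1.
Proof.
have [/tleft_matched[//]|/tleft_unmatched[_ +]] := boolP (mt Y Z i).
by move=> /le_trans; apply; have /andP[] := unmatched_mass_ge0.
Qed.

Lemma sum_cond_le (p : pred nat) i j : (i < j)%N -> p i ->
  \sum_(k < i | p k) Y k + Y i <= \sum_(k < j | p k) Y k.
Proof.
move=> ij pi; have := sum_ord_le (keep_ge0 p Y0) ij.
by rewrite big_ord_recr /= !sum_keep {1}/keep pi.
Qed.

Lemma tleft_order i j : i != j ->
  tleft Y Z i + Y i <= tleft Y Z j \/ tleft Y Z j + Y j <= tleft Y Z i.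
Proof.
have [mi|mi] := boolP (mt Y Z i); have [mj|mj] := boolP (mt Y Z j).
- rewrite neq_ltn => /orP[] ij; [left|right]; rewrite !tleftE mi mj -addrA lerD2l.
    exact: sum_cond_le.
  exact: sum_cond_le.
- move=> _; right; exact: le_trans (tleft_unmatched mj).2 (tleft_matched mi).1.
- move=> _; left; exact: le_trans (tleft_unmatched mi).2 (tleft_matched mj).1.
- rewrite neq_ltn => /orP[] ij; [left|right]; rewrite !tleftE (negbTE mi) (negbTE mj).
    exact: (@sum_cond_le (fun k => ~~ mt Y Z k)).
  exact: (@sum_cond_le (fun k => ~~ mt Y Z k)).
Qed.

Lemma tleft_uniq u i j : inb (tleft Y Z) Y u i -> inb (tleft Y Z) Y u j -> i = j.
Proof.
rewrite /inb => /andP[h1 h2] /andP[h3 h4]; apply/eqP/negPn/negP => /tleft_order[]; lra.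
Qed.

(** At the first partial sum that exceeds [u], the last index added satisfies [p], since otherwise
    the previous partial sum would already exceed [u]. *)
Lemma cover_aux (p : pred nat) (l u : R) : sumsto (keep p Y) l -> 0 < u < l ->
  exists2 i, p i & \sum_(j < i | p j) Y j <= u <= \sum_(j < i | p j) Y j + Y i.
Proof.
move=> /(sumsto_nneg _ (keep_ge0 _ Y0))[_ lb] /andP[u0 ul].
have ex : exists n, u < \sum_(i < n) keep p Y i.
  have [|n hn] := lb (l - u); first by rewrite subr_gt0.
  by exists n; move: hn; rewrite subKr.
case: (ex_minnP ex) => -[|i] ui hi; first by rewrite big_ord0 ltNge (ltW u0) in ui.
have hle : \sum_(j < i) keep p Y j <= u.
  by rewrite leNgt; apply/negP => /hi; rewrite ltnn.
have pi : p i.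
  apply/negPn/negP => pi; move: ui; rewrite big_ord_recr /= {2}/keep (negbTE pi); lra.
exists i => //; move: ui hle; rewrite big_ord_recr /= !sum_keep /keep pi; lra.
Qed.

Lemma tleft_cover u : 0 < u < 1 -> u != s ->
  exists2 i, mt Y Z i = (s < u) & tleft Y Z i <= u <= tleft Y Z i + Y i.
Proof.
move=> /andP[u0 u1]; rewrite neq_lt => /orP[us|su].
- have [||i mi hi] := @cover_aux (fun i => ~~ mt Y Z i) s u.
  + exact: sumsto_unmatched.
  + by rewrite u0.
  by exists i; rewrite ?tleftE ?(negbTE mi) // ltNge (ltW us).
- have [||i mi hi] := @cover_aux (mt Y Z) (Qmatch Y Z) (u - s).
  + exact: sumsto_matched.
  + by rewrite subr_gt0 su /= /s; lra.
  exists i; rewrite ?tleftE mi ?su // -/s; lra.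
Qed.

(** Excludes end points of intervals and the border between the unmatched and the matched part, so
    that exactly one interval contains [u] and the choice made by [least] is irrelevant. *)
Definition genericU u := [/\ 0 < u < 1, u != s & ntied (tleft Y Z) Y u].

Lemma idx_aP u : genericU u ->
  inb (tleft Y Z) Y u (idx_a Y Z u) /\ mt Y Z (idx_a Y Z u) = (s < u).
Proof.
move=> [u01 us nt]; have [i mi hi] := tleft_cover u01 us.
have ii := ntied_inb nt hi.
have ia : inb (tleft Y Z) Y u (idx_a Y Z u).
  apply: ntied_inb => //.
  exact: (@leastP (fun i => tleft Y Z i <= u <= tleft Y Z i + Y i) (ex_intro _ i hi)).
by rewrite -(tleft_uniq ii ia).
Qed.

Lemma idx_a_eq u i : genericU u -> inb (tleft Y Z) Y u i -> idx_a Y Z u = i.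
Proof. by move=> /idx_aP[+ _]; exact: tleft_uniq. Qed.

(** As entries decrease, the first unmatched index carries the largest unmatched entry, and its
    interval starts at [0]. This is how small values of [u] are known to hit the largest unmatched
    piece. *)
Lemma inb_first u i : ~~ mt Y Z i -> (forall j, ~~ mt Y Z j -> (i <= j)%N) ->
  0 < u < Y i -> inb (tleft Y Z) Y u i.
Proof.
move=> mi hi h; rewrite /inb tleftE (negbTE mi) big1 ?add0r // => j mj.
by have := hi _ mj; rewrite leqNgt ltn_ord.
Qed.

Section Hat.
Variable u : R.
Hypothesis gu : genericU u.
Notation a := (idx_a Y Z u).
Notation A := (Y (idx_a Y Z u)).

Lemma hleftE i : hleft Y Z u i = if i == a then 0
  else if tleft Y Z i < tleft Y Z a then tleft Y Z i + A else tleft Y Z i.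
Proof. by []. Qed.

Lemma hleft_a : hleft Y Z u a = 0. Proof. by rewrite hleftE eqxx. Qed.

Lemma hleft_cases i : i != a -> 0 < Y i ->
  (tleft Y Z i + Y i <= tleft Y Z a /\ hleft Y Z u i = tleft Y Z i + A) \/
  (tleft Y Z a + A <= tleft Y Z i /\ hleft Y Z u i = tleft Y Z i).
Proof.
move=> ia Yi; rewrite hleftE (negbTE ia).
have A0 : 0 < A by exact: inb_gt0 (idx_aP gu).1.
have [h|h] := tleft_order ia.
  by left; split=> //; rewrite ifT //; lra.
by right; split=> //; rewrite ifF //; apply/negbTE; rewrite -leNgt; lra.
Qed.

Lemma hleft_range i : 0 < Y i -> 0 <= hleft Y Z u i /\ hleft Y Z u i + Y i <= 1.
Proof.
move=> Yi; have [->|ia] := eqVneq i a.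
  by rewrite hleft_a add0r; split=> //; exact: Om_le1.
have := tleft_ge0 i; have := tright_le1 i; have := tright_le1 a; have := Y0 a.
by have [[h ->]|[h ->]] := hleft_cases ia Yi; lra.
Qed.

Lemma hleft_uniq v i j : inb (hleft Y Z u) Y v i -> inb (hleft Y Z u) Y v j -> i = j.
Proof.
move=> hi hj; have Yi := inb_gt0 hi; have Yj := inb_gt0 hj.
move: hi hj; rewrite /inb => /andP[h1 h2] /andP[h3 h4].
apply/eqP/negPn/negP => ij.
have ti := tleft_ge0 i; have tj := tleft_ge0 j; have ta := tleft_ge0 a.
have [ia|ia] := eqVneq i a; have [ja|ja] := eqVneq j a.
- by rewrite ia ja eqxx in ij.
- move: h1 h2; rewrite ia hleft_a; have [[h hE]|[h hE]] := hleft_cases ja Yj; lra.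
- move: h3 h4; rewrite ja hleft_a; have [[h hE]|[h hE]] := hleft_cases ia Yi; lra.
- have [[h hE]|[h hE]] := hleft_cases ia Yi; have [[h' hE']|[h' hE']] := hleft_cases ja Yj;
    have [hij|hij] := tleft_order ij; lra.
Qed.

(** Besides the end points of the rearranged intervals, [v] avoids the border [s] of the unmatched
    part and its translate by [A], because [tleft_cover] is applied to [v] or to [v - A], and it
    avoids the point that separates these two cases. *)
Definition genericV v := [/\ 0 < v < 1, v != s, v != s + A, v != tleft Y Z a + A &
  ntied (hleft Y Z u) Y v].

Lemma hleft_cover v : genericV v ->
  exists i, hleft Y Z u i <= v <= hleft Y Z u i + Y i.
Proof.
move=> [/andP[v0 v1] vs vsA vtA nt].
have [ia ma] := idx_aP gu; have A0 := inb_gt0 ia.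
have [vA|vA] := ltP v A.
  by exists a; rewrite hleft_a add0r (ltW v0) (ltW vA).
have ta := tleft_ge0 a; have ta1 := tright_le1 a.
have vA' : A < v.
  by rewrite lt_def vA andbT; have [_ +] := nt a; rewrite hleft_a add0r.
move: vtA; rewrite neq_lt => /orP[vl|vr].
(* Points between [A] and the old right end of the moved interval come from points shifted by [A];
   points beyond that end did not move. *)
- have [||i _ /andP[h1 h2]] := @tleft_cover (v - A); first lra.
    by rewrite subr_eq.
  have ia' : i != a.
    by apply/eqP => E; move: h1 h2; rewrite E; lra.
  exists i; rewrite hleftE (negbTE ia') ifT; last by lra.
  by lra.
- have [||i _ /andP[h1 h2]] := @tleft_cover v; first lra.
    by [].
  have ia' : i != a.
    by apply/eqP => E; move: h1 h2; rewrite E; lra.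
  have nlt : tleft Y Z i < tleft Y Z a = false.
    by apply/negbTE; rewrite -leNgt; have [] := tleft_order ia'; lra.
  by exists i; rewrite hleftE (negbTE ia') nlt; lra.
Qed.

Lemma idx_bP v : genericV v -> inb (hleft Y Z u) Y v (idx_b Y Z u v).
Proof.
move=> gv; have [_ _ _ _ nt] := gv.
apply: ntied_inb => //.
exact: (@leastP (fun i => hleft Y Z u i <= v <= hleft Y Z u i + Y i) (hleft_cover gv)).
Qed.

Lemma idx_b_eq v i : genericV v -> inb (hleft Y Z u) Y v i -> idx_b Y Z u v = i.
Proof. by move=> /idx_bP; exact: hleft_uniq. Qed.

Lemma idx_b_a v : genericV v -> (idx_b Y Z u v == a) = (v < A).
Proof.
move=> gv; have hb := idx_bP gv; have [/andP[v0 _] _ _ _ _] := gv.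
apply/eqP/idP => [E|vA]; first by move: hb; rewrite E /inb hleft_a add0r => /andP[].
by apply: idx_b_eq => //; rewrite /inb hleft_a add0r v0.
Qed.

(** Moving a matched interval to the front shifts the whole unmatched part by [A], so the border
    moves to [s + A]. Moving an unmatched interval permutes [[0, s]] and leaves the border at
    [s]. *)
Lemma idx_b_mt v : genericV v -> idx_b Y Z u v != a ->
  mt Y Z (idx_b Y Z u v) = (if s < u then s + A < v else s < v).
Proof.
move=> gv ba; have hb := idx_bP gv; set b := idx_b Y Z u v in ba hb *.
have Yb := inb_gt0 hb; have /andP[h1 h2] := hb.
have [ia ma] := idx_aP gu; have A0 := inb_gt0 ia; rewrite -ma.
have [mb|mb] := boolP (mt Y Z b); have [ma'|ma'] := boolP (mt Y Z a); apply/esym.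
- have [] := tleft_matched mb; have [] := tleft_matched ma'.
  by have [[h hE]|[h hE]] := hleft_cases ba Yb; lra.
- have [] := tleft_matched mb; have [] := tleft_unmatched ma'.
  by have [[h hE]|[h hE]] := hleft_cases ba Yb; lra.
- apply/negbTE; rewrite -leNgt.
  have [] := tleft_unmatched mb; have [] := tleft_matched ma'.
  by have [[h hE]|[h hE]] := hleft_cases ba Yb; lra.
- apply/negbTE; rewrite -leNgt.
  have [] := tleft_unmatched mb; have [] := tleft_unmatched ma'.
  by have [[h hE]|[h hE]] := hleft_cases ba Yb; lra.
Qed.

End Hat.
End OneSide.

Section Pair.
Variables (Y Z : nat -> R).
Hypotheses (oY : Om Y) (oZ : Om Z).

Lemma idx_a_matched u : genericU Y Z u -> genericU Z Y u -> mt Y Z (idx_a Y Z u) ->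
  Z (idx_a Z Y u) = Y (idx_a Y Z u) /\
  tleft Z Y (idx_a Z Y u) = tleft Y Z (idx_a Y Z u).
Proof.
move=> gu gu' ma; have [ia _] := idx_aP oY gu.
have [a' [za' _ ta']] := matched_corr oY oZ (inb_gt0 ia) ma.
have -> : idx_a Z Y u = a'.
  by apply: idx_a_eq => //; move: ia; rewrite /inb za' ta'.
by [].
Qed.

(** The rearrangement keeps the matched intervals of the two sides aligned: either both sides move
    the same matched interval, or both move an unmatched one, which leaves the matched part in
    place. *)
Lemma idx_b_matched u v : genericU Y Z u -> genericU Z Y u -> genericV Y Z u v -> genericV Z Y u v ->
  idx_b Y Z u v != idx_a Y Z u -> mt Y Z (idx_b Y Z u v) ->
  Z (idx_b Z Y u v) = Y (idx_b Y Z u v).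
Proof.
move=> gu gu' gv gv' ba mb.
have hb := idx_bP oY gu gv; have Yb := inb_gt0 hb.
have [b' [zb' mb' tb']] := matched_corr oY oZ Yb mb.
suff -> : idx_b Z Y u v = b' by [].
apply: idx_b_eq => //; move: hb; rewrite /inb zb'.
have [ia mai] := idx_aP oY gu; have [ia' mai'] := idx_aP oZ gu'.
(* Were the partner of [b] the interval moved on the [Z] side, that interval would be matched; then
   [u] would lie in [b] as well, forcing [b = a]. *)
have b'a' : b' != idx_a Z Y u.
  apply/eqP => E; have mia' : mt Z Y (idx_a Z Y u) by rewrite -E.
  have mia : mt Y Z (idx_a Y Z u) by rewrite mai (Qmatch_sym oY oZ) -mai'.
  have [h1 h2] := idx_a_matched gu gu' mia.
  move/eqP: ba; apply; apply: (tleft_uniq oY _ ia).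
  by move: ia' ; rewrite /inb -E zb' tb'.
suff -> : hleft Z Y u b' = hleft Y Z u (idx_b Y Z u v) by [].
rewrite !hleftE (negbTE ba) (negbTE b'a') tb'.
have [mia|mia] := boolP (mt Y Z (idx_a Y Z u)).
  by have [-> ->] := idx_a_matched gu gu' mia.
have mia' : ~~ mt Z Y (idx_a Z Y u) by rewrite mai' -(Qmatch_sym oY oZ) -mai.
have [_ h1] := tleft_unmatched oY mia; have [_ h2] := tleft_unmatched oZ mia'.
have [h3 _] := tleft_matched oY mb.
have := inb_gt0 ia; have := inb_gt0 ia'; rewrite -(Qmatch_sym oY oZ) in h2 => p1 p2.
by rewrite !ifF //; apply/negbTE; rewrite -leNgt; lra.
Qed.

End Pair.
End Geometry.

(** Absolute difference written with truncated subtraction: each summand is the number of unmatched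
    copies on one of the sides, and one of the two vanishes. *)
Definition dist (m n : nat) := ((m - n) + (n - m))%N.

(** Generalizes truth values and multiplicities to arbitrary natural numbers, so that the goal
    becomes linear arithmetic. *)
Ltac natlia :=
  rewrite ?/dist /= ?addn0;
  repeat match goal with |- context [nat_of_bool ?b] => move: (nat_of_bool b) => ? end;
  repeat match goal with |- context [mult ?Y ?r] => move: (mult Y r) => ? end;
  clear; lia.

(** * Multiplicities after one step *)

Section Moves.
Variable R : realType.
Implicit Types (Y Z : nat -> R) (r u v : R).

(** Used with [f = id] for the total mass and with [f] the indicator of a value for multiplicities;
    the term [f 0] stems from the emptied slot [b]. *)
Lemma sum_merge (f : R -> R) Y a b N : a != b -> (a < N)%N -> (b < N)%N ->
  \sum_(i < N) f (merge_seq Y a b i) =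
  \sum_(i < N) f (Y i) - f (Y a) - f (Y b) + f (Y a + Y b) + f 0.
Proof.
move=> ab aN bN; pose a' := Ordinal aN; pose b' := Ordinal bN.
have ba' : b' != a' by rewrite -val_eqE /= eq_sym.
rewrite (bigD1 a') // (bigD1 b') //= [in RHS](bigD1 a') // [in RHS](bigD1 b') //=.
rewrite (eq_bigr (fun i : 'I_N => f (Y i))); last first.
  move=> i /andP[ia ib]; rewrite /merge_seq.
  by rewrite -[(i : nat) == a]/(i == a') (negbTE ia) -[(i : nat) == b]/(i == b') (negbTE ib).
rewrite /merge_seq eqxx eq_sym (negbTE ab) eqxx; lra.
Qed.

Lemma sum_split (f : R -> R) Y a v N : (a < N)%N ->
  \sum_(i < N.+1) f (split_seq Y a v i) =
  \sum_(i < N) f (Y i) - f (Y a) + f v + f (Y a - v).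
Proof.
move=> aN; pose a' := Ordinal aN.
rewrite big_ord_recl /= (bigD1 a') //= [in RHS](bigD1 a') //= eqxx.
rewrite (eq_bigr (fun i : 'I_N => f (Y i))); first lra.
by move=> i ia; rewrite -[(i : nat) == a]/(i == a') (negbTE ia).
Qed.

Lemma sumsto_shift (x y : nat -> R) (k N : nat) (l : R) : (forall i, 0 <= x i) -> (forall i, 0 <= y i) ->
  sumsto x l -> (forall n, (N <= n)%N -> \sum_(i < n + k) y i = \sum_(i < n) x i) ->
  sumsto y l.
Proof.
move=> x0 y0 /(sumsto_nneg _ x0)[ub lb] h; apply/(sumsto_nneg _ y0); split=> [n|e e0].
  have le : (n <= maxn N n + k)%N by apply: leq_trans (leq_addr _ _); exact: leq_maxr.
  by apply: le_trans (sum_ord_le y0 le) _; rewrite h ?leq_maxl.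
have [n hn] := lb _ e0; exists (maxn N n + k)%N.
rewrite h ?leq_maxl //; apply: lt_le_trans hn _.
by apply: sum_ord_le => //; exact: leq_maxr.
Qed.

Lemma count_natr (p : pred nat) N :
  (count p (iota 0 N))%:R = \sum_(i < N) (p i)%:R :> R.
Proof.
elim: N => [|N IH]; first by rewrite big_ord0.
by rewrite count_iotaS natrD IH big_ord_recr.
Qed.

Section OneMove.
Variable Y : nat -> R.
Hypothesis oY : Om Y.
Let Y0 i : 0 <= Y i := Om_ge0 i oY.

Lemma merge_ge0 a b i : 0 <= merge_seq Y a b i.
Proof. by rewrite /merge_seq; case: eqP => _; [exact: addr_ge0|case: eqP]. Qed.

Lemma split_ge0 a v i : 0 < v < Y a -> 0 <= split_seq Y a v i.
Proof. by move=> hv; case: i => [|i] /=; [|case: eqP => _ //]; lra. Qed.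

Lemma sumsto_merge a b : a != b -> sumsto (merge_seq Y a b) 1.
Proof.
move=> ab; have [_ _ sY] := oY.
apply: (@sumsto_shift Y _ 0 (maxn a b).+1) => //; first exact: merge_ge0.
move=> n; rewrite gtn_max addn0 => /andP[an bn].
rewrite (@sum_merge id) //; lra.
Qed.

Lemma sumsto_split a v : 0 < v < Y a -> sumsto (split_seq Y a v) 1.
Proof.
move=> hv; have [_ _ sY] := oY.
apply: (@sumsto_shift Y _ 1 a.+1) => //; first by move=> i; exact: split_ge0.
move=> n an; rewrite addn1 (@sum_split id) //; lra.
Qed.

Lemma mult_merge a b r : a != b -> 0 < r ->
  (mult (sortdesc (merge_seq Y a b)) r + (Y a == r) + (Y b == r) =
   mult Y r + (Y a + Y b == r)%R)%N.
Proof.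
move=> ab r0; have sm := sumsto_merge ab.
pose N := maxn (maxn a b).+1 (Num.truncn r^-1).+1.
have [aN bN] : (a < N /\ b < N)%N by rewrite /N; lia.
have YN i : r <= Y i -> (i < N)%N.
  by move=> /(Om_index_lt oY r0) h; rewrite /N leq_max h orbT.
rewrite (@mult_sort _ (merge_seq Y a b) _ r N) //; last first.
- move=> i; rewrite /merge_seq; case: eqP => [-> //|_]; case: eqP => [-> //|_] h.
  by apply: YN; rewrite h.
- exact/sortdescP/(sumsto_sortable (merge_ge0 a b) sm).
- exact: Om_sortdesc (merge_ge0 a b) sm.
rewrite (@mult_count _ Y r N) //.
apply/eqP; rewrite -(eqr_nat R) !natrD !count_natr.
rewrite (@sum_merge (fun x => (x == r)%:R)) // [0 == r]lt_eqF //; apply/eqP; rewrite mulr0n; lra.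
Qed.

Lemma mult_split a v r : 0 < v < Y a -> 0 < r ->
  (mult (sortdesc (split_seq Y a v)) r + (Y a == r) =
   mult Y r + (v == r) + (Y a - v == r)%R)%N.
Proof.
move=> hv r0; have sm := sumsto_split hv.
pose N := maxn a.+1 (Num.truncn r^-1).+1.
have aN : (a < N)%N by rewrite /N; lia.
have YN i : r <= Y i -> (i < N)%N.
  by move=> /(Om_index_lt oY r0) h; rewrite /N leq_max h orbT.
rewrite (@mult_sort _ (split_seq Y a v) _ r N.+1) //; last first.
- move=> [|i] //=; case: eqP => [-> //|_] h.
  by rewrite ltnS; apply: YN; rewrite h.
- by apply/sortdescP/(sumsto_sortable _ sm) => i; exact: split_ge0.
- by apply: Om_sortdesc sm => i; exact: split_ge0.
rewrite (@mult_count _ Y r N) //.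
have := @count_natr (fun i => split_seq Y a v i == r) N.+1.
have := @count_natr (fun i => Y i == r) N.
rewrite (@sum_split (fun x => (x == r)%:R) Y a v N aN).
move: (count _ _) (count _ _) => c c' E E'.
by apply/eqP; rewrite -(eqr_nat R) !natrD E'; apply/eqP; lra.
Qed.

End OneMove.

Section Step.
Variables (Y Z : nat -> R) (u v : R).
Hypotheses (oY : Om Y) (oZ : Om Z).
Hypotheses (gu : genericU Y Z u) (gu' : genericU Z Y u) (gv : genericV Y Z u v) (gv' : genericV Z Y u v).

Lemma new_seq_split : v < Y (idx_a Y Z u) ->
  new_seq Y Z u v = sortdesc (split_seq Y (idx_a Y Z u) v).
Proof. by rewrite /new_seq eq_sym -(idx_b_a oY gu gv) => ->. Qed.

Lemma new_seq_merge : Y (idx_a Y Z u) <= v ->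
  new_seq Y Z u v = sortdesc (merge_seq Y (idx_a Y Z u) (idx_b Y Z u v)).
Proof. by rewrite leNgt /new_seq eq_sym -(idx_b_a oY gu gv) => ->. Qed.

Lemma Om_new_seq : Om (new_seq Y Z u v).
Proof.
have [/andP[v0 _] _ _ _ _] := gv.
have [vA|vA] := ltP v (Y (idx_a Y Z u)).
  rewrite new_seq_split //; apply: Om_sortdesc.
    by move=> i; apply: split_ge0; rewrite // v0.
  by apply: sumsto_split; rewrite ?v0.
rewrite new_seq_merge //; apply: Om_sortdesc => [i|]; first exact: merge_ge0.
by apply: sumsto_merge => //; rewrite eq_sym idx_b_a // -leNgt.
Qed.

Lemma mult_new_split r : v < Y (idx_a Y Z u) -> 0 < r ->
  (mult (new_seq Y Z u v) r + (Y (idx_a Y Z u) == r) =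
   mult Y r + (v == r) + (Y (idx_a Y Z u) - v == r)%R)%N.
Proof.
move=> vA r0; have [/andP[v0 _] _ _ _ _] := gv.
by rewrite new_seq_split // mult_split // v0.
Qed.

Lemma mult_new_merge r : Y (idx_a Y Z u) <= v -> 0 < r ->
  (mult (new_seq Y Z u v) r + (Y (idx_a Y Z u) == r) + (Y (idx_b Y Z u v) == r) =
   mult Y r + (Y (idx_a Y Z u) + Y (idx_b Y Z u v) == r)%R)%N.
Proof.
move=> vA r0; rewrite new_seq_merge // mult_merge //.
by rewrite eq_sym idx_b_a // -leNgt.
Qed.

(* The unmatched entries hit by [u] or [v], listed once if [a = b]. *)
Definition hits : seq R :=
  let a := idx_a Y Z u in let b := idx_b Y Z u v in
  (if mt Y Z a then [::] else [:: Y a]) ++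
  (if (b == a) || mt Y Z b then [::] else [:: Y b]).

(** The hits are distinct unmatched entries. Thus removing them really lowers the truncated
    difference of multiplicities, instead of being absorbed by matched copies of the same value. *)
Lemma count_hits r : 0 < r -> (count_mem r hits <= mult Y r - mult Z r)%N.
Proof.
move=> r0; pose a := idx_a Y Z u; pose b := idx_b Y Z u v.
pose s := [seq i <- (if mt Y Z a then [::] else [:: a]) ++
  (if (b == a) || mt Y Z b then [::] else [:: b]) | Y i == r].
have -> : count_mem r hits = size s.
  rewrite size_filter /hits !count_cat -/a -/b.
  by congr addn; case: ifP.
apply: unmatched_seq => //.
  apply: filter_uniq; case: ifP => _; case: ifP => //= + ; rewrite in_cons orbF eq_sym.
  by move=> /norP[/negbTE ->].
move=> i; rewrite mem_filter mem_cat => /andP[/eqP -> /orP[]].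
  by case: ifP => // /negbT h; rewrite in_cons orbF => /eqP ->.
by case: ifP => // /negbT /norP[_ h]; rewrite in_cons orbF => /eqP ->.
Qed.

End Step.

Section StepPair.
Variables (Y Z : nat -> R) (u v : R).
Hypotheses (oY : Om Y) (oZ : Om Z).
Hypotheses (gu : genericU Y Z u) (gu' : genericU Z Y u) (gv : genericV Y Z u v) (gv' : genericV Z Y u v).
Notation A := (Y (idx_a Y Z u)).
Notation A' := (Z (idx_a Z Y u)).
Notation s := (1 - Qmatch Y Z).

(** [Pl] collects the created pieces that are not created on both sides alike. There is an
    inequality rather than an equality because such a piece may happen to be matched by an entry
    already present on the other side. The last two clauses provide the drop by two and the birth of
    a piece. *)
Lemma step_multiplicities : exists Pl : seq R,
  [/\ forall r, 0 < r ->
       (dist (mult (new_seq Y Z u v) r) (mult (new_seq Z Y u v) r) +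
        count_mem r (hits Y Z u v ++ hits Z Y u v) <=
        dist (mult Y r) (mult Z r) + count_mem r Pl)%N,
      (size Pl <= size (hits Y Z u v ++ hits Z Y u v))%N /\ (size Pl <= 3)%N,
      u < s -> Num.max A A' < v < s ->
        size (hits Y Z u v ++ hits Z Y u v) = 4 /\ size Pl = 2 &
      u < s -> v < Num.max A A' -> Num.max A A' - v \in Pl].
Proof.
have QE := Qmatch_sym oY oZ.
have [ia ma] := idx_aP oY gu; have [ia' ma'] := idx_aP oZ gu'.
have ba := idx_b_a oY gu gv; have ba' := idx_b_a oZ gu' gv'.
have mb := idx_b_mt oY gu gv; have mb' := idx_b_mt oZ gu' gv'.
rewrite -QE in ma' mb'.
have cY r (r0 : 0 < r) := @count_hits Y Z u v oY oZ r r0.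
have cZ r (r0 : 0 < r) := @count_hits Z Y u v oZ oY r r0.
have sY r := mult_new_split oY gu gv (r := r); have sZ r := mult_new_split oZ gu' gv' (r := r).
have jY r := mult_new_merge oY gu gv (r := r); have jZ r := mult_new_merge oZ gu' gv' (r := r).
have mbE := idx_b_matched oY oZ gu gu' gv gv'.
have maE := idx_a_matched oY oZ gu gu'.
rewrite /hits ba ba' ma ma' in cY cZ *; rewrite ba ma in mbE maE.
rewrite ba in mb; rewrite ba' in mb'.
have [/andP[v0 _] _ _ _ _] := gv.
have [su|us] := ltP s u.
  rewrite su in cY cZ mb mb'; have [AE _] := maE su.
  rewrite AE in ba' mb' cZ sZ jZ *.
  have [vA|vA] := ltP v A.
    (* A matched entry is cut at the same point on both sides. *)
    exists [::]; split=> [r r0| |us|us] //; try by move: (lt_trans us su); rewrite ltxx.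
    by have := sY r vA r0; have := sZ r vA r0; natlia.
  rewrite -leNgt vA /= in mb mb' mbE.
  rewrite (le_gtF vA) /= in cY cZ *.
  rewrite mb // mb' // in cY cZ mbE *.
  have [sv|vs] := ltP (s + A) v.
    exists [::]; split=> [r r0| |us|us] //; try by move: (lt_trans us su); rewrite ltxx.
    have := jY r vA r0; have := jZ r vA r0; rewrite (mbE isT sv); natlia.
  rewrite (le_gtF vs) in cY cZ *.
  (* Equal matched entries are merged with two unmatched ones: two hits, two new pieces. *)
  exists [:: A + Y (idx_b Y Z u v); A + Z (idx_b Z Y u v)].
  split=> [r r0| |us|us] //; try by move: (lt_trans us su); rewrite ltxx.
  have := jY r vA r0; have := jZ r vA r0; have := cY r r0; have := cZ r r0.
  natlia.
rewrite (le_gtF us) in cY cZ mb mb' *.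
have As : A <= s /\ A' <= s.
  have ua : ~~ mt Y Z (idx_a Y Z u) by rewrite ma -leNgt.
  have ua' : ~~ mt Z Y (idx_a Z Y u) by rewrite ma' -leNgt.
  have [] := tleft_unmatched oY ua; have [] := tleft_unmatched oZ ua'.
  by rewrite -QE; split; lra.
have [As1 As2] := As.
have [vA|vA] := ltP v A; have [vA'|vA'] := ltP v A'.
(* Both sides split and both create a piece of size [v]; these two cancel and are left out of the
   list. *)
- exists [:: A - v; A' - v]; rewrite /=; split=> //.
  + move=> r r0; have := sY r vA r0; have := sZ r vA' r0; have := cY r r0; have := cZ r r0.
    rewrite vA vA'; natlia.
  + by move=> _; rewrite gt_max => /andP[/andP[h1 h2] h3]; exfalso; lra.
  + by move=> _ _; rewrite !in_cons; case: leP => _; rewrite eqxx ?orbT.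
- have vs : s < v = false by apply/negbTE; rewrite -leNgt; lra.
  rewrite -leNgt vA' vs in mb'; rewrite (mb' isT) (le_gtF vA') /= in cZ *.
  (* One side splits and the other merges. As [v < A <= s], the entry merged is unmatched, so there
     are three hits for three new pieces. *)
  exists [:: A - v; v; A' + Z (idx_b Z Y u v)]; split=> //.
  + move=> r r0; have := sY r vA r0; have := jZ r vA' r0; have := cY r r0; have := cZ r r0.
    rewrite vA; natlia.
  + by move=> _; rewrite gt_max => /andP[/andP[h1 h2] h3]; exfalso; lra.
  + move=> _ _; rewrite (_ : Num.max A A' = A) ?in_cons ?eqxx //; apply/max_idPl; lra.
- have vs : s < v = false by apply/negbTE; rewrite -leNgt; lra.
  rewrite -leNgt vA vs in mb; rewrite (mb isT) (le_gtF vA) /= in cY *.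
  exists [:: A' - v; v; A + Y (idx_b Y Z u v)]; split=> //.
  + move=> r r0; have := jY r vA r0; have := sZ r vA' r0; have := cY r r0; have := cZ r r0.
    rewrite vA'; natlia.
  + by move=> _; rewrite gt_max => /andP[/andP[h1 h2] h3]; exfalso; lra.
  + move=> _ _; rewrite (_ : Num.max A A' = A') ?in_cons ?eqxx //; apply/max_idPr; lra.
- rewrite -leNgt vA /= in mb mbE; rewrite -leNgt vA' /= in mb'.
  rewrite (le_gtF vA) (le_gtF vA') (mb isT) (mb' isT) /= in cY cZ mbE *.
  exists [:: A + Y (idx_b Y Z u v); A' + Z (idx_b Z Y u v)].
  (* Two merges. Beyond [s] the entries found by [v] are matched and equal, which leaves two hits;
     below [s] they are unmatched, and four hits face two new pieces. *)
  have [sv|vs] := ltP s v.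
    rewrite sv /= in cY cZ *; split=> //.
    + move=> r r0; have := jY r vA r0; have := jZ r vA' r0; have := cY r r0; have := cZ r r0.
      by rewrite (mbE isT sv); natlia.
    + by move=> _ /andP[_ h]; exfalso; lra.
    + by move=> _; rewrite lt_max => /orP[] h; exfalso; lra.
  rewrite (le_gtF vs) /= in cY cZ *; split=> //.
  + move=> r r0; have := jY r vA r0; have := jZ r vA' r0; have := cY r r0; have := cZ r r0.
    natlia.
  + by move=> _; rewrite lt_max => /orP[] h; exfalso; lra.
Qed.

End StepPair.
End Moves.

(** * Additive functionals of the unmatched entries *)

Section Functionals.
Variable R : realType.
Implicit Types (Y Z : nat -> R) (r u v : R) (psi phi : R -> R).

Lemma sum_by_value psi Y (p : pred nat) n (V : seq R) : uniq V ->
  (forall i, (i < n)%N -> Y i \in V) ->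
  \sum_(i < n) (if p i then psi (Y i) else 0) =
  \sum_(r <- V) psi r * (count (fun i => (Y i == r) && p i) (iota 0 n))%:R.
Proof.
move=> uV hV.
under [RHS]eq_bigr do rewrite count_natr big_distrr /=.
rewrite exchange_big /=; apply: eq_bigr => i _.
rewrite (bigD1_seq (Y i)) ?hV //= eqxx /= big1 ?addr0.
  by case: (p i); rewrite ?mulr1 ?mulr0.
by move=> r ri; rewrite eq_sym (negbTE ri) mulr0.
Qed.

Definition Uf n psi Y Z := \sum_(i < n) (if ~~ mt Y Z i then psi (Y i) else 0).
Definition Nf n psi Y Z := Uf n psi Y Z + Uf n psi Z Y.
Definition Lf n psi Y := \sum_(i < n) psi (Y i).

(** Entries above [1/n] have index below [n], so for such weights the finite sums [Uf] and [Lf] over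
    [n] indices miss nothing. *)
Definition large n psi := (forall r, 0 <= psi r) /\ forall r, r <= n%:R^-1 -> psi r = 0.

Lemma Om_index_lt_inv Y n i : Om Y -> (0 < n)%N -> n%:R^-1 < Y i -> (i < n)%N.
Proof.
move=> oY n0 h; have := Om_mul_le1 i oY; rewrite ltnNge => h1; apply/negP => ni.
have n0' : (0 < n%:R :> R) by rewrite ltr0n.
have h2 : 1 < n%:R * Y i.
  by move: h; rewrite -(ltr_pM2l n0') mulfV // lt0r_neq0.
have h3 : n%:R * Y i <= i.+1%:R * Y i.
  by apply: ler_wpM2r; [exact: Om_ge0 | rewrite ler_nat; exact: leqW].
lra.
Qed.

Lemma LfE n psi Y (V : seq R) : Om Y -> (0 < n)%N -> large n psi -> uniq V ->
  (forall i, (i < n)%N -> Y i \in V) ->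
  Lf n psi Y = \sum_(r <- V) psi r * (mult Y r)%:R.
Proof.
move=> oY n0 [_ ps] uV hV.
rewrite /Lf -[LHS]/(\sum_(i < n) (if xpredT (i : nat) then psi (Y i) else 0)).
rewrite (@sum_by_value psi Y xpredT n V uV hV); apply: eq_bigr => r _.
have [rn|rn] := leP r n%:R^-1; first by rewrite ps // !mul0r.
have r0 : 0 < r by apply: le_lt_trans rn; rewrite invr_ge0.
rewrite (@mult_count _ Y r n) // => [|i ri].
  by congr (_ * _%:R); apply: eq_count => i; rewrite andbT.
by apply: (Om_index_lt_inv oY) => //; exact: lt_le_trans ri.
Qed.

Lemma UfE n psi Y Z (V : seq R) : Om Y -> Om Z -> (0 < n)%N -> large n psi -> uniq V ->
  (forall i, (i < n)%N -> Y i \in V) ->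
  Uf n psi Y Z = \sum_(r <- V) psi r * (mult Y r - mult Z r)%:R.
Proof.
move=> oY oZ n0 [_ ps] uV hV.
rewrite /Uf (@sum_by_value psi Y (fun i => ~~ mt Y Z i) n V uV hV); apply: eq_bigr => r _.
have [rn|rn] := leP r n%:R^-1; first by rewrite ps // !mul0r.
have r0 : 0 < r by apply: le_lt_trans rn; rewrite invr_ge0.
rewrite count_unmatched // (@mult_count _ Y r n) // => i ri.
by apply: (Om_index_lt_inv oY) => //; exact: lt_le_trans ri.
Qed.

Lemma sum_count_mem psi (l V : seq R) : uniq V -> {subset l <= V} ->
  \sum_(r <- V) psi r * (count_mem r l)%:R = \sum_(x <- l) psi x.
Proof.
move=> uV; elim: l => [|x l IH] lV.
  by rewrite big_nil big1 // => r _; rewrite mulr0.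
rewrite big_cons -IH; last by move=> y yl; apply: lV; rewrite in_cons yl orbT.
under eq_bigr do rewrite /= natrD mulrDr.
rewrite big_split /=; congr (_ + _).
rewrite (bigD1_seq x) //=; last by apply: lV; rewrite in_cons eqxx.
rewrite eqxx mulr1 big1 ?addr0 // => r rx.
by rewrite eq_sym (negbTE rx) mulr0.
Qed.

Section StepF.
Variables (Y Z : nat -> R) (u v : R) (n : nat).
Hypotheses (oY : Om Y) (oZ : Om Z) (n0 : (0 < n)%N).
Hypotheses (gu : genericU Y Z u) (gu' : genericU Z Y u) (gv : genericV Y Z u v) (gv' : genericV Z Y u v).
Let oY' : Om (new_seq Y Z u v) := Om_new_seq oY gu gv.
Let oZ' : Om (new_seq Z Y u v) := Om_new_seq oZ gu' gv'.

(** The inequality between multiplicities is multiplied by [psi r] and summed over a finite list [V]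
    of all the values involved. *)
Lemma Nf_step (Pl : seq R) psi : large n psi ->
  (forall r, 0 < r ->
       (dist (mult (new_seq Y Z u v) r) (mult (new_seq Z Y u v) r) +
        count_mem r (hits Y Z u v ++ hits Z Y u v) <=
        dist (mult Y r) (mult Z r) + count_mem r Pl)%N) ->
  Nf n psi (new_seq Y Z u v) (new_seq Z Y u v) +
    \sum_(x <- hits Y Z u v ++ hits Z Y u v) psi x <=
  Nf n psi Y Z + \sum_(x <- Pl) psi x.
Proof.
move=> lp; have [p0 ps] := lp; move: (hits Y Z u v ++ hits Z Y u v) => H h.
pose V := undup (map Y (iota 0 n) ++ map Z (iota 0 n) ++ map (new_seq Y Z u v) (iota 0 n) ++
  map (new_seq Z Y u v) (iota 0 n) ++ H ++ Pl).
have uV : uniq V := undup_uniq _.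
have inI (W : nat -> R) i : (i < n)%N -> W i \in map W (iota 0 n).
  by move=> ni; apply: map_f; rewrite mem_iota.
rewrite -(@sum_count_mem _ H V) //; last by move=> x xH; rewrite mem_undup !mem_cat xH !orbT.
rewrite -(@sum_count_mem _ Pl V) //; last by move=> x xH; rewrite mem_undup !mem_cat xH !orbT.
rewrite /Nf !(@UfE n _ _ _ V) //; try by move=> i ni; rewrite mem_undup !mem_cat inI ?orbT.
rewrite -!big_split /=; apply: ler_sum => r _.
have [rn|rn] := leP r n%:R^-1; first by rewrite ps // !mul0r.
have r0 : 0 < r by apply: le_lt_trans rn; rewrite invr_ge0.
rewrite -!mulrDr -!natrD; apply: ler_wpM2l => //.
by rewrite ler_nat; exact: h.
Qed.

(* Indicators that [u], resp. [v], falls in an entry of size at most [1/n]. *)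
Definition du n Y Z u := 1 - \sum_(i < n) (n%:R^-1 < Y i)%R%:R * (inb (tleft Y Z) Y u i)%:R : R.
Definition dv n Y Z u v :=
  1 - \sum_(i < n) (n%:R^-1 < Y i)%R%:R * (inb (hleft Y Z u) Y v i)%:R : R.

End StepF.

Lemma sum_block (L Y : nat -> R) u n (i0 : nat) (f : nat -> R) : (0 < n)%N ->
  (forall i, inb L Y u i = (i == i0)) -> ((n <= i0)%N -> f i0 = 0) ->
  \sum_(i < n) f i * (inb L Y u i)%:R = f i0.
Proof.
move=> n0 hi h0; have [ni|ni] := leqP n i0.
  rewrite h0 // big1 // => i _; rewrite hi; case: eqP; rewrite ?mulr0 // => E.
  by have := ltn_ord i; rewrite E ltnNge ni.
rewrite (bigD1 (Ordinal ni)) //= hi eqxx mulr1 big1 ?addr0 // => i.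
by rewrite hi -val_eqE /= => /negbTE ->; rewrite mulr0.
Qed.

Section StepG.
Variables (Y Z : nat -> R) (u v : R) (n : nat).
Hypotheses (oY : Om Y) (n0 : (0 < n)%N) (gu : genericU Y Z u) (gv : genericV Y Z u v).

Lemma inb_tleftE i : inb (tleft Y Z) Y u i = (i == idx_a Y Z u).
Proof.
apply/idP/eqP => [h|->]; first exact/esym/idx_a_eq.
by have [] := idx_aP oY gu.
Qed.

Lemma inb_hleftE i : inb (hleft Y Z u) Y v i = (i == idx_b Y Z u v).
Proof.
apply/idP/eqP => [h|->]; first exact/esym/idx_b_eq.
exact: idx_bP.
Qed.

Lemma small_index i : (n <= i)%N -> Y i <= n%:R^-1.
Proof. by move=> ni; rewrite leNgt; apply/negP => /(Om_index_lt_inv oY n0); rewrite ltnNge ni. Qed.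

Lemma duE : du n Y Z u = (Y (idx_a Y Z u) <= n%:R^-1)%R%:R.
Proof.
rewrite /du (@sum_block (tleft Y Z) Y u n (idx_a Y Z u) (fun i => (n%:R^-1 < Y i)%R%:R)) //.
- by rewrite ltNge; case: (_ <= _); rewrite /= ?subr0 ?subrr.
- exact: inb_tleftE.
- by move=> /small_index; rewrite leNgt => /negbTE ->.
Qed.

Lemma dvE : dv n Y Z u v = (Y (idx_b Y Z u v) <= n%:R^-1)%R%:R.
Proof.
rewrite /dv (@sum_block (hleft Y Z u) Y v n (idx_b Y Z u v) (fun i => (n%:R^-1 < Y i)%R%:R)) //.
- by rewrite ltNge; case: (_ <= _); rewrite /= ?subr0 ?subrr.
- exact: inb_hleftE.
- by move=> /small_index; rewrite leNgt => /negbTE ->.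
Qed.

(** A majorant of the weight of the hits whose expectation can be taken interval by interval; an
    unmatched entry is counted twice when [a = b]. *)
Definition hitf n phi Y Z u v :=
  \sum_(i < n) (if ~~ mt Y Z i then phi (Y i) else 0) * (inb (tleft Y Z) Y u i)%:R +
  \sum_(i < n) (if ~~ mt Y Z i then phi (Y i) else 0) * (inb (hleft Y Z u) Y v i)%:R.

Lemma hits_le phi : large n phi -> \sum_(x <- hits Y Z u v) phi x <= hitf n phi Y Z u v.
Proof.
move=> [p0 ps]; rewrite /hitf.
have z i : (n <= i)%N -> (if ~~ mt Y Z i then phi (Y i) else 0) = 0.
  by move=> /small_index/ps ->; case: ifP.
rewrite (@sum_block (tleft Y Z) Y u n (idx_a Y Z u)
  (fun i => if ~~ mt Y Z i then phi (Y i) else 0) n0 inb_tleftE (z _)).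
rewrite (@sum_block (hleft Y Z u) Y v n (idx_b Y Z u v)
  (fun i => if ~~ mt Y Z i then phi (Y i) else 0) n0 inb_hleftE (z _)).
rewrite /hits big_cat /=; apply: lerD.
  by case: (mt _ _ _); rewrite /= ?big_nil ?big_seq1.
by case: eqP => _; case: (mt _ _ _); rewrite /= ?big_nil ?big_seq1.
Qed.

Lemma hits_sub x : x \in hits Y Z u v -> x = Y (idx_a Y Z u) \/ x = Y (idx_b Y Z u v).
Proof.
rewrite /hits mem_cat => /orP[]; case: ifP => // _; rewrite in_cons orbF => /eqP ->; by [left|right].
Qed.

End StepG.

Definition dust n Y Z u v := du n Y Z u + dv n Y Z u v + (du n Z Y u + dv n Z Y u v).

Definition genericUV Y Z u v := [/\ genericU Y Z u, genericU Z Y u, genericV Y Z u v & genericV Z Y u v].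

Definition mx Y Z := Num.max (unmatched_max Y Z) (unmatched_max Z Y).
Definition mn Y Z := Num.min (unmatched_max Y Z) (unmatched_max Z Y).

Definition big1f n : R -> R := fun r => (n%:R^-1 < r)%R%:R.

Lemma large_big1 n : large n (big1f n).
Proof. by split=> r; rewrite /big1f ?ler0n // => /le_gtF ->. Qed.

Lemma unmatched_maxP Y Z : Om Y ->
  (exists i, [/\ ~~ mt Y Z i, forall j, ~~ mt Y Z j -> (i <= j)%N & unmatched_max Y Z = Y i])
  \/ (forall i, mt Y Z i) /\ unmatched_max Y Z = 0.
Proof.
move=> oY.
have [exm|hall] := pselect (exists i, ~~ mt Y Z i); last first.
  right; have hm i : mt Y Z i by apply/negPn/negP => h; apply: hall; exists i.
  split=> //; rewrite /unmatched_max /choose_spec.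
  have ex : exists r, (exists i, [/\ ~ matched Y Z i, r = Y i & forall j, ~ matched Y Z j -> Y j <= Y i])
    \/ ((forall i, matched Y Z i) /\ r = 0).
    by exists 0; right; split=> // i; exact/asboolP/hm.
  have [[i [nm _ _]]|[]//] := ClassicalEpsilon.epsilon_spec (inhabits (0 : R)) _ ex.
  by case: nm; exact/asboolP/hm.
left; case: (ex_minnP exm) => i ni hi; exists i; split=> //.
have nP j : ~~ mt Y Z j -> ~ matched Y Z j by move=> /asboolPn.
have Pn j : ~ matched Y Z j -> ~~ mt Y Z j by move=> /asboolPn.
rewrite /unmatched_max /choose_spec.
have ex : exists r, (exists i, [/\ ~ matched Y Z i, r = Y i & forall j, ~ matched Y Z j -> Y j <= Y i])
    \/ ((forall i, matched Y Z i) /\ r = 0).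
  by exists (Y i); left; exists i; split=> //; [exact: nP| move=> j /Pn/hi; exact: Om_noninc].
have [[j [/Pn nj -> hj]]|[/(_ i)]] := ClassicalEpsilon.epsilon_spec (inhabits (0 : R)) _ ex.
  by apply/eqP; rewrite eq_le hj ?andbT; [apply: Om_noninc => //; exact: hi | exact: nP].
by move/nP: ni.
Qed.

Lemma unmatched_max_ge Y Z i : Om Y -> ~~ mt Y Z i -> Y i <= unmatched_max Y Z.
Proof.
move=> oY ni; have [[j [nj hj ->]]|[/(_ i)]] := @unmatched_maxP Y Z oY.
  by apply: Om_noninc => //; exact: hj.
by rewrite (negbTE ni).
Qed.

Lemma unmatched_max_le Y Z : Om Y -> unmatched_max Y Z <= 1 - Qmatch Y Z.
Proof.
move=> oY; have [[j [nj _ ->]]|[_ ->]] := @unmatched_maxP Y Z oY.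
  have [] := tleft_unmatched oY nj; lra.
by have /andP[] := @unmatched_mass_ge0 _ Y Z oY.
Qed.

Lemma mxC Y Z : mx Y Z = mx Z Y. Proof. by rewrite /mx maxC. Qed.

Lemma mx_le Y Z : Om Y -> Om Z -> mx Y Z <= 1 - Qmatch Y Z.
Proof.
by move=> oY oZ; rewrite ge_max unmatched_max_le //= (Qmatch_sym oY oZ) unmatched_max_le.
Qed.

Lemma hit_max_eq Y Z u : Om Y -> genericU Y Z u -> 0 < u < unmatched_max Y Z ->
  Y (idx_a Y Z u) = unmatched_max Y Z /\ forall j, ~~ mt Y Z j -> (idx_a Y Z u <= j)%N.
Proof.
move=> oY gu hu; have [[j [nj hj E]]|[_ E]] := @unmatched_maxP Y Z oY; rewrite E in hu *; last lra.
by rewrite (idx_a_eq oY gu (inb_first nj hj hu)).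
Qed.

Lemma hit_lt_s Y Z u : Om Y -> Om Z -> 0 < u < mx Y Z -> u < 1 - Qmatch Y Z.
Proof. by move=> oY oZ; have := mx_le oY oZ; lra. Qed.

Lemma idx_a_le_max Y Z u : Om Y -> genericU Y Z u -> u < 1 - Qmatch Y Z ->
  Y (idx_a Y Z u) <= unmatched_max Y Z.
Proof.
move=> oY gu us; apply: unmatched_max_ge => //.
by have [_ ->] := idx_aP oY gu; rewrite -leNgt ltW.
Qed.

(** The side holding the larger of the two maxima is hit in its first unmatched interval. On the
    other side [u < s] still forces an unmatched entry, which is no larger. *)
Lemma hit_mx Y Z u : Om Y -> Om Z -> genericU Y Z u -> genericU Z Y u -> 0 < u < mx Y Z ->
  u < 1 - Qmatch Y Z /\ Num.max (Y (idx_a Y Z u)) (Z (idx_a Z Y u)) = mx Y Z.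
Proof.
move=> oY oZ gu gu' hu; have us := hit_lt_s oY oZ hu; split=> //.
have h1 := idx_a_le_max oY gu us.
have h2 := idx_a_le_max oZ gu'; rewrite -(Qmatch_sym oY oZ) in h2; have {}h2 := h2 us.
have /andP[u0 ux] := hu.
apply/eqP; rewrite eq_le ge_max !le_max h1 h2 orbT /=.
move: ux; rewrite /mx; case: (leP (unmatched_max Y Z) (unmatched_max Z Y)) => h ux.
  have [|-> _] := hit_max_eq oZ gu'; first by rewrite u0.
  by rewrite lexx orbT.
have [|-> _] := hit_max_eq oY gu; first by rewrite u0.
by rewrite lexx.
Qed.

Lemma dust_ge0 n Y Z u v : Om Y -> Om Z -> (0 < n)%N -> genericUV Y Z u v ->
  0 <= dust n Y Z u v.
Proof.
move=> oY oZ n0 [gu gu' gv gv']; rewrite /dust !duE // !dvE // -!natrD ler0n.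
Qed.

Lemma hits_dust n Y Z u v : Om Y -> Om Z -> (0 < n)%N -> genericUV Y Z u v ->
  dust n Y Z u v < 1 ->
  \sum_(x <- hits Y Z u v ++ hits Z Y u v) big1f n x =
  (size (hits Y Z u v ++ hits Z Y u v))%:R.
Proof.
move=> oY oZ n0 [gu gu' gv gv']; rewrite /dust !duE // !dvE // => hd.
rewrite -sum1_size natr_sum big_seq [RHS]big_seq; apply: eq_bigr => x.
rewrite mem_cat /big1f ltNge => hx.
suff /negbTE -> : ~~ (x <= n%:R^-1) by [].
apply/negP => xn; move: hd; apply/negP; rewrite -leNgt.
rewrite -!natrD ler1n.
by move: hx => /orP[] /hits_sub[] E; rewrite E in xn; rewrite xn; do ?case: (_ <= _)%R.
Qed.

Lemma dust_int n Y Z u v : Om Y -> Om Z -> (0 < n)%N -> genericUV Y Z u v ->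
  dust n Y Z u v = 0 \/ 1 <= dust n Y Z u v.
Proof.
move=> oY oZ n0 [gu gu' gv gv']; rewrite /dust !duE // !dvE // -!natrD.
by case: (_ + _)%N => [|k]; [left|right; rewrite ler1n].
Qed.

(** Without dust all hits are counted and pay for the new pieces, with two to spare in the case of
    four hits. Otherwise at most [3] new pieces plus the [2] of the claim are charged to the dust,
    whence [5]. *)
Lemma Nf_big_step n Y Z u v : Om Y -> Om Z -> (0 < n)%N -> genericUV Y Z u v ->
  Nf n (big1f n) (new_seq Y Z u v) (new_seq Z Y u v) +
    2 * ((0 < u < mx Y Z)%R%:R * (mx Y Z < v < 1 - Qmatch Y Z)%R%:R) <=
  Nf n (big1f n) Y Z + 5 * dust n Y Z u v.
Proof.
move=> oY oZ n0 g; have [gu gu' gv gv'] := g.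
have [Pl [h1 [h2 h3] h4 _]] := step_multiplicities oY oZ gu gu' gv gv'.
have := Nf_step oY oZ n0 gu gu' gv gv' (large_big1 n) h1.
set H := \sum_(x <- _ ++ _) _; set P := \sum_(x <- Pl) _.
set I := _%:R * _%:R.
have P3 : P <= (size Pl)%:R.
  rewrite -sum1_size natr_sum; apply: ler_sum => x _; rewrite /big1f lern1; exact: leq_b1.
have H0 : 0 <= H by apply: sumr_ge0 => x _; rewrite ler0n.
have I1 : 0 <= I <= 1.
  by rewrite /I -natrM ler0n lern1 mulnb leq_b1.
have [d0|d1] := dust_int oY oZ n0 g.
  have HE : H = (size (hits Y Z u v ++ hits Z Y u v))%:R.
    by apply: hits_dust => //; rewrite d0.
  have [I0|IN0] := eqVneq I 0.
    have : (size Pl)%:R <= H by rewrite HE ler_nat.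
    rewrite I0 d0; lra.
  have [hu hv] : (0 < u < mx Y Z) /\ (mx Y Z < v < 1 - Qmatch Y Z).
    apply/andP; apply: contraNT IN0 => /negbTE h.
    by rewrite /I -natrM mulnb h.
  have [us mE] := hit_mx oY oZ gu gu' hu; rewrite mE in h4.
  have [s4 s2] := h4 us hv; rewrite s4 in HE; rewrite s2 in P3; rewrite d0; lra.
have : (size Pl)%:R <= 3 :> R by rewrite ler_nat.
lra.
Qed.

Lemma Nf_lin n (c : R) psi phi Y Z : Nf n (fun r => c * psi r - phi r) Y Z =
  c * Nf n psi Y Z - Nf n phi Y Z.
Proof.
have U W W' : Uf n (fun r => c * psi r - phi r) W W' = c * Uf n psi W W' - Uf n phi W W'.
  rewrite /Uf mulr_sumr -sumrB; apply: eq_bigr => i _.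
  by case: ifP; rewrite ?mulr0 ?subr0.
rewrite /Nf !U; lra.
Qed.

(** [Nf_step] for the weight [M * big1f n - phi], nonnegative because [phi <= M]. In this form an
    upper bound for the step becomes a bound on the [phi]-weight born, insensitive to accidental
    matches. *)
Lemma Nf_phi_step n phi (M : R) Y Z u v : Om Y -> Om Z -> (0 < n)%N -> genericUV Y Z u v ->
  large n phi -> (forall r, phi r <= M) ->
  (0 < u < mx Y Z)%R%:R * ((v < mx Y Z)%R%:R * phi (mx Y Z - v)) +
  (M * Nf n (big1f n) (new_seq Y Z u v) (new_seq Z Y u v) -
   Nf n phi (new_seq Y Z u v) (new_seq Z Y u v)) <=
  M * Nf n (big1f n) Y Z - Nf n phi Y Z +
  (hitf n phi Y Z u v + hitf n phi Z Y u v) + 3 * M * dust n Y Z u v.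
Proof.
move=> oY oZ n0 g lphi phiM; have [gu gu' gv gv'] := g.
have [p0 ps] := lphi.
have M0 : 0 <= M by apply: le_trans (p0 0) (phiM 0).
have [Pl [h1 [h2 h3] _ h4]] := step_multiplicities oY oZ gu gu' gv gv'.
have lpsi : large n (fun r => M * big1f n r - phi r).
  split=> r; rewrite /big1f; last by move=> h; rewrite (le_gtF h) mulr0 ps // subrr.
  have [h|h] := leP r n%:R^-1; first by rewrite mulr0 ps // subrr.
  by rewrite mulr1 subr_ge0.
have := Nf_step oY oZ n0 gu gu' gv gv' lpsi h1.
rewrite !Nf_lin !sumrB -!mulr_sumr.
have hY := hits_le oY n0 gu gv lphi; have hZ := hits_le oZ n0 gu' gv' lphi.
have Hc : \sum_(x <- hits Y Z u v ++ hits Z Y u v) phi x =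
  \sum_(x <- hits Y Z u v) phi x + \sum_(x <- hits Z Y u v) phi x by rewrite big_cat.
rewrite Hc; set H := \sum_(x <- _ ++ _) _; set P := \sum_(x <- Pl) big1f _ _.
have P3 : P <= (size Pl)%:R.
  rewrite -sum1_size natr_sum; apply: ler_sum => x _; rewrite /big1f lern1; exact: leq_b1.
have H0 : 0 <= H by apply: sumr_ge0 => x _; rewrite ler0n.
(* The terms in [M] cancel up to dust, because [Pl] is no longer than the list of hits. *)
have PH : P <= H + 3 * dust n Y Z u v.
  have [d0|d1] := dust_int oY oZ n0 g.
    rewrite d0 /H hits_dust ?d0 // mulr0 addr0; apply: le_trans P3 _.
    by rewrite ler_nat.
  have : (size Pl)%:R <= 3 :> R by rewrite ler_nat.
  lra.
have MP : M * P <= M * H + 3 * M * dust n Y Z u v.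
  by have := ler_wpM2l M0 PH; rewrite mulrDr; lra.
have birth : (0 < u < mx Y Z)%R%:R * ((v < mx Y Z)%R%:R * phi (mx Y Z - v)) <= \sum_(x <- Pl) phi x.
  have nn : 0 <= \sum_(x <- Pl) phi x by apply: sumr_ge0.
  case: (boolP (0 < u < mx Y Z)) => hu; rewrite ?mul0r //.
  case: (boolP (v < mx Y Z)) => hv; rewrite ?mul0r ?mulr0 //.
  have [us mE] := hit_mx oY oZ gu gu' hu; rewrite mE in h4.
  have vin := h4 us hv; rewrite !mul1r (big_rem _ vin) /= lerDl.
  exact: sumr_ge0.
lra.
Qed.

End Functionals.

(** * The mass of the entries of size at most [1/n] *)

Section MoreSteps.
Variable R : realType.
Implicit Types (Y Z : nat -> R) (r u v : R) (psi phi : R -> R).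

Lemma Lf_move n psi Y Y' (rm ad : seq R) : Om Y -> Om Y' -> (0 < n)%N -> large n psi ->
  (forall r, 0 < r ->
    (mult Y' r + count_mem r rm = mult Y r + count_mem r ad)%N) ->
  Lf n psi Y' + \sum_(x <- rm) psi x = Lf n psi Y + \sum_(x <- ad) psi x.
Proof.
move=> oY oY' n0 lp h; have [p0 ps] := lp.
pose V := undup (map Y (iota 0 n) ++ map Y' (iota 0 n) ++ rm ++ ad).
have uV : uniq V := undup_uniq _.
have inI (W : nat -> R) i : (i < n)%N -> W i \in map W (iota 0 n).
  by move=> ni; apply: map_f; rewrite mem_iota.
rewrite -(@sum_count_mem _ _ rm V) //; last by move=> x xH; rewrite mem_undup !mem_cat xH !orbT.
rewrite -(@sum_count_mem _ _ ad V) //; last by move=> x xH; rewrite mem_undup !mem_cat xH !orbT.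
rewrite !(@LfE _ n _ _ V) //; try by move=> i ni; rewrite mem_undup !mem_cat inI ?orbT.
rewrite -!big_split /=; apply: eq_bigr => r _.
have [rn|rn] := leP r n%:R^-1; first by rewrite ps // !mul0r.
have r0 : 0 < r by apply: le_lt_trans rn; rewrite invr_ge0.
by rewrite -!mulrDr -!natrD h.
Qed.

(** The cut-off at [1] does not affect entries of [Om]; it makes the function bounded on the whole
    line, as expectations require. *)
Definition bigmass n : R -> R := fun x => x * (n%:R^-1 < x <= 1)%R%:R.

Lemma large_bigmass n : large n (bigmass n).
Proof.
split=> r; rewrite /bigmass; last by move=> /le_gtF ->; rewrite mulr0.
case: (boolP (_ < _ <= _)) => [/andP[h _]|_]; rewrite ?mulr0 // mulr1 ltW //.
by apply: le_lt_trans h; rewrite invr_ge0.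
Qed.

Definition dust_mass n Y := 1 - Lf n (bigmass n) Y.

(** Merging never creates small entries. A split adds at most [1/n] of small mass for each part of
    size at most [1/n]; the factor [2] leaves room for open intervals of [v]. *)
Lemma Fm_step n Y Z u v : Om Y -> (0 < n)%N -> genericU Y Z u -> genericV Y Z u v ->
  dust_mass n (new_seq Y Z u v) <= dust_mass n Y + n%:R^-1 * ((0 < v < 2 * n%:R^-1)%R%:R +
    (Y (idx_a Y Z u) - 2 * n%:R^-1 < v < Y (idx_a Y Z u))%R%:R).
Proof.
move=> oY n0 gu gv; have oY' := Om_new_seq oY gu gv.
have [ia _] := idx_aP oY gu; have A0 := inb_gt0 ia.
have ib := idx_bP oY gu gv; have B0 := inb_gt0 ib.
have [/andP[v0 v1] _ _ _ _] := gv.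
have e0 : 0 < n%:R^-1 :> R by rewrite invr_gt0 ltr0n.
set e := n%:R^-1 in e0 *; set A := Y (idx_a Y Z u) in A0 *.
have A1 : A <= 1 by exact: Om_le1.
have rhs0 (b c : bool) : 0 <= e * (b%:R + c%:R) :> R.
  by rewrite mulr_ge0 ?addr_ge0 ?ler0n // ltW.
have [vA|vA] : v < A \/ A <= v by case: (ltP v A); [left|right].
  have E : Lf n (bigmass n) (new_seq Y Z u v) + bigmass n A =
      Lf n (bigmass n) Y + (bigmass n v + bigmass n (A - v)).
    have := @Lf_move n (bigmass n) Y _ [:: A] [:: v; A - v] oY oY' n0 (large_bigmass n).
    rewrite !big_cons !big_nil !addr0; apply=> r r0.
    by have := mult_new_split oY gu gv vA r0; rewrite /= !addn0 addnA.
  suff : bigmass n A <= bigmass n v + bigmass n (A - v) +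
      e * ((0 < v < 2 * e)%R%:R + (A - 2 * e < v < A)%R%:R) by rewrite /dust_mass; lra.
  rewrite /bigmass -/e A1 vA (ltW v1) v0 !andbT.
  have -> : A - v <= 1 by lra.
  rewrite !andbT /=.
  by case: (ltP e A) => h1; case: (ltP e v) => h2; case: (ltP e (A - v)) => h3;
    case: (ltP v (2 * e)) => h4; case: (ltP (A - 2 * e) v) => h5; rewrite /= ?mulr1n ?mulr0n; lra.
have vA' : idx_a Y Z u != idx_b Y Z u v by rewrite eq_sym (idx_b_a oY gu gv) -leNgt.
have E : Lf n (bigmass n) (new_seq Y Z u v) + (bigmass n A + bigmass n (Y (idx_b Y Z u v))) =
      Lf n (bigmass n) Y + bigmass n (A + Y (idx_b Y Z u v)).
  have := @Lf_move n (bigmass n) Y _ [:: A; Y (idx_b Y Z u v)] [:: A + Y (idx_b Y Z u v)]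
    oY oY' n0 (large_bigmass n).
  rewrite !big_cons !big_nil !addr0; apply=> r r0.
  by have := mult_new_merge oY gu gv vA r0; rewrite /= !addn0 addnA.
have AB1 : A + Y (idx_b Y Z u v) <= 1.
  apply: le_trans (Om_sum_le1 (maxn (idx_a Y Z u) (idx_b Y Z u v)).+1 oY).
  have := @sum_uniq_le _ [:: idx_a Y Z u; idx_b Y Z u v] (maxn (idx_a Y Z u) (idx_b Y Z u v)).+1 Y.
  rewrite !big_cons big_nil addr0; apply=> [|i|i]; first by rewrite /= in_cons in_nil orbF vA'.
    by rewrite !in_cons in_nil orbF => /orP[] /eqP ->; rewrite ltnS ?leq_maxl ?leq_maxr.
  exact: Om_ge0.
have : bigmass n A + bigmass n (Y (idx_b Y Z u v)) <= bigmass n (A + Y (idx_b Y Z u v)).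
  rewrite /bigmass -/e A1 AB1 (Om_le1 (idx_b Y Z u v) oY) !andbT.
  move: (Y (idx_b Y Z u v)) B0 => B B0.
  by case: (ltP e A) => h1; case: (ltP e B) => h2; case: (ltP e (A + B)) => h3;
   rewrite ?mulr1 ?mulr0; lra.
have := rhs0 (0 < v < 2 * e) (A - 2 * e < v < A).
rewrite /dust_mass; lra.
Qed.

End MoreSteps.

(** * Creating a configuration that loses two unmatched pieces *)

Section Case2.
Variable R : realType.
Implicit Types (Y Z : nat -> R) (r u v : R) (psi phi : R -> R).

(** Leaves room [r] for [u] in [[0, mx]] and room [r] for [v] between [mx] and the border of the
    unmatched part: such a pair hits four unmatched pieces. *)
Definition case1 r Y Z := (r <= mx Y Z) && (r <= 1 - Qmatch Y Z - mx Y Z).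

Definition atl r : R -> R := fun x => (r <= x)%R%:R.

(** One of the two indices differs from that of the largest unmatched entry, and the two disjoint
    intervals both fit into [[0, s]]. *)
Lemma two_unmatched Y Z r i j : Om Y -> i != j -> ~~ mt Y Z i -> ~~ mt Y Z j ->
  r <= Y i -> r <= Y j -> unmatched_max Y Z + r <= 1 - Qmatch Y Z.
Proof.
move=> oY ij ni nj ri rj.
have [[k [nk hk ->]]|[/(_ i)]] := @unmatched_maxP _ Y Z oY; last by rewrite (negbTE ni).
have aux m : k != m -> ~~ mt Y Z m -> r <= Y m -> Y k + r <= 1 - Qmatch Y Z.
  move=> km nm rm; have [_] := tleft_unmatched oY nm; have [tk _] := tleft_unmatched oY nk.
  have [h|h] := tleft_order Z oY km; first by lra.
  have : (k < m)%N by rewrite ltn_neqAle km hk.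
  move=> /(sum_cond_le oY (p := fun i => ~~ mt Y Z i)) => /(_ nk).
  have := Om_ge0 m oY.
  by rewrite !tleftE (negbTE nk) (negbTE nm) in tk h *; lra.
have [ki|ki] := eqVneq k i; last exact: aux ki ni ri.
by apply: (@aux j) => //; rewrite ki.
Qed.

Lemma two_sided_case1 Y Z r i j k l : Om Y -> Om Z -> i != j -> ~~ mt Y Z i -> ~~ mt Y Z j ->
  r <= Y i -> r <= Y j -> k != l -> ~~ mt Z Y k -> ~~ mt Z Y l -> r <= Z k -> r <= Z l ->
  case1 r Y Z.
Proof.
move=> oY oZ ij ni nj ri rj kl nk nl rk rl.
have h1 := two_unmatched oY ij ni nj ri rj.
have h2 := two_unmatched oZ kl nk nl rk rl; rewrite -(Qmatch_sym oY oZ) in h2.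
have h3 := unmatched_max_ge oY ni.
rewrite /case1 /mx; case: (leP (unmatched_max Y Z) (unmatched_max Z Y)) => h; lra.
Qed.

Lemma Uf_atl n r Y Z :
  Uf n (atl r) Y Z = (size [seq i <- iota 0 n | ~~ mt Y Z i & r <= Y i])%:R.
Proof.
rewrite size_filter count_natr /Uf; apply: eq_bigr => i _.
by case: (~~ _).
Qed.

Lemma Uf_atl_le n r Y Z : Om Y -> 0 < r -> Uf n (atl r) Y Z <= r^-1.
Proof.
move=> oY r0; rewrite -[r^-1]mul1r ler_pdivlMr // mulr_suml.
apply: le_trans (Om_sum_le1 n oY); apply: ler_sum => i _.
have Y0 := Om_ge0 i oY.
case: ifP => _; rewrite ?mul0r // /atl; case: (leP r (Y i)) => h; rewrite ?mul0r // mul1r //.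
Qed.

(* Excludes the [v] for which a new piece has the size of an entry of the other
   side, and so could be matched. *)
Definition generic_cut Y Z v := [/\ forall j, v != Z j, forall i j, v != Y i - Z j,
  forall i, v != Y i / 2 & forall i j k, v != Y i - Z j - Z k].

(** If [case1] fails, the largest unmatched piece nearly fills the unmatched part, so its side has
    no second piece of size [r]; at least three of the four large pieces are then on the other
    side. *)
Lemma case2_lower n r Y Z : Om Y -> Om Z -> 0 < r -> 4 <= Nf n (atl r) Y Z ->
  ~~ case1 (r / 2) Y Z -> unmatched_max Z Y <= unmatched_max Y Z ->
  [/\ 1 - Qmatch Y Z - r / 2 < unmatched_max Y Z &
   exists j p p', [/\ ~~ mt Z Y j, forall k, ~~ mt Z Y k -> (j <= k)%N, unmatched_max Z Y = Z j,
     uniq [:: j; p; p'] & [/\ ~~ mt Z Y p, ~~ mt Z Y p', r <= Z j, r <= Z p & r <= Z p']]].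
Proof.
move=> oY oZ r0 N4 c1 zy.
have mxE : mx Y Z = unmatched_max Y Z by exact/max_idPl.
rewrite /case1 mxE in c1; move: N4; rewrite /Nf !Uf_atl.
set lY := seq.filter _ _; set lZ := seq.filter _ _ => N4.
have memY i : i \in lY -> ~~ mt Y Z i /\ r <= Y i by rewrite mem_filter => /andP[/andP[]].
have memZ i : i \in lZ -> ~~ mt Z Y i /\ r <= Z i by rewrite mem_filter => /andP[/andP[]].
have uY : uniq lY by exact/filter_uniq/iota_uniq.
have uZ : uniq lZ by exact/filter_uniq/iota_uniq.
have N4' : (4 <= size lY + size lZ)%N by rewrite -(ler_nat R) natrD.
have rx : r <= unmatched_max Y Z.
  case EY : lY N4' memY => [|i l] N4' memY.
    case EZ : lZ N4' memZ => [//|i l] _ memZ.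
    have [|ni ri] := memZ i; first by rewrite in_cons eqxx.
    apply: le_trans zy; apply: le_trans ri _; exact: unmatched_max_ge.
  have [|ni ri] := memY i; first by rewrite in_cons eqxx.
  apply: le_trans ri _; exact: unmatched_max_ge.
have sx : 1 - Qmatch Y Z - r / 2 < unmatched_max Y Z.
  by move: c1; rewrite negb_and -!ltNge => /orP[]; lra.
have sY : (size lY <= 1)%N.
  case EY : lY uY memY => [//|i [//|j l]] uY memY.
  have [|ni ri] := memY i; first by rewrite in_cons eqxx.
  have [|nj rj] := memY j; first by rewrite !in_cons eqxx orbT.
  have ij : i != j by move: uY => /= /andP[]; rewrite in_cons => /norP[].
  by have := two_unmatched oY ij ni nj ri rj; lra.
have sZ : (3 <= size lZ)%N by lia.
split=> //.
have [[j [nj hj jE]]|[hall _]] := @unmatched_maxP _ Z Y oZ; last first.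
  case EZ : lZ sZ memZ => [//|i l] _ memZ.
  by have [|] := memZ i; [rewrite in_cons eqxx|rewrite hall].
have sr : (2 <= size (seq.filter (predC1 j) lZ))%N.
  rewrite size_filter; have := count_predC (pred1 j) lZ.
  have : (count (pred1 j) lZ <= 1)%N by rewrite count_uniq_mem //; case: (_ \in _).
  rewrite (_ : count (predC1 j) lZ = count (predC (pred1 j)) lZ); last exact: eq_count.
  move: sZ; move: (size lZ) (count_mem j lZ) (count (predC (pred1 j)) lZ) => d c c'.
  by clear; lia.
have us := filter_uniq (predC1 j) uZ.
have ms i : i \in seq.filter (predC1 j) lZ -> i != j /\ (~~ mt Z Y i /\ r <= Z i).
  by rewrite mem_filter => /andP[ij /memZ h]; split.
case: (seq.filter _ _) sr us ms => [//|p [//|p' l]] _ us ms.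
have [|pj [np rp]] := ms p; first by rewrite in_cons eqxx.
have [|pj' [np' rp']] := ms p'; first by rewrite !in_cons eqxx orbT.
have pp' : p != p' by move: us => /= /andP[]; rewrite in_cons => /norP[].
exists j, p, p'; split=> //.
  by rewrite /= !in_cons !in_nil !orbF negb_or ![j == _]eq_sym pj pj' pp'.
by split=> //; apply: le_trans rp _; apply: Om_noninc => //; exact: hj.
Qed.

Lemma sum_three_le Y (p : pred nat) (i j k m : nat) : Om Y -> uniq [:: i; j; k] ->
  p i -> p j -> p k -> (i < m)%N -> (j < m)%N -> (k < m)%N ->
  Y i + Y j + Y k <= \sum_(l < m | p l) Y l.
Proof.
move=> oY us pi pj pk im jm km.
have := @sum_uniq_le _ [:: i; j; k] m (keep p Y) us.
rewrite !big_cons big_nil sum_keep /keep pi pj pk addr0 addrA; apply.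
- by move=> l; rewrite !in_cons in_nil orbF => /or3P[] /eqP ->.
- by move=> l; case: ifP => _ //; exact: Om_ge0.
Qed.

Lemma sum_unmatched_le Y Z m : Om Y -> \sum_(l < m | ~~ mt Y Z l) Y l <= 1 - Qmatch Y Z.
Proof.
move=> oY; have Y0 i := Om_ge0 i oY.
have [ub _] := (sumsto_nneg _ (keep_ge0 _ Y0)).1 (@sumsto_unmatched _ Y Z oY).
by have := ub m; rewrite sum_keep.
Qed.

Lemma unmatched_of_mult Y Z r : Om Y -> Om Z -> 0 < r -> (mult Z r < mult Y r)%N ->
  exists2 i, Y i = r & ~~ mt Y Z i.
Proof.
move=> oY oZ r0 h; have [|s [us ss hs]] := @unmatched_ex _ Y Z r 1 oY oZ r0; first by rewrite subn_gt0.
case: s us ss hs => [//|i l] _ _ hs; have [|Yi ni] := hs i; first by rewrite in_cons eqxx.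
by exists i.
Qed.

Lemma mult0 Y r : (forall i, r != Y i) -> mult Y r = 0%N.
Proof.
move=> h; rewrite /mult; apply/eqP; rewrite -leqn0 leqNgt -has_count; apply/hasPn => i _.
by rewrite /= eq_sym h.
Qed.

(* [u] hits both largest unmatched entries and [v] the second one of the
   side that has several: the lone large entry splits in two while the other side still
   keeps two large entries. *)
Lemma case2_step_aux n r Y Z u v : Om Y -> Om Z -> 0 < r -> 4 <= Nf n (atl r) Y Z ->
  ~~ case1 (r / 2) Y Z -> unmatched_max Z Y <= unmatched_max Y Z ->
  genericUV Y Z u v -> generic_cut Y Z v -> 0 < u < unmatched_max Z Y ->
  unmatched_max Z Y < v < unmatched_max Z Y + r / 2 ->
  case1 (r / 2) (new_seq Y Z u v) (new_seq Z Y u v).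
Proof.
move=> oY oZ r0 N4 c1 zy [gu gu' gv gv'] [g1 g2 g3 g4] hu hv.
have [sx [j [p [p' [nj hj jE uj [np np' rj rp rp']]]]]] := case2_lower oY oZ r0 N4 c1 zy.
have QE := Qmatch_sym oY oZ.
have [|AE _] := hit_max_eq oY gu; first by move: hu zy; lra.
have [AE' aj'] := hit_max_eq oZ gu' hu.
set y1 := unmatched_max Y Z in zy sx AE; set z1 := unmatched_max Z Y in zy hu hv jE AE'.
have sZ m := @sum_unmatched_le Z Y m oZ; rewrite -QE in sZ.
have zsum : Z j + Z p + Z p' <= 1 - Qmatch Y Z.
  by apply: le_trans (sZ (maxn j (maxn p p')).+1); apply: (@sum_three_le Z (fun i => ~~ mt Z Y i)) => //; rewrite ltnS !leq_max leqnn ?orbT.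
have us : u < 1 - Qmatch Y Z by move: zsum hu; rewrite -jE; lra.
have vs : v < 1 - Qmatch Y Z by move: zsum hv; rewrite -jE; lra.
have aj : idx_a Z Y u = j.
  apply/eqP; rewrite eqn_leq aj' // hj //; have [_ ->] := idx_aP oZ gu'.
  by rewrite -leNgt -QE ltW.
have bne : idx_b Z Y u v != idx_a Z Y u.
  by rewrite (idx_b_a oZ gu' gv') AE' -leNgt; move: hv; lra.
have nb : ~~ mt Z Y (idx_b Z Y u v).
  by rewrite (idx_b_mt oZ gu' gv' bne) -QE (le_gtF (ltW us)) -leNgt ltW.
have ib := idx_bP oZ gu' gv'; have B0 := inb_gt0 ib.
set b := idx_b Z Y u v in bne nb ib B0 *.
have bj : b != j by rewrite -aj.
(* A smaller unmatched entry would come after the three large ones, so its interval would start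
   beyond [Z j + 2 r], to the right of [v]. *)
have rb : r <= Z b.
  rewrite leNgt; apply/negP => zb.
  have lt q : r <= Z q -> (q < b)%N.
    by move=> rq; rewrite ltnNge; apply/negP => /(Om_noninc oZ); lra.
  have h3 : Z j + Z p + Z p' <= tleft Z Y b.
    by rewrite tleftE (negbTE nb); apply: (@sum_three_le Z (fun i => ~~ mt Z Y i)) => //; exact: lt.
  have hE : hleft Z Y u b = tleft Z Y b.
    rewrite hleftE (negbTE bne) aj ifF //; apply/negbTE; rewrite -leNgt.
    apply: le_trans h3; rewrite tleftE (negbTE nj) big1 ?addr_ge0 ?(ltW (lt_le_trans r0 _)) //;
      try lra.
    by move=> i ni; have := hj _ ni; rewrite leqNgt ltn_ord.
  by move: ib; rewrite /inb hE => /andP[]; move: hv; rewrite jE; lra.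
have [w [nw rw wj wb]] : exists w, [/\ ~~ mt Z Y w, r <= Z w, w != j & w != b].
  move: uj; rewrite /= !in_cons !in_nil !orbF => /andP[/norP[jp jp'] /andP[pp' _]].
  have [pb|pb] := eqVneq p b; last by exists p; split=> //; rewrite eq_sym.
  by exists p'; split=> //; rewrite eq_sym // -pb.
have zsum2 : Z j + Z b + Z w <= 1 - Qmatch Y Z.
  apply: le_trans (sZ (maxn j (maxn b w)).+1); apply: (@sum_three_le Z (fun i => ~~ mt Z Y i)) => //; try by rewrite ltnS !leq_max leqnn ?orbT.
  by rewrite /= !in_cons !in_nil !orbF negb_or ![j == _]eq_sym bj wj eq_sym wb.
have oY' := Om_new_seq oY gu gv; have oZ' := Om_new_seq oZ gu' gv'.
have vA : v < Y (idx_a Y Z u) by rewrite AE; move: hv; rewrite jE; lra.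
have vA' : Z (idx_a Z Y u) <= v by rewrite AE'; move: hv; lra.
have mY x (x0 : 0 < x) := mult_new_split oY gu gv vA x0.
have mZ x (x0 : 0 < x) := mult_new_merge oZ gu' gv' vA' x0.
rewrite AE in mY; rewrite -/b AE' jE in mZ.
rewrite jE in hv.
have [i0 i0E] : exists i, y1 = Y i by exists (idx_a Y Z u).
have ne (x y : R) : x < y -> (x == y) = false by move=> h; rewrite lt_eqF.
have ne' (x y : R) : x < y -> (y == x) = false by move=> h; rewrite gt_eqF.
have v0 : 0 < v by move: hv; lra.
have yv0 : 0 < y1 - v by move: hv; lra.
(* Two unmatched pieces are exhibited on each side after the step: [v] and [y1 - v] against
   [Z j + Z b] and [Z w]. *)
have [i1 i1E ni1] : exists2 i, new_seq Y Z u v i = v & ~~ mt (new_seq Y Z u v) (new_seq Z Y u v) i.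
  apply: unmatched_of_mult => //.
  have := mY v v0; have := mZ v v0; rewrite eqxx (mult0 g1).
  rewrite (ne' v y1) ?(ne' v (Z j + Z b)); [|move: hv; lra..].
  natlia.
have [i2 i2E ni2] : exists2 i, new_seq Y Z u v i = y1 - v & ~~ mt (new_seq Y Z u v) (new_seq Z Y u v) i.
  apply: unmatched_of_mult => //.
  have := mY _ yv0; have := mZ _ yv0; rewrite eqxx.
  have -> : mult Z (y1 - v) = 0%N.
    apply: mult0 => k; apply/eqP => E; move/eqP: (g2 i0 k); apply; rewrite -i0E -E; lra.
  have -> : (Z j + Z b == y1 - v) = false.
    apply/eqP => E; move/eqP: (g4 i0 j b); apply; rewrite -i0E; lra.
  rewrite (ne' _ y1); last by lra.
  natlia.
have [k1 k1E nk1] : exists2 i, new_seq Z Y u v i = Z j + Z b & ~~ mt (new_seq Z Y u v) (new_seq Y Z u v) i.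
  have x0 : 0 < Z j + Z b by lra.
  apply: unmatched_of_mult => //.
  have := mY _ x0; have := mZ _ x0; rewrite eqxx.
  rewrite (ne (Z j)) ?(ne (Z b)) ?(ne' _ y1) ?(ne v); [|move: hv; lra..].
  have -> : (y1 - v == Z j + Z b) = false.
    apply/eqP => E; move/eqP: (g4 i0 j b); apply; rewrite -i0E; lra.
  (* Otherwise [Y] would have an unmatched entry of this size besides [y1], more than the unmatched
     part can hold. *)
  have : (mult Y (Z j + Z b) <= mult Z (Z j + Z b))%N.
    rewrite leqNgt; apply/negP => /(unmatched_of_mult oY oZ x0)[k kE nk].
    have ka : k != idx_a Y Z u.
      by apply/eqP => E; move: kE; rewrite E AE; lra.
    have na : ~~ mt Y Z (idx_a Y Z u).
      by have [_ ->] := idx_aP oY gu; rewrite -leNgt ltW.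
    have := @two_unmatched Y Z (Z j + Z b) k (idx_a Y Z u) oY ka nk na.
    rewrite kE AE -/y1 lexx; lra.
  natlia.
have [k2 k2E nk2] : exists2 i, new_seq Z Y u v i = Z w & ~~ mt (new_seq Z Y u v) (new_seq Y Z u v) i.
  have x0 : 0 < Z w by lra.
  apply: unmatched_of_mult => //.
  have := mY _ x0; have := mZ _ x0.
  rewrite (negbTE (g1 w)).
  have -> : (y1 - v == Z w) = false.
    apply/eqP => E; move/eqP: (g2 i0 w); apply; rewrite -i0E; lra.
  (* The merged entries may have the same size as [w]. They are counted along with it, so that an
     unmatched copy survives their removal. *)
  have := @unmatched_seq _ Z Y (Z w) (w :: [seq i <- [:: j; b] | Z i == Z w]) oZ oY x0.
  set l := _ :: _ => h.
  have sz : size l = (1 + ((Z j == Z w) + (Z b == Z w)))%N.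
    by rewrite /l /=; case: (Z j == Z w); case: (Z b == Z w).
  have : (1 + ((Z j == Z w) + (Z b == Z w)) <= mult Z (Z w) - mult Y (Z w))%N.
    rewrite -sz; apply: h.
      rewrite /l cons_uniq filter_uniq; last by rewrite /= in_cons in_nil orbF eq_sym bj.
      by rewrite mem_filter !in_cons in_nil orbF (negbTE wj) (negbTE wb) andbF.
    move=> i; rewrite /l in_cons => /orP[/eqP -> //|].
    by rewrite mem_filter !in_cons in_nil orbF => /andP[/eqP -> /orP[] /eqP ->].
  natlia.
apply: (@two_sided_case1 _ _ (r / 2) i1 i2 k1 k2) => //.
- apply/eqP => E; move/eqP: (g3 i0); apply; move: i2E; rewrite -E i1E -i0E; lra.
- by rewrite i1E; move: hv; lra.
- by rewrite i2E; move: hv; lra.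
- apply/eqP => E; move: k2E; rewrite -E k1E.
  have := Om_noninc oZ (hj _ nw); lra.
- rewrite k1E; lra.
- rewrite k2E; lra.
Qed.

Lemma case1C r Y Z : Om Y -> Om Z -> case1 r Y Z = case1 r Z Y.
Proof. by move=> oY oZ; rewrite /case1 mxC (Qmatch_sym oY oZ). Qed.

Lemma NfC n psi Y Z : Nf n psi Y Z = Nf n psi Z Y.
Proof. by rewrite /Nf addrC. Qed.

Lemma case2_step n r Y Z u v : Om Y -> Om Z -> 0 < r -> 4 <= Nf n (atl r) Y Z ->
  ~~ case1 (r / 2) Y Z -> genericUV Y Z u v -> generic_cut Y Z v -> generic_cut Z Y v -> 0 < u < mn Y Z ->
  mn Y Z < v < mn Y Z + r / 2 ->
  case1 (r / 2) (new_seq Y Z u v) (new_seq Z Y u v).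
Proof.
move=> oY oZ r0 N4 c1 g gn gn'; have [gu gu' gv gv'] := g.
rewrite /mn; case: (leP (unmatched_max Y Z) (unmatched_max Z Y)) => h hu hv.
  rewrite case1C; [|exact: Om_new_seq|exact: Om_new_seq].
  by apply: (@case2_step_aux n) => //; rewrite 1?NfC 1?case1C //; split.
by apply: (@case2_step_aux n) => //; exact: ltW.
Qed.

(** Guarantees that the windows for [u] and [v] in [case2_step] lie in the unit interval, with
    lengths at least [r] and [r / 2]. *)
Lemma case2_mn n r Y Z : Om Y -> Om Z -> 0 < r -> 4 <= Nf n (atl r) Y Z ->
  ~~ case1 (r / 2) Y Z -> r <= mn Y Z /\ mn Y Z + r / 2 <= 1.
Proof.
have aux W V : Om W -> Om V -> 0 < r -> 4 <= Nf n (atl r) W V ->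
  ~~ case1 (r / 2) W V -> unmatched_max V W <= unmatched_max W V ->
  r <= unmatched_max V W /\ unmatched_max V W + r / 2 <= 1.
  move=> oW oV r0 N4 c1 h.
  have [_ [j [p [p' [nj hj jE uj [np np' rj rp rp']]]]]] := case2_lower oW oV r0 N4 c1 h.
  rewrite jE; split=> //.
  have := @sum_unmatched_le V W (maxn j (maxn p p')).+1 oV.
  have := @sum_three_le V (fun i => ~~ mt V W i) j p p' (maxn j (maxn p p')).+1 oV uj nj np np'.
  have /andP[_] := @unmatched_mass_ge0 _ V W oV.
  move=> h1 h2 h3; have := h2 _ _ _; rewrite !ltnS !leq_max !leqnn !orbT => h4.
  have {}h4 := h4 isT isT isT; lra.
move=> oY oZ r0 N4 c1; rewrite /mn; case: (leP (unmatched_max Y Z) (unmatched_max Z Y)) => h.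
  by apply: (aux Z Y) => //; rewrite 1?NfC 1?case1C.
by apply: (aux Y Z) => //; exact: ltW.
Qed.

End Case2.

(** * Stick breaking *)

Section Stick.
Variable R : realType.
Variable U : nat -> R.
Hypothesis U01 : forall j, 0 < U j < 1.

Lemma stick_rem_gt0 n : 0 < stick_rem U n.
Proof.
elim: n => [|n IH] /=; first exact: ltr01.
by have := U01 n => /andP[h1 h2]; rewrite -{1}[stick_rem U n]mul1r -mulrBl mulr_gt0 // subr_gt0.
Qed.

Lemma stick_ge0 j : 0 <= stick U j.
Proof. by rewrite /stick mulr_ge0 // ltW // ?stick_rem_gt0 //; have /andP[] := U01 j. Qed.

Lemma sum_stick n : \sum_(j < n) stick U j = 1 - stick_rem U n.
Proof.
elim: n => [|n IH]; first by rewrite big_ord0 subrr.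
by rewrite big_ord_recr /= IH /stick; lra.
Qed.

Lemma stick_le1 j : stick U j <= 1.
Proof.
have : stick U j <= \sum_(i < j.+1) stick U i.
  by rewrite big_ord_recr /= lerDr sumr_ge0 // => i _; exact: stick_ge0.
by rewrite sum_stick; have := stick_rem_gt0 j.+1; lra.
Qed.

Hypothesis rem0 : forall e, 0 < e -> exists n, stick_rem U n < e.

Lemma sumsto_stick : sumsto (stick U) 1.
Proof.
apply/sumsto_nneg; first exact: stick_ge0.
split=> [n|e /rem0[n hn]]; last by exists n; rewrite sum_stick; lra.
by rewrite sum_stick; have := stick_rem_gt0 n; lra.
Qed.

Lemma Om_PD1 : Om (PD1_sample U).
Proof. exact: Om_sortdesc stick_ge0 sumsto_stick. Qed.

Let sd : is_sortdesc (stick U) (PD1_sample U) :=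
  sortdescP (sumsto_sortable stick_ge0 sumsto_stick).

(** Each of the first [K] sticks counts at most once; among the later ones, each that exceeds [1/n]
    uses more than [1/n] of the mass left after [K] sticks. *)
Lemma PD1_count_le n K : (0 < n)%N ->
  Lf n (big1f n) (PD1_sample U) <= K%:R + n%:R * stick_rem U K.
Proof.
move=> n0; have [_ _ h] := sd.
have sub : submult (PD1_sample U) (stick U) by move=> r k r0; rewrite h.
have [|r r0|M hM] := submult_sum_le n sub (f := big1f n).
- by move=> r; rewrite ler0n.
- by rewrite /big1f le_gtF // (le_trans r0) // invr_ge0.
apply: le_trans hM _.
have [f0 _] := @large_big1 R n.
apply: (@le_trans _ _ (\sum_(j < K + M) big1f n (stick U j))).
  by apply: (@sum_ord_le _ (fun j => big1f n (stick U j))) => //; exact: leq_addl.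
suff : \sum_(j < K + M) big1f n (stick U j) <= K%:R + n%:R * (stick_rem U K - stick_rem U (K + M)).
  move=> /le_trans; apply; rewrite lerD2l ler_wpM2l // gerBl ltW //; exact: stick_rem_gt0.
elim: M => [|M IH].
  rewrite addn0 subrr mulr0 addr0; apply: (@le_trans _ _ (\sum_(j < K) 1)).
    by apply: ler_sum => j _; rewrite /big1f lern1 leq_b1.
  by rewrite sumr_const card_ord.
rewrite addnS big_ord_recr /=.
suff : big1f n (stick U (K + M)) <= n%:R * stick U (K + M).
  move: IH; rewrite /stick; lra.
rewrite /big1f; case: (ltP n%:R^-1 (stick U (K + M))) => hs.
  rewrite mulr1n; have n0' : 0 < n%:R :> R by rewrite ltr0n.
  by move: (ltW hs); rewrite -(ler_pM2l n0') mulfV // lt0r_neq0.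
by rewrite mulr0n mulr_ge0 // stick_ge0.
Qed.

(** Each of the first [K] sticks contributes at least its length minus [1/n] to the mass of the
    large entries. *)
Lemma PD1_dust_le n K : (0 < n)%N ->
  dust_mass n (PD1_sample U) <= stick_rem U K + K%:R / n%:R.
Proof.
move=> n0; have [_ _ h] := sd; have oY := Om_PD1.
have sub : submult (stick U) (PD1_sample U) by move=> r k r0; rewrite h.
have [f0 fs] := @large_bigmass R n.
have e0 : 0 <= n%:R^-1 :> R by rewrite invr_ge0.
have [r r0|M hM] := submult_sum_le K sub f0; first by apply: fs; exact: le_trans e0.
have hM' : \sum_(i < K) bigmass n (stick U i) <= Lf n (bigmass n) (PD1_sample U).
  apply: le_trans hM _; have [Mn|nM] := leqP M n.
    exact: (@sum_ord_le _ (fun j => bigmass n (PD1_sample U j))).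
  rewrite -(subnKC (ltnW nM)) big_split_ord /= [X in _ + X]big1 ?addr0 // => i _.
  apply: fs; rewrite leNgt; apply/negP => /(Om_index_lt_inv oY n0).
  by rewrite ltnNge leq_addr.
have : \sum_(i < K) (stick U i - n%:R^-1) <= \sum_(i < K) bigmass n (stick U i).
  apply: ler_sum => i _; rewrite /bigmass stick_le1 andbT.
  case: (ltP n%:R^-1 (stick U i)) => hs; rewrite ?mulr1 ?mulr0; lra.
rewrite sumrB sum_stick sumr_const card_ord -[_ *+ K]mulr_natl /dust_mass; lra.
Qed.

End Stick.

Lemma Nf_big_le (R : realType) n (Y Z : nat -> R) :
  Nf n (big1f n) Y Z <= Lf n (big1f n) Y + Lf n (big1f n) Z.
Proof.
by apply: lerD; apply: ler_sum => i _; case: ifP => _; rewrite // /big1f ler0n.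
Qed.

(** Propositional extensionality and proof irrelevance make all choices from unsatisfiable
    predicates equal. The default values thus do not vary with the sample point, which measurability
    needs. *)
Lemma choose_empty (A : Type) (d d0 : A) (P : A -> Prop) : ~ (exists x, P x) ->
  choose_spec d P = choose_spec d0 (fun _ => False).
Proof.
move=> nP; have -> : P = (fun _ => False).
  by apply/funext => x; apply/propext; split=> // Px; apply: nP; exists x.
by rewrite /choose_spec (Prop_irrelevance (inhabits d) (inhabits d0)).
Qed.

(** * Measurability of the chain *)

Section Measurability.
Variables (d : measure_display) (T : measurableType d) (R : realType).

Definition mprop (P : T -> Prop) := measurable [set w | P w].
Notation mfun := (@measurable_fun _ _ T R setT).
Definition mnat (k : T -> nat) := forall n, mprop (fun w => k w = n).
Definition mseq (X : T -> nat -> R) := forall i, mfun (fun w => X w i).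

Lemma mprop_ext P Q : (forall w, P w <-> Q w) -> mprop P -> mprop Q.
Proof.
move=> PQ; rewrite /mprop; have -> // : [set w | P w] = [set w | Q w].
by apply/funext => w; apply/propext.
Qed.

Lemma mprop_cst (P : Prop) : mprop (fun _ => P).
Proof.
rewrite /mprop; have [p|p] := pselect P.
  by rewrite (_ : [set _ | P] = setT) //; apply/seteqP; split.
by rewrite (_ : [set _ | P] = set0) //; apply/seteqP; split.
Qed.

Lemma mprop_not P : mprop P -> mprop (fun w => ~ P w).
Proof. exact: measurableC. Qed.

Lemma mprop_and P Q : mprop P -> mprop Q -> mprop (fun w => P w /\ Q w).
Proof. exact: measurableI. Qed.

Lemma mprop_or P Q : mprop P -> mprop Q -> mprop (fun w => P w \/ Q w).
Proof. exact: measurableU. Qed.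

Lemma mprop_imp P Q : mprop P -> mprop Q -> mprop (fun w => P w -> Q w).
Proof.
move=> mP mQ; apply: (mprop_ext (P := fun w => ~ P w \/ Q w)).
  by move=> w; split=> [[]//|h]; have [p|p] := pselect (P w); [right; exact: h|left].
by apply: mprop_or => //; exact: mprop_not.
Qed.

Lemma mprop_ex (I : countType) (P : I -> T -> Prop) :
  (forall i, mprop (P i)) -> mprop (fun w => exists i, P i w).
Proof.
move=> mP; rewrite /mprop (_ : [set w | _] = \bigcup_i [set w | P i w]).
  by apply: countable_bigcupT_measurable => //; exact: countableP.
by apply/seteqP; split=> w /=; [move=> [i Pi]; exists i | move=> [i _ Pi]; exists i].
Qed.

Lemma mprop_all (I : countType) (P : I -> T -> Prop) :
  (forall i, mprop (P i)) -> mprop (fun w => forall i, P i w).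
Proof.
move=> mP; apply: (mprop_ext (P := fun w => ~ exists i, ~ P i w)).
  move=> w; split=> [h i|h [i]]; last by apply; exact: h.
  by apply: contrapT => n; apply: h; exists i.
by apply: mprop_not; apply: mprop_ex => i; exact: mprop_not.
Qed.

Lemma mpropP (b : T -> bool) : measurable_fun setT b <-> mprop b.
Proof.
split=> [mb|mb].
  rewrite /mprop (_ : [set w | b w] = setT `&` b @^-1` [set true]); first exact: mb.
  by rewrite setTI; apply/seteqP; split=> w /=.
apply: (measurable_fun_bool true); rewrite setTI.
by rewrite (_ : b @^-1` [set true] = [set w | b w]) //; apply/seteqP; split=> w /=.
Qed.

Lemma mprop_lt f g : mfun f -> mfun g -> mprop (fun w => f w < g w).
Proof. by move=> mf mg; apply/mpropP; exact: measurable_fun_ltr. Qed.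

Lemma mprop_le f g : mfun f -> mfun g -> mprop (fun w => f w <= g w).
Proof. by move=> mf mg; apply/mpropP; exact: measurable_fun_ler. Qed.

Lemma mprop_eqb f g : mfun f -> mfun g -> mprop (fun w => f w == g w).
Proof. by move=> mf mg; apply/mpropP; exact: measurable_fun_eqr. Qed.

Lemma mprop_eq f g : mfun f -> mfun g -> mprop (fun w => f w = g w).
Proof. by move=> mf mg; apply: (mprop_ext _ (mprop_eqb mf mg)) => w; split=> /eqP. Qed.

Lemma mprop_andb (b c : T -> bool) : mprop b -> mprop c -> mprop (fun w => b w && c w).
Proof.
by move=> mb mc; apply: (mprop_ext _ (mprop_and mb mc)) => w; split=> [/andP|/andP].
Qed.

Lemma mprop_negb (b : T -> bool) : mprop b -> mprop (fun w => ~~ b w).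
Proof. by move=> mb; apply: (mprop_ext _ (mprop_not mb)) => w; split=> /negP. Qed.

Lemma mfun_gt f : (forall c, mprop (fun w => c < f w)) -> mfun f.
Proof.
move=> h; apply: (measurability _ (RGenOInfty.measurableE R)) => //.
move=> /= _ [_ [c ->] <-]; rewrite setTI.
rewrite (_ : _ @^-1` _ = [set w | c < f w]); first exact: h.
by apply/seteqP; split=> w /=; rewrite in_itv /= andbT.
Qed.

Lemma mfun_ext f g : (forall w, f w = g w) -> mfun f -> mfun g.
Proof. by move=> /funext ->. Qed.

Lemma mfun_cst (c : R) : mfun (fun _ => c).
Proof. exact: measurable_cst. Qed.

Lemma mfun_if (b : T -> bool) f g : mprop b -> mfun f -> mfun g ->
  mfun (fun w => if b w then f w else g w).
Proof. by move=> /mpropP mb mf mg; exact: measurable_fun_ifT. Qed.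

Lemma mfun_bool (b : T -> bool) : mprop b -> mfun (fun w => (b w)%:R).
Proof.
move=> mb; apply: (@mfun_ext (fun w => if b w then 1 else 0)) => [w|].
  by case: (b w).
by apply: mfun_if => //; exact: mfun_cst.
Qed.

Lemma mprop_asbool P : mprop P -> mprop (fun w => `[< P w >]).
Proof. by move=> mP; apply: (mprop_ext _ mP) => w; split=> /asboolP. Qed.

Lemma mnat_cst n : mnat (fun _ => n).
Proof. by move=> m; exact: mprop_cst. Qed.

(** A random index is eliminated by a countable union over its values. *)
Lemma mprop_sel (k : T -> nat) (P : nat -> T -> Prop) : mnat k ->
  (forall n, mprop (P n)) -> mprop (fun w => P (k w) w).
Proof.
move=> mk mP; apply: (mprop_ext (P := fun w => exists n, k w = n /\ P n w)).
  by move=> w; split=> [[n [<-]]//|Pk]; exists (k w).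
by apply: (@mprop_ex nat) => n; apply: mprop_and.
Qed.

Lemma mfun_sel (k : T -> nat) (F : nat -> T -> R) : mnat k ->
  (forall n, mfun (F n)) -> mfun (fun w => F (k w) w).
Proof.
move=> mk mF; apply: mfun_gt => c.
by apply: (mprop_sel (P := fun n w => c < F n w)) => // n; apply: mprop_lt => //; exact: mfun_cst.
Qed.

Lemma mprop_eqn k l : mnat k -> mnat l -> mprop (fun w => k w = l w).
Proof.
move=> mk ml; apply: (mprop_sel (P := fun n w => k w = n)) => //.
Qed.

Lemma mprop_atleast X r n : mseq X -> mfun r -> mprop (fun w => atleast (X w) (r w) n).
Proof.
move=> mX mr; apply: (@mprop_ex (seq nat)) => s.
apply: (mprop_ext (P := fun w => (uniq s /\ size s = n) /\ forall j, j \in s -> X w j = r w)).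
  by move=> w; split=> [[[? ?] ?]|[? ? ?]].
apply: mprop_and; first exact: mprop_cst.
apply: (@mprop_all nat) => j; apply: mprop_imp; first exact: mprop_cst.
exact: mprop_eq.
Qed.

Lemma mprop_sortable X : mseq X -> mprop (fun w => sortable (X w)).
Proof.
move=> mX; apply: (@mprop_all nat) => j; apply: mprop_imp.
  by apply: mprop_lt => //; exact: mfun_cst.
apply: (@mprop_ex nat) => N; apply: (@mprop_all nat) => i; apply: mprop_imp.
  exact: mprop_lt.
exact: mprop_cst.
Qed.

(** Replaces a sequence defined by choice by a condition on [x] that only quantifies over finite
    lists of indices, a countable type. *)
Lemma sortdesc_gt (x : nat -> R) k (c : R) : sortable x ->
  c < sortdesc x k <->
  c < 0 \/ exists s, [/\ uniq s, size s = k.+1 & forall j, j \in s -> c < x j].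
Proof.
move=> sx; have [y0 yd h] := sortdescP sx; set y := sortdesc x in y0 yd h *.
have ydl a b : (a <= b)%N -> y b <= y a.
  elim: b => [|b IH]; first by rewrite leqn0 => /eqP ->.
  by rewrite leq_eqVlt => /orP[/eqP ->//|/IH]; exact: le_trans.
split=> [cy|[c0|[s [us ss hs]]]]; last 2 first.
- exact: lt_le_trans c0 (y0 k).
- have [c0|c0] := ltP c 0; first exact: lt_le_trans c0 (y0 k).
  have xy : submult x y by move=> r n r0; rewrite h.
  have [i si|s' [us' ps']] := submult_inj xy us; first exact: le_lt_trans c0 (hs _ si).
  have hs' j : j \in s' -> c < y j.
    move=> js'; have : y j \in map x s by rewrite -(perm_mem ps'); exact: map_f.
    by move=> /mapP[i si ->]; exact: hs.
  have ss' : size s' = k.+1 by rewrite -(size_map y) (perm_size ps') size_map.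
  rewrite ltNge; apply/negP => yk.
  have : (size s' <= size (iota 0 k))%N.
    apply: uniq_leq_size => // j js'; rewrite mem_iota /= add0n ltnNge; apply/negP => kj.
    by have := hs' _ js'; have := ydl _ _ kj; lra.
  by rewrite size_iota ss' ltnn.
- have [c0|c0] := ltP c 0; [by left|right].
  have yx : submult y x by move=> r n r0; rewrite h.
  have hy i : i \in iota 0 k.+1 -> c < y i.
    by rewrite mem_iota /= add0n ltnS => ik; exact: lt_le_trans cy (ydl _ _ ik).
  have [i si|s' [us' ps']] := submult_inj yx (iota_uniq 0 k.+1).
    exact: le_lt_trans c0 (hy _ si).
  exists s'; split=> //.
    by rewrite -(size_map x) (perm_size ps') size_map size_iota.
  move=> j js'; have : x j \in map y (iota 0 k.+1) by rewrite -(perm_mem ps'); exact: map_f.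
  by move=> /mapP[i si ->]; exact: hy.
Qed.

(* The value of [sortdesc] on a sequence without a nonincreasing rearrangement:
   it has to be known for [sortdesc] to be measurable everywhere. *)
Definition junk_seq : nat -> R := choose_spec (fun _ => 0) (fun _ => False).

Lemma sortdesc_junk (x : nat -> R) : ~ sortable x -> sortdesc x = junk_seq.
Proof.
by move=> nx; apply: choose_empty => -[y /is_sortdesc_sortable].
Qed.

Lemma mseq_sortdesc X : mseq X -> mseq (fun w => sortdesc (X w)).
Proof.
move=> mX k; apply: mfun_gt => c.
apply: (mprop_ext (P := fun w => (sortable (X w) /\ (c < 0 \/
   exists s, (uniq s /\ size s = k.+1) /\ forall j, j \in s -> c < X w j)) \/
   (~ sortable (X w) /\ c < junk_seq k))).
  move=> w; have [sx|nsx] := pselect (sortable (X w)).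
    rewrite (sortdesc_gt k c sx); split=> [[[_ [?|[s [[? ?] ?]]]]|[]//]|[?|[s [? ? ?]]]].
    - by left.
    - by right; exists s.
    - by left; split=> //; left.
    - by left; split=> //; right; exists s.
  by rewrite sortdesc_junk //; split=> [[[]//|[]//]|?]; right.
have ms := mprop_sortable mX.
apply: mprop_or; apply: mprop_and => //; [|exact: mprop_not|exact: mprop_cst].
apply: mprop_or; first exact: mprop_cst.
apply: (@mprop_ex (seq nat)) => s; apply: mprop_and; first exact: mprop_cst.
apply: (@mprop_all nat) => j; apply: mprop_imp; first exact: mprop_cst.
by apply: mprop_lt => //; exact: mfun_cst.
Qed.

Lemma mnat_count (b : nat -> T -> bool) (s : seq nat) : (forall i, mprop (b i)) ->
  mnat (fun w => count (fun i => b i w) s).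
Proof.
move=> mb; elim: s => [|i s IH] n /=; first exact: mprop_cst.
apply: (mprop_ext (P := fun w => (b i w /\ exists m, (count (fun i => b i w) s = m /\ m.+1 = n)) \/
   (~ b i w /\ count (fun i => b i w) s = n))).
  move=> w; case: (b i w) => /=; rewrite ?add1n ?add0n; split.
  - by move=> [[_ [m [-> ->]]]|[]//].
  - by move=> <-; left; split=> //; exists (count (fun i => b i w) s).
  - by move=> [[]//|[_ ->]].
  - by move=> <-; right.
apply: mprop_or; apply: mprop_and => //; last exact: mprop_not.
by apply: (@mprop_ex nat) => m; apply: mprop_and => //; exact: mprop_cst.
Qed.

Lemma mprop_matched Y Z i : mseq Y -> mseq Z -> mprop (fun w => matched (Y w) (Z w) i).
Proof.
move=> mY mZ; apply: (mprop_sel (P := fun n w => atleast (Z w) (Y w i) n)).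
  by apply: mnat_count => j; exact: mprop_eqb.
by move=> n; exact: mprop_atleast.
Qed.

Lemma mprop_mt Y Z i : mseq Y -> mseq Z -> mprop (fun w => mt (Y w) (Z w) i).
Proof. by move=> mY mZ; apply: mprop_asbool; exact: mprop_matched. Qed.

(** All quantifiers of this Cauchy criterion range over [nat], so the set of convergence is
    measurable. *)
Lemma cvgn_cauchy (x : nat -> R) : cvgn x <->
  forall k : nat, exists N : nat, forall m n : nat, (N <= m)%N -> (N <= n)%N ->
   `|x m - x n| <= k.+1%:R^-1.
Proof.
split=> [cx k|h].
  have : 0 < k.+1%:R^-1 :> R by rewrite invr_gt0 ltr0n.
  move: (k.+1%:R^-1) => e e0; have k0 : 0 < e / 2 by rewrite divr_gt0.
  move/cvgrPdist_lt: cx => /(_ _ k0) [N _ hN]; exists N => m n Nm Nn.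
  have h1 := hN _ Nm; have h2 := hN _ Nn; rewrite /= in h1 h2.
  have := ler_distD (limn x) (x m) (x n); rewrite (distrC (x m) (limn x)); lra.
apply: cauchy_cvg; apply/cauchy_ballP => e e0.
have [k hk] : exists k : nat, k.+1%:R^-1 < e.
  exists (Num.truncn e^-1); rewrite -ltf_pV2 ?posrE ?invr_gt0 // ?invrK; exact: truncnS_gt.
have [N hN] := h k.
exists ([set x n | n in [set n | (N <= n)%N]], [set x n | n in [set n | (N <= n)%N]]).
  by split; exists N => // n /= Nn; exists n.
move=> [_ _] /= [[m Nm <-] [n Nn <-]].
by rewrite /ball /= /ball_ /=; exact: le_lt_trans (hN _ _ Nm Nn) hk.
Qed.

Lemma mfun_limn (h : nat -> T -> R) : (forall n, mfun (h n)) ->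
  mfun (fun w => limn (fun n => h n w)).
Proof.
move=> mh.
have mC : mprop (fun w => cvgn (fun n => h n w)).
  apply: (mprop_ext (fun w => iff_sym (cvgn_cauchy (fun n => h n w)))).
  apply: (@mprop_all nat) => k; apply: (@mprop_ex nat) => N; apply: (@mprop_all nat) => m.
  apply: (@mprop_all nat) => n; do 2 (apply: mprop_imp; first exact: mprop_cst).
  apply: mprop_le; last exact: mfun_cst.
  by apply: measurableT_comp => //; exact: measurable_funB.
(* Off the set of convergence [limn] takes the default [point], so the terms are replaced by that
   constant there. *)
apply: (@measurable_fun_cvg _ _ _ _
  (fun n w => if `[< cvgn (fun n => h n w) >] then h n w else point)).
  by move=> n; apply: mfun_if => //; exact: mprop_asbool.
move=> w _; have [cw|ncw] := pselect (cvgn (fun n => h n w)).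
  by rewrite asboolT.
rewrite asboolF // dvgP //; exact: cvg_cst.
Qed.

Lemma mfun_sum_cond (X : T -> nat -> R) (p : nat -> T -> bool) n : mseq X ->
  (forall i, mprop (p i)) -> mfun (fun w => \sum_(i < n | p i w) X w i).
Proof.
move=> mX mp.
apply: (@mfun_ext (fun w => \sum_(i < n) (if p i w then X w i else 0))).
  by move=> w; rewrite [RHS]big_mkcond.
apply: measurable_sum => i; apply: mfun_if => //; exact: mfun_cst.
Qed.

Lemma mfun_Qmatch Y Z : mseq Y -> mseq Z -> mfun (fun w => Qmatch (Y w) (Z w)).
Proof.
move=> mY mZ; apply: mfun_limn => n.
by apply: (@mfun_sum_cond Y (fun i w => mt (Y w) (Z w) i)) => // i; exact: mprop_mt.
Qed.

Lemma mseq_tleft Y Z : mseq Y -> mseq Z -> mseq (fun w => tleft (Y w) (Z w)).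
Proof.
move=> mY mZ i; apply: mfun_if; first exact: mprop_mt.
  apply: measurable_funD.
    by apply: measurable_funB; [exact: mfun_cst|exact: mfun_Qmatch].
  by apply: (@mfun_sum_cond Y (fun i w => mt (Y w) (Z w) i)) => // j; exact: mprop_mt.
apply: (@mfun_sum_cond Y (fun i w => ~~ mt (Y w) (Z w) i)) => // j.
by apply: mprop_negb; exact: mprop_mt.
Qed.

Lemma mnat_least (P : nat -> T -> Prop) : (forall n, mprop (P n)) ->
  mnat (fun w => least (fun n => P n w)).
Proof.
move=> mP n.
pose c : nat := choose_spec 0%N (fun _ => False).
apply: (mprop_ext (P := fun w => (P n w /\ forall m, P m w -> (n <= m)%N) \/
    (~ (exists m, P m w) /\ c = n))).
  move=> w; have [ex|nex] := pselect (exists m, P m w).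
    have ex' : exists n, P n w /\ forall m, P m w -> (n <= m)%N.
      have ex2 : exists m, `[< P m w >] by case: ex => m Pm; exists m; exact/asboolP.
      case: (ex_minnP ex2) => m /asboolP Pm hm; exists m; split=> // k Pk.
      by apply: hm; exact/asboolP.
    have [Pl hl] := ClassicalEpsilon.epsilon_spec (inhabits 0%N) _ ex'.
    rewrite -/(least (fun n => P n w)) in Pl hl; split.
      move=> [[Pn hn]|[]//]; apply/eqP; rewrite eqn_leq; apply/andP; split.
        exact: hl.
      exact: hn.
    by move=> <-; left.
  have -> : least (fun n => P n w) = c.
    by apply: choose_empty => -[m [Pm _]]; apply: nex; exists m.
  by split=> [[[Pn _]|[]//]|->]; [case: nex; exists n|right].
apply: mprop_or; apply: mprop_and => //.
- apply: (@mprop_all nat) => m; apply: mprop_imp => //; exact: mprop_cst.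
- by apply: mprop_not; apply: (@mprop_ex nat).
- exact: mprop_cst.
Qed.

Lemma mnat_idx_a Y Z u : mseq Y -> mseq Z -> mfun u ->
  mnat (fun w => idx_a (Y w) (Z w) (u w)).
Proof.
move=> mY mZ mu; apply: mnat_least => i; apply: mprop_andb; apply: mprop_le => //.
  exact: mseq_tleft.
by apply: measurable_funD => //; exact: mseq_tleft.
Qed.

Lemma mseq_hleft Y Z u : mseq Y -> mseq Z -> mfun u ->
  mseq (fun w => hleft (Y w) (Z w) (u w)).
Proof.
move=> mY mZ mu i; have ma := mnat_idx_a mY mZ mu; have mt' := mseq_tleft mY mZ.
apply: mfun_if; first 1 last.
- exact: mfun_cst.
- apply: mfun_if => //.
    apply: mprop_lt => //.
    exact: (mfun_sel (F := fun n w => tleft (Y w) (Z w) n) ma).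
  by apply: measurable_funD => //; exact: (mfun_sel (F := fun n w => Y w n) ma).
- apply: (mprop_ext (P := fun w => i = idx_a (Y w) (Z w) (u w))).
    by move=> w; split=> /eqP.
  by apply: mprop_eqn => //; exact: mnat_cst.
Qed.

Lemma mnat_idx_b Y Z u v : mseq Y -> mseq Z -> mfun u -> mfun v ->
  mnat (fun w => idx_b (Y w) (Z w) (u w) (v w)).
Proof.
move=> mY mZ mu mv; have mh := mseq_hleft mY mZ mu.
apply: mnat_least => i; apply: mprop_andb; apply: mprop_le => //.
by apply: measurable_funD.
Qed.

Lemma mseq_merge Y a b : mseq Y -> mnat a -> mnat b ->
  mseq (fun w => merge_seq (Y w) (a w) (b w)).
Proof.
move=> mY ma mb i.
have eqm k : mnat k -> mprop (fun w => i == k w).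
  move=> mk; apply: (mprop_ext (P := fun w => i = k w)) => [w|].
    by split=> /eqP.
  by apply: mprop_eqn => //; exact: mnat_cst.
have sel k : mnat k -> mfun (fun w => Y w (k w)).
  by move=> mk; exact: (mfun_sel (F := fun n w => Y w n)).
apply: mfun_if; [exact: eqm|by apply: measurable_funD; exact: sel|].
by apply: mfun_if; [exact: eqm|exact: mfun_cst|].
Qed.

Lemma mseq_split Y a v : mseq Y -> mnat a -> mfun v ->
  mseq (fun w => split_seq (Y w) (a w) (v w)).
Proof.
move=> mY ma mv [|i] /=.
  by apply: measurable_funB => //; exact: (mfun_sel (F := fun n w => Y w n)).
apply: mfun_if => //; apply: (mprop_ext (P := fun w => i = a w)) => [w|].
  by split=> /eqP.
by apply: mprop_eqn => //; exact: mnat_cst.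
Qed.

Lemma mseq_new Y Z u v : mseq Y -> mseq Z -> mfun u -> mfun v ->
  mseq (fun w => new_seq (Y w) (Z w) (u w) (v w)).
Proof.
move=> mY mZ mu mv i.
have ma := mnat_idx_a mY mZ mu; have mb := mnat_idx_b mY mZ mu mv.
have E w : new_seq (Y w) (Z w) (u w) (v w) i =
  if idx_a (Y w) (Z w) (u w) != idx_b (Y w) (Z w) (u w) (v w)
  then sortdesc (merge_seq (Y w) (idx_a (Y w) (Z w) (u w)) (idx_b (Y w) (Z w) (u w) (v w))) i
  else sortdesc (split_seq (Y w) (idx_a (Y w) (Z w) (u w)) (v w)) i.
  by rewrite /new_seq; case: ifP.
apply: (mfun_ext (fun w => esym (E w))).
apply: mfun_if.
- apply: mprop_negb; apply: (mprop_ext (P := fun w => idx_a (Y w) (Z w) (u w) = idx_b (Y w) (Z w) (u w) (v w))) => [w|].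
    by split=> /eqP.
  exact: mprop_eqn.
- by apply: mseq_sortdesc; exact: mseq_merge.
- by apply: mseq_sortdesc; exact: mseq_split.
Qed.

Lemma mfun_stick_rem X n : mseq X -> mfun (fun w => stick_rem (X w) n).
Proof.
move=> mX; elim: n => [|n IH]; first exact: mfun_cst.
by apply: measurable_funB => //; exact: measurable_funM.
Qed.

Lemma mseq_PD1 X : mseq X -> mseq (fun w => PD1_sample (X w)).
Proof.
move=> mX; apply: mseq_sortdesc => j; apply: measurable_funM => //.
exact: mfun_stick_rem.
Qed.

Lemma mseq_chain (A B : T -> nat -> R) (f g : T -> nat -> R) t :
  mseq A -> mseq B -> (forall i, (i < t)%N -> mfun (f^~ i)) -> (forall i, (i < t)%N -> mfun (g^~ i)) ->
  mseq (fun w => (chain (A w) (B w) (f w) (g w) t).1) /\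
  mseq (fun w => (chain (A w) (B w) (f w) (g w) t).2).
Proof.
move=> mA mB; elim: t => [|t IH] mf mg; first by split; exact: mseq_PD1.
have [i it|i it|m1 m2] := IH; first by apply: mf; exact: ltnW.
  by apply: mg; exact: ltnW.
by split; apply: mseq_new => //; [exact: mf|exact: mg|exact: mf|exact: mg].
Qed.

(** Three regimes: the maximum is attained, everything is matched, or no value meets the
    specification and the fixed default is returned. *)
Lemma mfun_unmatched_max Y Z : mseq Y -> mseq Z ->
  mfun (fun w => unmatched_max (Y w) (Z w)).
Proof.
move=> mY mZ; apply: mfun_gt => c.
pose M w i := ~ matched (Y w) (Z w) i /\ forall j, ~ matched (Y w) (Z w) j -> Y w j <= Y w i.
pose junk : R := choose_spec 0 (fun _ => False).
apply: (mprop_ext (P := fun w => (exists i, M w i /\ c < Y w i) \/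
  (((forall i, matched (Y w) (Z w) i) /\ c < 0) \/
   ((~ (exists i, M w i) /\ ~ (forall i, matched (Y w) (Z w) i)) /\ c < junk)))).
  move=> w; rewrite /unmatched_max; set S := (X in choose_spec 0 X).
  have [[i [ni hi]]|nM] := pselect (exists i, M w i).
    have ex : exists r, S r by exists (Y w i); left; exists i.
    rewrite /choose_spec.
    have [[j [nj -> hj]]|[/(_ i)//]] := ClassicalEpsilon.epsilon_spec (inhabits (0 : R)) _ ex.
    have -> : Y w j = Y w i by apply/eqP; rewrite eq_le hi // hj.
    split=> [[[k [[nk hk] ck]]|[[/(_ i)//]|[[[]]]]]|ci]; last by left; exists i.
      by have -> : Y w i = Y w k by apply/eqP; rewrite eq_le hi // hk.
    by exists i.
  have [hall|nall] := pselect (forall i, matched (Y w) (Z w) i).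
    have ex : exists r, S r by exists 0; right.
    rewrite /choose_spec.
    have [[j [/(_ (hall j))//]]|[_ ->]] := ClassicalEpsilon.epsilon_spec (inhabits (0 : R)) _ ex.
    split=> [[[k [[/(_ (hall k))//]]]|[[_ //]|[[_]//]]]|c0]; by right; left.
  have -> : choose_spec 0 S = junk.
    apply: choose_empty => -[r [[i [ni _ hi]]|[]//]].
    by apply: nM; exists i.
  split=> [[[k [Mk _]]|[[]//|[_ //]]]|cj]; last by right; right.
  by case: nM; exists k.
have mm i := mprop_matched i mY mZ.
have mM i : mprop (fun w => M w i).
  apply: mprop_and; first exact: mprop_not.
  apply: (@mprop_all nat) => j; apply: mprop_imp; first exact: mprop_not.
  exact: mprop_le.
have mall : mprop (fun w => forall i, matched (Y w) (Z w) i) by exact: (@mprop_all nat).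
apply: mprop_or.
  apply: (@mprop_ex nat) => i; apply: mprop_and => //.
  by apply: mprop_lt => //; exact: mfun_cst.
apply: mprop_or; apply: mprop_and => //; try exact: mprop_cst.
by apply: mprop_and; apply: mprop_not => //; exact: (@mprop_ex nat).
Qed.

End Measurability.

(** * Independence and conditional uniformity *)

Section Independence.
Variables (d : measure_display) (T : measurableType d) (R : realType) (P : probability T R).
Variables (I : choiceType) (E : I -> set (set T)).
Hypothesis ind : mutually_independent P E.
Hypothesis Em : forall i, E i `<=` measurable.
Hypothesis ET : forall i, E i setT.
Hypothesis EI : forall i, setI_closed (E i).
Variable S : set I.

Definition gens : set (set T) := \bigcup_(i in S) E i.

Let cyl : set (set T) := [set A | exists (J : {fset I}) (F : I -> set T),
  (forall i, i \in J -> S i /\ E i (F i)) /\ A = \bigcap_(i in [set` J]) F i].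

Let cylI : setI_closed cyl.
Proof.
move=> _ _ [J [F [hF ->]]] [K [G [hG ->]]].
exists (J `|` K)%fset, (fun i => (if i \in J then F i else setT) `&` (if i \in K then G i else setT)).
split.
  move=> i; rewrite in_fsetU => iJK; split.
    by move: iJK => /orP[/hF[]|/hG[]].
  by apply: EI; case: ifP => // h; [exact: (hF _ h).2|exact: (hG _ h).2].
apply/seteqP; split=> w /=.
  move=> [wF wG] i _; split; case: ifP => // h; [exact: wF|exact: wG].
move=> h; split=> i /= iJ; have := h i; rewrite /= in_fsetU iJ ?orbT => /(_ isT)[] //.
Qed.

Let cyl_meas : cyl `<=` measurable.
Proof.
move=> _ [J [F [hF ->]]]; apply: fin_bigcap_measurable; first exact: finite_fset.
by move=> i /= /hF[_ /Em].
Qed.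

Let cylT : cyl setT.
Proof.
exists fset0, (fun _ => setT); split=> //.
by apply/seteqP; split=> // w _ i.
Qed.

(** Uniqueness of measures: [P (A & B)] and [P A * P B] are finite measures in [A] that agree on
    cylinders, a family stable under intersection that generates the sigma-algebra. *)
Lemma independent_gens i0 A B : ~ S i0 -> E i0 B -> <<s gens >> A ->
  P (A `&` B) = (P A * P B)%E.
Proof.
move=> ni0 EB sA.
have mB := Em EB.
have PBfin : P B \is a fin_num by exact: fin_num_measure.
have pB0 : 0 <= fine (P B) by rewrite fine_ge0.
pose m2 := mscale (NngNum pB0) P.
have m2E C : m2 C = (P B * P C)%E by rewrite -[X in (X * _)%E](fineK PBfin).
have sA' : <<s cyl >> A.
  move: A sA; apply: smallest_sub; first exact: smallest_sigma_algebra.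
  move=> A [i Si EA]; apply: sub_sigma_algebra.
  exists [fset i]%fset, (fun _ => A); split=> [j|]; first by rewrite in_fset1 => /eqP ->.
  apply/seteqP; split=> w; first by move=> ? j.
  by move=> /(_ i); apply; rewrite /= in_fset1.
have := @g_sigma_algebra_measure_unique _ R T cyl cyl_meas (fun=> setT) (fun=> cylT) _
  (mrestr P mB) m2 cylI.
move=> h; have {}h := h _ _ _ A sA'.
have -> : P (A `&` B) = mrestr P mB A by [].
rewrite h.
- by rewrite muleC; exact: m2E.
- by apply/seteqP; split=> // w _; exists 0%N.
- move=> C [J [F [hF ->]]].
  apply/esym; rewrite [LHS]m2E; apply/esym.
  transitivity (P (\bigcap_(i in [set` J]) F i `&` B)) => //.
  have i0J : i0 \notin J by apply/negP => /hF[].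
  (* [B] becomes one more factor of the cylinder, at the index [i0] outside [J]. *)
  pose F' i := if i == i0 then B else F i.
  have -> : \bigcap_(i in [set` J]) F i `&` B = \bigcap_(i in [set` (i0 |` J)%fset]) F' i.
    apply/seteqP; split=> w /=.
      move=> [wF wB] i /=; rewrite in_fset1U /F'; case: eqP => //= _ iJ; exact: wF.
    move=> hw; split=> [i /= iJ|]; last first.
      by have := hw i0; rewrite /F' eqxx; apply; rewrite /= in_fset1U eqxx.
    have := hw i; rewrite /F' /= in_fset1U iJ orbT; case: eqP => [ii0|_]; last exact.
    by rewrite ii0 (negbTE i0J) in iJ.
  rewrite ind; last first.
    move=> i; rewrite in_fset1U /F'; case: eqP => [->//|_] /= iJ; exact: (hF _ iJ).2.
  rewrite ind; last by move=> i iJ; exact: (hF _ iJ).2.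
  rewrite big_fsetU1 // /F' eqxx; congr (_ * _)%E.
  rewrite big_seq [RHS]big_seq; apply: eq_bigr => i iJ; case: eqP => // ii0.
  by rewrite ii0 (negbTE i0J) in iJ.
- move=> _; rewrite -[ltLHS]/(P (setT `&` B)) setTI; exact: (le_lt_trans (probability_le1 P mB) (ltry _)).
Qed.

End Independence.

Definition clip (R : realType) (x : R) : R := Num.min 1 (Num.max 0 x).
(** The Lebesgue measure of []a, b[] within the unit interval, for arbitrary [a] and [b]. *)
Definition len (R : realType) (a b : R) : R := Num.max 0 (clip b - clip a).

Lemma uniform_itv (R : realType) (a b : R) :
  uniform_prob (@ltr01 R) `]a, b[%classic = (len a b)%:E.
Proof.
set A := `]a, b[%classic.
have mA : measurable A by exact: measurable_itv.
have -> : uniform_prob (@ltr01 R) A = (\int[uniform_prob (@ltr01 R)]_x (\1_A x)%:E)%E.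
  by rewrite integral_indic // setIT.
rewrite integral_uniform; [|by apply/measurable_EFinP; exact: measurable_indic|
  by move=> x; rewrite lee_fin].
rewrite subr0 invr1 mul1e integral_indic //.
rewrite setIC.
have ca (x : R) : clip x = if x < 0 then 0 else if x < 1 then x else 1.
  rewrite /clip; case: (ltP x 0) => h; first exact/min_idPr.
  by case: (ltP x 1).
have lo : (lebesgue_measure `]clip a, clip b[%classic <= lebesgue_measure ((`[0%R, 1%R]%classic : set R) `&` A))%E.
  apply: le_measure; [by apply: mem_set; exact: measurable_itv|
    by apply: mem_set; apply: measurableI; exact: measurable_itv|].
  move=> x; rewrite /A /= !in_itv /= !ca => /andP[].
  case: (ltP a 0) => h1; case: (ltP a 1) => h2; case: (ltP b 0) => h3; case: (ltP b 1) => h4;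
   move=> h5 h6; split; lra.
have hi : (lebesgue_measure ((`[0%R, 1%R]%classic : set R) `&` A) <= lebesgue_measure `[clip a, clip b]%classic)%E.
  apply: le_measure; [by apply: mem_set; apply: measurableI; exact: measurable_itv|
    by apply: mem_set; exact: measurable_itv|].
  move=> x; rewrite /A /= !in_itv /= !ca => -[/andP[h7 h8] /andP[h5 h6]].
  case: (ltP a 0) => h1; case: (ltP a 1) => h2; case: (ltP b 0) => h3; case: (ltP b 1) => h4; lra.
apply/eqP; rewrite eq_le; apply/andP; split.
  apply: le_trans hi _; rewrite lebesgue_measure_itv /= lte_fin /len.
  by case: ifP => h; rewrite ?EFinB lee_fin le_max ?lexx ?orbT.
apply: le_trans lo; rewrite lebesgue_measure_itv /= lte_fin /len.
case: ltP => h; rewrite -?EFinB lee_fin ge_max; first by rewrite lexx andbT subr_ge0 ltW.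
by rewrite lexx /= subr_le0.
Qed.

(** * Integrating out a variable independent of a sigma-algebra *)

Section Freezing.
Variables (d : measure_display) (T : measurableType d) (R : realType) (P : probability T R).
Variables (I : choiceType) (E : I -> set (set T)).
Hypothesis ind : mutually_independent P E.
Hypothesis Em : forall i, E i `<=` measurable.
Hypothesis ET : forall i, E i setT.
Hypothesis EI : forall i, setI_closed (E i).
Variable S : set I.

Local Notation TS := (g_sigma_algebraType (gens E S)).

Lemma gens_measurable (A : set T) : <<s gens E S >> A -> measurable A.
Proof.
move: A; apply: smallest_sub; first exact: sigma_algebra_measurable.
by move=> A [i _]; exact: Em.
Qed.

(** The identity, seen as a random variable with values in [T] equipped with the sigma-algebra of
    the sources in [S]; it stands for all the information frozen. *)
Definition to_gens : T -> TS := id.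

Lemma measurable_to_gens : measurable_fun setT to_gens.
Proof. by move=> _ A mA; rewrite setTI; exact: gens_measurable. Qed.

HB.instance Definition _ := @isMeasurableFun.Build _ _ _ _ to_gens measurable_to_gens.

Lemma measurable_of_gens d' (T' : measurableType d') (f : T -> T') :
  measurable_fun (setT : set TS) (f : TS -> T') -> measurable_fun (setT : set T) f.
Proof. by move=> mf; exact: (measurableT_comp mf measurable_to_gens). Qed.

Variables (i0 : I) (X : {mfun T >-> R}).
Hypothesis ni0 : ~ S i0.
Hypothesis EX : forall A : set R, measurable A -> E i0 (X @^-1` A).

(** By independence the joint law of [to_gens] and [X] is a product measure, and Fubini-Tonelli
    applies. *)
Lemma freezing (f : TS * R -> \bar R) : measurable_fun setT f -> (forall x, 0 <= f x)%E ->
  (\int[P]_w f (to_gens w, X w) =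
   \int[P]_w \int[distribution P X]_x f (to_gens w, x))%E.
Proof.
move=> mf f0.
pose phi : T -> TS * R := fun w => (to_gens w, X w).
have mphi : measurable_fun setT phi.
  by apply: measurable_fun_pair => //; exact: measurable_to_gens.
pose phim : {mfun T >-> (TS * R)%type} :=
  HB.pack phi (@isMeasurableFun.Build _ _ _ _ phi mphi).
pose Q : probability TS R := distribution P to_gens.
transitivity (\int[distribution P phim]_z f z)%E.
  by rewrite ge0_integral_pushforward.
transitivity (\int[(Q \x distribution P X)%E]_z f z)%E.
  apply: eq_measure_integral => A mA _; apply/esym.
  apply: (@product_measure_unique _ _ _ _ _ Q (distribution P X) (distribution P phim)) => // B C mB mC.
  exact: (independent_gens ind Em ET EI (S := S) ni0 (EX mC) mB).
rewrite fubini_tonelli1 // ge0_integral_pushforward //.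
- exact: measurable_fun_fubini_tonelli_F.
- by move=> w _; apply: integral_ge0.
Qed.

Hypothesis XU : forall A : set R, measurable A ->
  distribution P X A = uniform_prob (@ltr01 R) A.

Lemma freezing_itv (W a b : T -> R) :
  measurable_fun (setT : set TS) (W : TS -> R) -> measurable_fun (setT : set TS) (a : TS -> R) ->
  measurable_fun (setT : set TS) (b : TS -> R) -> (forall w, 0 <= W w) ->
  \int[P]_w (W w * (a w < X w < b w)%R%:R) = \int[P]_w (W w * len (a w) (b w)).
Proof.
move=> mW ma mb W0; congr fine.
pose f (z : TS * R) := (W z.1 * (a z.1 < z.2 < b z.1)%R%:R)%:E.
have mf : measurable_fun setT f.
  apply/measurable_EFinP; apply: measurable_funM; first exact: measurableT_comp.
  apply: mfun_bool; apply: mprop_andb; apply: mprop_lt => //; exact: measurableT_comp.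
have f0 z : (0 <= f z)%E by rewrite lee_fin mulr_ge0.
rewrite [LHS](freezing mf f0); apply: eq_integral => w _.
have -> : (fun x => f (to_gens w, x)) =
  (fun x => (W w)%:E * (\1_(`]a w, b w[%classic : set R) x)%:E)%E.
  apply/funext => x; rewrite /f /= -EFinM indicE; congr (_ * _%:R)%:E.
  by rewrite mem_setE in_itv.
rewrite ge0_integralZl //; last first.
- by rewrite lee_fin.
- by apply/measurable_EFinP; exact: measurable_indic.
rewrite integral_indic // setIT EFinM; congr (_ * _)%E.
by apply: etrans (XU _) (uniform_itv _ _); exact: measurable_itv.
Qed.

End Freezing.

(** * Expectations of bounded measurable functions *)

Section Expectation.
Variables (d : measure_display) (T : measurableType d) (R : realType) (P : probability T R).
Implicit Types f g : T -> R.

Definition bm f := measurable_fun setT f /\ exists M, forall w, `|f w| <= M.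

Definition Ex f : R := \int[P]_w f w.

Lemma bm_integrable f : bm f -> P.-integrable setT (EFin \o f).
Proof.
move=> [mf [M hM]]; apply: measurable_bounded_integrable => //.
  by apply: (le_lt_trans (probability_le1 P measurableT)); exact: ltry.
exists M; split; first by rewrite num_real.
by move=> x Mx w _; exact: le_trans (hM w) (ltW Mx).
Qed.

Lemma bm_cst c : bm (fun=> c).
Proof. by split; [exact: measurable_cst|exists `|c|]. Qed.

Lemma bm_ext f g : (forall w, f w = g w) -> bm f -> bm g.
Proof. by move=> /funext ->. Qed.

Lemma bm_add f g : bm f -> bm g -> bm (fun w => f w + g w).
Proof.
move=> [mf [M hM]] [mg [N hN]]; split; first exact: measurable_funD.
by exists (M + N) => w; apply: le_trans (ler_normD _ _) (lerD (hM w) (hN w)).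
Qed.

Lemma bm_sub f g : bm f -> bm g -> bm (fun w => f w - g w).
Proof.
move=> [mf [M hM]] [mg [N hN]]; split; first exact: measurable_funB.
by exists (M + N) => w; apply: le_trans (ler_normB _ _) (lerD (hM w) (hN w)).
Qed.

Lemma bm_mul f g : bm f -> bm g -> bm (fun w => f w * g w).
Proof.
move=> [mf [M hM]] [mg [N hN]]; split; first exact: measurable_funM.
by exists (M * N) => w; rewrite normrM; apply: ler_pM.
Qed.

Lemma bm_sum (I : Type) (s : seq I) (F : I -> T -> R) : (forall i, bm (F i)) ->
  bm (fun w => \sum_(i <- s) F i w).
Proof.
move=> bF; elim: s => [|i s IH].
  by apply: (bm_ext _ (bm_cst 0)) => w; rewrite big_nil.
by apply: (bm_ext _ (bm_add (bF i) IH)) => w; rewrite big_cons.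
Qed.

Lemma bm_bool (b : T -> bool) : mprop b -> bm (fun w => (b w)%:R).
Proof.
move=> mb; split; first exact: mfun_bool.
by exists 1 => w; case: (b w); rewrite ?normr1 ?normr0.
Qed.

Lemma bm_if (b : T -> bool) f g : mprop b -> bm f -> bm g ->
  bm (fun w => if b w then f w else g w).
Proof.
move=> mb [mf [M hM]] [mg [N hN]]; split; first exact: mfun_if.
exists (Num.max M N) => w; case: (b w); rewrite le_max ?hM ?hN ?orbT //.
Qed.

Lemma bm_comp (psi : R -> R) f M : measurable_fun setT psi -> (forall x, `|psi x| <= M) ->
  measurable_fun setT f -> bm (fun w => psi (f w)).
Proof.
by move=> mp hp mf; split; [exact: measurableT_comp|exists M => w].
Qed.

Lemma Ex_cst c : Ex (fun=> c) = c.
Proof.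
transitivity (c * fine (P setT)); first exact: Rintegral_cst.
by rewrite probability_setT mulr1.
Qed.

Lemma Ex_add f g : bm f -> bm g -> Ex (fun w => f w + g w) = Ex f + Ex g.
Proof. by move=> bf bg; rewrite /Ex RintegralD //; exact: bm_integrable. Qed.

Lemma Ex_sub f g : bm f -> bm g -> Ex (fun w => f w - g w) = Ex f - Ex g.
Proof. by move=> bf bg; rewrite /Ex RintegralB //; exact: bm_integrable. Qed.

Lemma Ex_scale c f : bm f -> Ex (fun w => c * f w) = c * Ex f.
Proof. by move=> bf; rewrite /Ex RintegralZl //; exact: bm_integrable. Qed.

Lemma Ex_sum (I : Type) (s : seq I) (F : I -> T -> R) : (forall i, bm (F i)) ->
  Ex (fun w => \sum_(i <- s) F i w) = \sum_(i <- s) Ex (F i).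
Proof.
move=> bF; elim: s => [|i s IH].
  rewrite big_nil -[RHS](Ex_cst 0); congr Ex; apply/funext => w; exact: big_nil.
rewrite big_cons -IH -Ex_add //; last exact: bm_sum.
by congr Ex; apply/funext => w; rewrite big_cons.
Qed.

Lemma Ex_bool (b : T -> bool) : mprop b -> (Ex (fun w => (b w)%:R))%:E = P [set w | b w].
Proof.
move=> mb; rewrite /Ex /Rintegral.
have -> : (\int[P]_w (b w)%:R%:E)%E = P [set w | b w].
  transitivity (\int[P]_w (\1_[set w | b w] w)%:E)%E.
    by apply: eq_integral => w _; rewrite indicE mem_setE.
  by rewrite integral_indic ?setIT.
by rewrite fineK // fin_num_measure.
Qed.

Lemma Ex_le_ae f g : bm f -> bm g -> (\forall w \ae P, f w <= g w) -> Ex f <= Ex g.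
Proof.
move=> bf bg [N [mN PN hN]].
have [mf [M hM]] := bf; have [mg [M' hM']] := bg.
have mN' : mprop (fun w => `[< N w >]) by apply: mprop_asbool.
have bN := bm_bool mN'.
have E0 : Ex (fun w => (`[< N w >])%:R) = 0.
  apply: EFin_inj; rewrite (Ex_bool mN').
  by rewrite (_ : [set w | _] = N) //; apply/seteqP; split=> w /= /asboolP.
(* A large multiple of the indicator of the null set turns the almost sure inequality into one that
   holds everywhere, without changing the expectation. *)
have -> : Ex g = Ex (fun w => g w + (M + M') * (`[< N w >])%:R).
  rewrite Ex_add //; last by apply: bm_mul => //; exact: bm_cst.
  by rewrite Ex_scale // E0 mulr0 addr0.
apply: le_Rintegral => //; try apply: bm_integrable => //.
  by apply: bm_add => //; apply: bm_mul => //; exact: bm_cst.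
move=> w _; case: asboolP => Nw.
  rewrite mulr1; have := hM w; have := hM' w; rewrite !ler_norml => /andP[h1 h2] /andP[h3 h4].
  lra.
rewrite mulr0 addr0; apply: contrapT => h; apply: Nw; exact: hN.
Qed.

Lemma Ex_le f g : bm f -> bm g -> (forall w, f w <= g w) -> Ex f <= Ex g.
Proof.
by move=> bf bg h; apply: Ex_le_ae => //; apply: aeW.
Qed.

Lemma Ex_eq_ae f g : bm f -> bm g -> (\forall w \ae P, f w = g w) -> Ex f = Ex g.
Proof.
move=> bf bg h; apply/eqP; rewrite eq_le; apply/andP; split; apply: Ex_le_ae => //;
  by apply: filterS h => w ->.
Qed.

Lemma ae_bool (b : T -> bool) : mprop b -> Ex (fun w => (b w)%:R) <= 0 ->
  \forall w \ae P, ~~ b w.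
Proof.
move=> mb hb; exists [set w | b w]; split=> //.
  apply/eqP; rewrite eq_le measure_ge0 andbT -Ex_bool // lee_fin //.
by move=> w /= /negP; rewrite negbK.
Qed.

Lemma ae_all (I : countType) (Q : I -> T -> Prop) :
  (forall i, \forall w \ae P, Q i w) -> \forall w \ae P, forall i, Q i w.
Proof.
move=> h.
have h' : forall n, \forall w \ae P, (fun n w => if choice.unpickle n is Some i then Q i w else True) n w.
  by move=> n; case: (choice.unpickle n) => [i|]; [exact: h|exact: aeW].
apply: filterS (ae_foralln h') => w hw i.
by have := hw (choice.pickle i); rewrite choice.pickleK.
Qed.

End Expectation.

(** * Lengths of intervals within the unit interval *)

Section Length.
Variable R : realType.
Implicit Types a b x : R.

Lemma len_ge0 a b : 0 <= len a b. Proof. by rewrite le_max lexx. Qed.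

Lemma clip01 a : 0 <= a <= 1 -> clip a = a.
Proof. by move=> /andP[h1 h2]; rewrite /clip (max_idPr h1); apply/min_idPr. Qed.

Lemma len01 a b : 0 <= a -> a <= b -> b <= 1 -> len a b = b - a.
Proof.
move=> a0 ab b1; rewrite /len !clip01; [|lra..].
by apply/max_idPr; rewrite subr_ge0.
Qed.

Lemma clip_ge0_le1 a : 0 <= clip a <= 1.
Proof. by rewrite /clip le_min ler01 le_max lexx ge_min lexx. Qed.

Lemma len_le1 a b : len a b <= 1.
Proof. by rewrite /len ge_max ler01 /=; have := clip_ge0_le1 a; have := clip_ge0_le1 b; lra. Qed.

Lemma len_le a b : a <= b -> len a b <= b - a.
Proof.
move=> ab; rewrite /len ge_max subr_ge0 ab /= /clip.
case: (leP 0 a) => h1; case: (leP 0 b) => h2; rewrite ?(max_idPr h1) ?(max_idPr h2)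
  ?(max_idPl (ltW h1)) ?(max_idPl (ltW h2)).
- by case: (leP 1 a) => h3; case: (leP 1 b) => h4; lra.
- lra.
- by case: (leP 1 0) => h3; case: (leP 1 b) => h4; lra.
- by rewrite subrr subr_ge0.
Qed.

Lemma measurable_len (d : measure_display) (T : measurableType d) (a b : T -> R) :
  measurable_fun setT a -> measurable_fun setT b ->
  measurable_fun setT (fun w => len (a w) (b w)).
Proof.
have mc (c : T -> R) : measurable_fun setT c -> measurable_fun setT (fun w => clip (c w)).
  move=> mc; apply: measurable_minr; first exact: measurable_cst.
  by apply: measurable_maxr => //; exact: measurable_cst.
move=> ma mb; apply: measurable_maxr; first exact: measurable_cst.
by apply: measurable_funB; exact: mc.
Qed.

End Length.

(** [27/64 <= 1/2]. *)
Lemma expr34_le (R : realType) (n : nat) : (3 / 4 : R) ^+ (3 * n) <= (2 ^+ n)^-1.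
Proof.
have h : 0 <= (3 / 4 : R) ^+ 3 <= 2^-1 by rewrite !exprS expr0; lra.
have /andP[h1 h2] := h.
by rewrite exprM -exprVn; apply: lerXn2r; rewrite ?nnegrE // invr_ge0.
Qed.

Lemma le0_of_expr34 (R : realType) (x c : R) : 0 <= c ->
  (forall n, x <= c * (3 / 4) ^+ n) -> x <= 0.
Proof.
move=> c0 h; rewrite leNgt; apply/negP => x0.
pose N := Num.truncn (c / x).
have h1 : c / x < N.+1%:R by exact: truncnS_gt.
have h2 : x <= c * (2 ^+ N)^-1.
  by apply: le_trans (h (3 * N)%N) _; apply: ler_wpM2l => //; exact: expr34_le.
have h3 : N.+1%:R <= 2 ^+ N :> R by rewrite -natrX ler_nat ltn_expl.
have p0 : 0 < 2 ^+ N :> R by rewrite exprn_gt0.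
have h4 : x * 2 ^+ N <= c by rewrite -ler_pdivlMr.
have h5 : c < N.+1%:R * x by rewrite -ltr_pdivrMr.
have h6 : N.+1%:R * x <= 2 ^+ N * x by apply: ler_wpM2r => //; exact: ltW.
by rewrite [x * _]mulrC in h4; move: (lt_le_trans h5 (le_trans h6 h4)); rewrite ltxx.
Qed.

(** * The chain driven by uniform variables *)

Section Process.
Variables (R : realType) (d : measure_display) (T : measurableType d) (P : probability T R).
Variables (U : nat -> nat -> {mfun T >-> R}) (q : T -> nat).
Hypothesis UU : forall k j (A : set R), measurable A ->
       distribution P (U k j) A = uniform_prob (@ltr01 R) A.
Hypothesis qm : forall k, measurable (q @^-1` [set k]).

Definition events (i : option (nat * nat)) : set (set T) := match i with
        | Some (k, j) => [set U k j @^-1` A | A in [set A : set R | measurable A]]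
        | None => [set q @^-1` B | B in [set: set nat]]
        end.

Hypothesis ind : mutually_independent P events.

Lemma events_measurable i : events i `<=` measurable.
Proof.
case: i => [[k j]|] _ [A mA <-].
  by rewrite -[X in measurable X]setTI; exact: measurable_funPT.
rewrite (_ : q @^-1` A = \bigcup_(k in A) (q @^-1` [set k])).
  by apply: bigcup_measurable => k _; exact: qm.
by apply/seteqP; split=> w /=; [move=> Aq; exists (q w)|move=> [k Ak ->]].
Qed.

Lemma events_setT i : events i setT.
Proof. by case: i => [[k j]|]; exists setT; rewrite ?preimage_setT //=; exact: measurableT. Qed.

Lemma events_setI i : setI_closed (events i).
Proof.
case: i => [[k j]|] _ _ [A mA <-] [B mB <-]; exists (A `&` B) => //.
exact: measurableI.
Qed.

Local Notation TS S := (g_sigma_algebraType (gens events S)).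
Local Notation mS S := (@measurable_fun _ _ (TS S) R setT).
Local Notation E := (Ex P).

Lemma freeze (S : set (option (nat * nat))) k j (W a b : T -> R) : ~ S (Some (k, j)) ->
  mS S W -> mS S a -> mS S b -> (forall w, 0 <= W w) ->
  E (fun w => W w * (a w < U k j w < b w)%R%:R) = E (fun w => W w * len (a w) (b w)).
Proof.
move=> nS mW ma mb W0; rewrite /Ex.
apply: (freezing_itv ind events_measurable events_setT events_setI nS _ (UU k j)) => // A mA.
by exists A.
Qed.

Lemma measurable_source (S : set (option (nat * nat))) k j : S (Some (k, j)) -> mS S (U k j).
Proof.
move=> Sk _ A mA; rewrite setTI; apply: sub_sigma_algebra.
by exists (Some (k, j)) => //; exists A.
Qed.

Lemma measurable_sub (S : set (option (nat * nat))) (f : T -> R) :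
  mS S f -> measurable_fun (setT : set T) f.
Proof. exact: (measurable_of_gens events_measurable). Qed.

Definition Yt t w := (chain (fun j => U 0%N j w) (fun j => U 1%N j w)
                                (fun j => U 2%N j w) (fun j => U 3%N j w) t).1.
Definition Zt t w := (chain (fun j => U 0%N j w) (fun j => U 1%N j w)
                                (fun j => U 2%N j w) (fun j => U 3%N j w) t).2.

(* The variables which [Y^t] and [Z^t] depend on. *)
Definition past t : set (option (nat * nat)) :=
  [set i | if i is Some (k, j) then (k < 2)%N || (j < t)%N else false].
Definition past1 t : set (option (nat * nat)) := past t `|` [set Some (2, t)%N].

Lemma chain_measurable (S : set (option (nat * nat))) t : past t `<=` S ->
  @mseq _ (TS S) R (Yt t) /\ @mseq _ (TS S) R (Zt t).
Proof.
move=> sub.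
have [] := @mseq_chain _ (TS S) R (fun w j => U 0%N j w) (fun w j => U 1%N j w)
   (fun w j => U 2%N j w) (fun w j => U 3%N j w) t.
- by move=> j; apply: measurable_source; apply: sub.
- by move=> j; apply: measurable_source; apply: sub.
- by move=> j jt; apply: measurable_source; apply: sub; rewrite /past /= jt.
- by move=> j jt; apply: measurable_source; apply: sub; rewrite /past /= jt.
by [].
Qed.

Lemma past_sub1 t : past t `<=` past1 t. Proof. by move=> i; left. Qed.

Lemma past_not_u t : ~ past t (Some (2, t)%N).
Proof. by rewrite /past /= ltnn. Qed.

Lemma past1_not_v t : ~ past1 t (Some (3, t)%N).
Proof. by move=> [|//]; rewrite /past /= ltnn. Qed.

(** [freeze] only deals with open intervals, so the point [a] is enclosed in one of arbitrarily
    small length [e]. *)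
Lemma ae_neq (S : set (option (nat * nat))) k j (a : T -> R) : ~ S (Some (k, j)) -> mS S a ->
  \forall w \ae P, U k j w != a w.
Proof.
move=> nS ma; have ma' := measurable_sub ma.
have meq : mprop (fun w => U k j w == a w) by apply: mprop_eqb.
apply: (ae_bool meq); apply/ler_addgt0Pr => e e0; rewrite add0r.
have mlo : mS S (fun w => a w - e / 2) by apply: measurable_funB => //; exact: measurable_cst.
have mhi : mS S (fun w => a w + e / 2) by apply: measurable_funD => //; exact: measurable_cst.
have c1 : mS S (fun=> 1 : R) by exact: measurable_cst.
have := freeze nS c1 mlo mhi (fun=> ler01).
have bl : bm (fun w => 1 * len (a w - e / 2) (a w + e / 2)).
  split; last first.
    by exists 1 => w; rewrite mul1r ger0_norm ?len_ge0 ?len_le1.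
  apply: measurable_funM; first exact: measurable_cst.
  by apply: measurable_len; [exact: (measurable_sub mlo)|exact: (measurable_sub mhi)].
have bi : @bm _ T R (fun w => 1 * (a w - e / 2 < U k j w < a w + e / 2)%R%:R).
  apply: bm_mul; first exact: bm_cst.
  by apply: bm_bool; apply: mprop_andb; apply: mprop_lt => //;
    [exact: (measurable_sub mlo)|exact: (measurable_sub mhi)].
move=> Eq; apply: (@le_trans _ _ (E (fun w => 1 * (a w - e / 2 < U k j w < a w + e / 2)%R%:R))).
  apply: Ex_le => //; first exact: bm_bool.
  move=> w; rewrite mul1r; case: eqP => [->|_]; last by rewrite ler0n.
  by rewrite (_ : _ && _) //; lra.
rewrite Eq -[leRHS](Ex_cst P); apply: Ex_le => //; first exact: bm_cst.
move=> w; rewrite mul1r; apply: le_trans (len_le _) _; lra.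
Qed.

Lemma ae_U01 k j : \forall w \ae P, 0 < U k j w < 1.
Proof.
pose S : set (option (nat * nat)) := set0.
have c1 (c : R) : mS S (fun=> c) by exact: measurable_cst.
have nS : ~ S (Some (k, j)) by [].
have := freeze nS (c1 1) (c1 0) (c1 1) (fun=> ler01).
have -> : (fun w : T => 1 * len (0 : R) 1) = fun=> 1.
  by apply/funext => w; rewrite mul1r len01 ?subr0.
rewrite Ex_cst.
have mb : mprop (fun w => 0 < U k j w < 1).
  by apply: mprop_andb; apply: mprop_lt => //; exact: measurable_cst.
have -> : (fun w => 1 * (0 < U k j w < 1)%R%:R) = (fun w => (0 < U k j w < 1)%R%:R :> R).
  by apply/funext => w; rewrite mul1r.
move=> e1; have := @ae_bool _ _ _ P (fun w => ~~ (0 < U k j w < 1)).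
move=> h; have {}h := h (mprop_negb mb).
apply: filterS (h _) => [w|]; first by rewrite negbK.
have -> : (fun w => (~~ (0 < U k j w < 1))%R%:R) = (fun w => 1 - (0 < U k j w < 1)%R%:R :> R).
  by apply/funext => w; case: (_ && _); rewrite /= ?subr0 ?subrr.
rewrite Ex_sub ?Ex_cst ?e1 ?subrr //; [exact: bm_cst|exact: bm_bool].
Qed.

Lemma ae_U01_all : \forall w \ae P, forall kj : nat * nat, 0 < U kj.1 kj.2 w < 1.
Proof. by apply: ae_all => kj; exact: ae_U01. Qed.

(** Clipping makes the remainder bounded at every sample point, although the uniform variables lie
    in the unit interval only almost surely. *)
Definition remc k j w : R := clip (stick_rem (fun i => U k i w) j).

Lemma stick_rem_le1 (V : nat -> R) j : (forall i, 0 < V i < 1) -> stick_rem V j <= 1.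
Proof.
move=> V01; have := sum_stick V j; have : 0 <= \sum_(i < j) stick V i.
  by apply: sumr_ge0 => i _; exact: stick_ge0.
lra.
Qed.

Lemma remcE k j w : (forall i, 0 < U k i w < 1) -> remc k j w = stick_rem (fun i => U k i w) j.
Proof.
move=> h; apply: clip01; rewrite stick_rem_le1 // andbT ltW //; exact: stick_rem_gt0.
Qed.

Lemma bm_remc k j : bm (remc k j).
Proof.
split; last first.
  exists 1 => w; have /andP[h1 h2] := clip_ge0_le1 (stick_rem (fun i => U k i w) j).
  by rewrite /remc ger0_norm.
apply: measurable_minr; first exact: measurable_cst.
apply: measurable_maxr; first exact: measurable_cst.
by apply: (@mfun_stick_rem _ T R (fun w i => U k i w)).
Qed.

(** With probability [1/2] the new stick takes at least half of the remainder, which costs a quarter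
    of its expectation. This cruder rate only uses interval events, the form that [freeze]
    handles. *)
Lemma Ex_remc k j : E (remc k j) <= (3 / 4) ^+ j.
Proof.
elim: j => [|j IH].
  rewrite expr0 -[leRHS](Ex_cst P); apply: Ex_le; [exact: bm_remc|exact: bm_cst|].
  by move=> w; rewrite /remc; have /andP[] := clip_ge0_le1 (stick_rem (fun i => U k i w) 0).
pose S : set (option (nat * nat)) := [set i | if i is Some (l, m) then (m < j)%N else false].
have nS : ~ S (Some (k, j)) by rewrite /S /= ltnn.
have mr : mS S (remc k j).
  apply: measurable_minr; first exact: measurable_cst.
  apply: measurable_maxr; first exact: measurable_cst.
  have aux : forall m, (m <= j)%N -> mS S (fun w => stick_rem (fun i => U k i w) m).
    elim=> [|m IHm] mj /=; first exact: measurable_cst.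
    have h1 := IHm (ltnW mj).
    apply: measurable_funB => //; apply: measurable_funM => //.
    by apply: measurable_source.
  exact: aux.
have c (x : R) : mS S (fun=> x) by exact: measurable_cst.
have r0 w : 0 <= remc k j w by have /andP[] := clip_ge0_le1 (stick_rem (fun i => U k i w) j).
have := freeze nS mr (c (1 / 2)) (c 1) r0.
have bh : bm (fun w => remc k j w * (1 / 2 < U k j w < 1)%R%:R).
  apply: bm_mul; first exact: bm_remc.
  by apply: bm_bool; apply: mprop_andb; apply: mprop_lt => //; exact: measurable_cst.
have -> : (fun w => remc k j w * len (1 / 2) 1) = (fun w => 1 / 2 * remc k j w).
  apply/funext => w; rewrite len01 //; lra.
rewrite Ex_scale; last exact: bm_remc.
move=> Eq.
have : E (remc k j.+1) <= E (fun w => remc k j w - 1 / 2 * (remc k j w * (1 / 2 < U k j w < 1)%R%:R)).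
  apply: Ex_le_ae; first exact: bm_remc.
    by apply: bm_sub; [exact: bm_remc|apply: bm_mul => //; exact: bm_cst].
  apply: filterS ae_U01_all => w hw.
  have h01 i : 0 < U k i w < 1 by exact: (hw (k, i)).
  rewrite !remcE //=; have g0 := stick_rem_gt0 h01 j.
  have /andP[u0 u1] := h01 j; rewrite u1 andbT.
  have p1 : 0 < U k j w * stick_rem (fun i => U k i w) j by rewrite mulr_gt0.
  case: ltP => hu; rewrite ?mulr1 ?mulr0; last lra.
  have : 1 / 2 * stick_rem (fun i => U k i w) j <= U k j w * stick_rem (fun i => U k i w) j.
    by rewrite ler_pM2r // ltW.
  lra.
rewrite Ex_sub; [|exact: bm_remc|by apply: bm_mul => //; exact: bm_cst].
rewrite Ex_scale // Eq exprS; lra.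
Qed.

(** Markov's inequality: the remainder stays above [1/(m+1)] up to time [j] with probability at most
    [(m+1) (3/4)^j]. *)
Lemma ae_rem0 k : \forall w \ae P, forall m : nat, exists j, remc k j w < m.+1%:R^-1.
Proof.
apply: ae_all => m.
have mb : mprop (fun w => forall j, m.+1%:R^-1 <= remc k j w).
  apply: (@mprop_all _ _ nat) => j; apply: mprop_le; first exact: measurable_cst.
  by have [] := bm_remc k j.
have mb' := mprop_asbool mb.
have hb : E (fun w => `[< forall j, m.+1%:R^-1 <= remc k j w >]%:R) <= 0.
  apply: (@le0_of_expr34 _ _ m.+1%:R) => // j.
  apply: (@le_trans _ _ (m.+1%:R * E (remc k j))); last by rewrite ler_pM2l ?ltr0n // Ex_remc.
  rewrite -Ex_scale; last exact: bm_remc.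
  apply: Ex_le; first exact: bm_bool.
    by apply: bm_mul; [exact: bm_cst|exact: bm_remc].
  move=> w; have r0 : 0 <= remc k j w by have /andP[] := clip_ge0_le1 (stick_rem (fun i => U k i w) j).
  case: asboolP => [/(_ j) hj|_]; last by rewrite mulr_ge0.
  by move: hj; rewrite -(ler_pM2l (_ : 0 < m.+1%:R :> R)) ?ltr0n // mulfV // pnatr_eq0.
apply: filterS (ae_bool mb' hb) => w /asboolPn nw.
apply: contrapT => hw; apply: nw => j; rewrite leNgt; apply/negP => hj.
by apply: hw; exists j.
Qed.

Lemma stick_rem_small k w : (forall i, 0 < U k i w < 1) ->
  (forall m : nat, exists j, remc k j w < m.+1%:R^-1) ->
  forall e, 0 < e -> exists j, stick_rem (fun i => U k i w) j < e.
Proof.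
move=> h01 h e e0; have [j hj] := h (Num.truncn e^-1); exists j.
rewrite -remcE //; apply: lt_trans hj _.
rewrite -ltf_pV2 ?posrE ?invr_gt0 // ?invrK; exact: truncnS_gt.
Qed.

Definition good t w := [/\ Om (Yt t w), Om (Zt t w), genericUV (Yt t w) (Zt t w) (U 2%N t w) (U 3%N t w),
  generic_cut (Yt t w) (Zt t w) (U 3%N t w) & generic_cut (Zt t w) (Yt t w) (U 3%N t w)].

Lemma ae_gU (A B : T -> nat -> R) t : @mseq _ (TS (past t)) R A -> @mseq _ (TS (past t)) R B ->
  \forall w \ae P, genericU (A w) (B w) (U 2%N t w).
Proof.
move=> mA mB; have mt := mseq_tleft mA mB.
have nS := @past_not_u t.
have h1 := ae_U01 2 t.
have h2 : \forall w \ae P, U 2%N t w != 1 - Qmatch (A w) (B w).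
  apply: (ae_neq nS); apply: measurable_funB; first exact: measurable_cst.
  exact: mfun_Qmatch.
have h3 : \forall w \ae P, forall i, U 2%N t w != tleft (A w) (B w) i.
  by apply: ae_all => i; apply: (ae_neq nS); exact: mt.
have h4 : \forall w \ae P, forall i, U 2%N t w != tleft (A w) (B w) i + A w i.
  by apply: ae_all => i; apply: (ae_neq nS); apply: measurable_funD; [exact: mt|exact: mA].
by apply: filterS2 (filterI h1 h2) (filterI h3 h4) => w [a b] [c e]; split=> // i; split.
Qed.

Lemma measurable_u1 t : mS (past1 t) (U 2%N t).
Proof. by apply: measurable_source; right. Qed.

Lemma ae_gV (A B : T -> nat -> R) t : @mseq _ (TS (past1 t)) R A -> @mseq _ (TS (past1 t)) R B ->
  \forall w \ae P, genericV (A w) (B w) (U 2%N t w) (U 3%N t w).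
Proof.
move=> mA mB; have mt := mseq_tleft mA mB; have mu := @measurable_u1 t.
have mh := mseq_hleft mA mB mu; have ma := mnat_idx_a mA mB mu.
have mAa := mfun_sel ma mA; have mta := mfun_sel ma mt.
have nS := @past1_not_v t.
have ms : mS (past1 t) (fun w => 1 - Qmatch (A w) (B w)).
  by apply: measurable_funB; [exact: measurable_cst|exact: mfun_Qmatch].
have h1 := ae_U01 3 t.
have h2 := ae_neq nS ms.
have h3 := ae_neq nS (measurable_funD ms mAa).
have h4 := ae_neq nS (measurable_funD mta mAa).
have h5 : \forall w \ae P, forall i, U 3%N t w != hleft (A w) (B w) (U 2%N t w) i.
  by apply: ae_all => i; apply: (ae_neq nS); exact: mh.
have h6 : \forall w \ae P, forall i, U 3%N t w != hleft (A w) (B w) (U 2%N t w) i + A w i.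
  by apply: ae_all => i; apply: (ae_neq nS); apply: measurable_funD; [exact: mh|exact: mA].
apply: filterS3 (filterI h1 h2) (filterI h3 h4) (filterI h5 h6) => w [a b] [c e] [f g].
by split=> // i; split.
Qed.

Lemma ae_gen (A B : T -> nat -> R) t : @mseq _ (TS (past1 t)) R A -> @mseq _ (TS (past1 t)) R B ->
  \forall w \ae P, generic_cut (A w) (B w) (U 3%N t w).
Proof.
move=> mA mB; have nS := @past1_not_v t.
have h1 : \forall w \ae P, forall j, U 3%N t w != B w j.
  by apply: ae_all => j; apply: (ae_neq nS); exact: mB.
have h2 : \forall w \ae P, forall ij : nat * nat, U 3%N t w != A w ij.1 - B w ij.2.
  by apply: ae_all => ij; apply: (ae_neq nS); apply: measurable_funB; [exact: mA|exact: mB].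
have h3 : \forall w \ae P, forall i, U 3%N t w != A w i / 2.
  apply: ae_all => i; apply: (ae_neq nS); apply: measurable_funM; [exact: mA|exact: measurable_cst].
have h4 : \forall w \ae P, forall ijk : nat * nat * nat, U 3%N t w != A w ijk.1.1 - B w ijk.1.2 - B w ijk.2.
  apply: ae_all => ijk; apply: (ae_neq nS); apply: measurable_funB; last exact: mB.
  by apply: measurable_funB; [exact: mA|exact: mB].
apply: filterS2 (filterI h1 h2) (filterI h3 h4) => w [a b] [c e]; split=> //.
  by move=> i j; exact: (b (i, j)).
by move=> i j k; exact: (e (i, j, k)).
Qed.

(** Genericity holds almost surely at all times, since the excluded values are measurable in earlier
    draws, whatever the state. Membership in [Om] then follows path by path, by induction on
    time. *)
Lemma ae_good : \forall w \ae P, (forall kj : nat * nat, 0 < U kj.1 kj.2 w < 1) /\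
  forall t, good t w.
Proof.
have h0 := ae_U01_all; have hr0 := ae_rem0 0; have hr1 := ae_rem0 1.
have hg : \forall w \ae P, forall t, genericUV (Yt t w) (Zt t w) (U 2%N t w) (U 3%N t w) /\
   (generic_cut (Yt t w) (Zt t w) (U 3%N t w) /\ generic_cut (Zt t w) (Yt t w) (U 3%N t w)).
  apply: ae_all => t.
  have [mY mZ] := @chain_measurable (past t) t (@subset_refl _ _).
  have [mY1 mZ1] := chain_measurable (@past_sub1 t).
  have a1 := ae_gU mY mZ; have a2 := ae_gU mZ mY.
  have a3 := ae_gV mY1 mZ1; have a4 := ae_gV mZ1 mY1.
  have a5 := ae_gen mY1 mZ1; have a6 := ae_gen mZ1 mY1.
  by apply: filterS3 (filterI a1 a2) (filterI a3 a4) (filterI a5 a6) => w [? ?] [? ?] [? ?].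
apply: filterS2 (filterI h0 hg) (filterI hr0 hr1) => w [hw g] [r0 r1].
split=> // t.
have OO : Om (Yt t w) /\ Om (Zt t w).
  elim: t => [|t [oY oZ]].
    split.
      have h i : 0 < U 0%N i w < 1 by exact: (hw (0, i)%N).
      by apply: Om_PD1 => //; exact: stick_rem_small.
    have h i : 0 < U 1%N i w < 1 by exact: (hw (1, i)%N).
    by apply: Om_PD1 => //; exact: stick_rem_small.
  have [[gu gu' gv gv'] _] := g t.
  by split; [exact: (Om_new_seq oY gu gv)|exact: (Om_new_seq oZ gu' gv')].
have [oY oZ] := OO; have [gg [g1 g2]] := g t.
by split.
Qed.

End Process.

(** * Expected change in one step *)

Section Estimates.
Variables (R : realType) (d : measure_display) (T : measurableType d) (P : probability T R).
Variables (U : nat -> nat -> {mfun T >-> R}) (q : T -> nat).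
Hypothesis UU : forall k j (A : set R), measurable A ->
       distribution P (U k j) A = uniform_prob (@ltr01 R) A.
Hypothesis qm : forall k, measurable (q @^-1` [set k]).
Hypothesis ind : mutually_independent P (events U q).
Variable n : nat.
Hypothesis n0 : (0 < n)%N.

Local Notation TS S := (g_sigma_algebraType (gens (events U q) S)).
Local Notation mS S := (@measurable_fun _ _ (TS S) R setT).
Local Notation E := (Ex P).
Local Notation e := (n%:R^-1 : R).
Local Notation u t := (fun w => U 2%N t w : R).
Local Notation v t := (fun w => U 3%N t w : R).

(** The quantification over [S] allows the same sequence to be frozen with the past alone, when [u]
    is drawn, and with [u] included, when [v] is drawn. *)
Definition adapted t (A : T -> nat -> R) := forall S, past t `<=` S -> @mseq _ (TS S) R A.

Lemma adaptedY t : adapted t (Yt U t).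
Proof. by move=> S sub; have [] := @chain_measurable _ _ _ U q S t sub. Qed.

Lemma adaptedZ t : adapted t (Zt U t).
Proof. by move=> S sub; have [] := @chain_measurable _ _ _ U q S t sub. Qed.

Lemma adapted_mseq t A : adapted t A -> @mseq _ T R A.
Proof. by move=> aA i; exact: (measurable_sub qm (aA _ (@subset_refl _ _) i)). Qed.

Lemma measurable_big1 : measurable_fun setT (big1f (R := R) n).
Proof. by apply: mfun_bool; apply: mprop_lt => //; exact: measurable_cst. Qed.

Lemma measurable_atl r : measurable_fun setT (@atl R r).
Proof. by apply: mfun_bool; apply: mprop_le => //; exact: measurable_cst. Qed.

Lemma measurable_bigmass : measurable_fun setT (bigmass (R := R) n).
Proof.
apply: measurable_funM => //; apply: mfun_bool; apply: mprop_andb.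
  by apply: mprop_lt => //; exact: measurable_cst.
by apply: mprop_le => //; exact: measurable_cst.
Qed.

Lemma norm_bool (b : bool) : `|b%:R| <= 1 :> R.
Proof. by case: b; rewrite ?normr1 ?normr0. Qed.

Lemma norm_bigmass x : `|bigmass n x| <= 1 :> R.
Proof.
rewrite /bigmass; case: (boolP (_ < _ <= _)) => [/andP[h1 h2]|_]; rewrite ?mulr0 ?normr0 // mulr1.
by rewrite ger0_norm //; apply: le_trans (ltW h1); rewrite invr_ge0.
Qed.

Lemma bm_Uf (psi : R -> R) M A B : measurable_fun setT psi -> (forall x : R, `|psi x| <= M) ->
  @mseq _ T R A -> @mseq _ T R B -> bm (fun w => Uf n psi (A w) (B w)).
Proof.
move=> mp hp mA mB; apply: bm_sum => i; apply: bm_if; last exact: bm_cst.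
  by apply: mprop_negb; exact: mprop_mt.
exact: (bm_comp mp hp (mA _)).
Qed.

Lemma bm_Nf (psi : R -> R) M A B : measurable_fun setT psi -> (forall x : R, `|psi x| <= M) ->
  @mseq _ T R A -> @mseq _ T R B -> bm (fun w => Nf n psi (A w) (B w)).
Proof. by move=> mp hp mA mB; apply: bm_add; exact: (bm_Uf mp hp). Qed.

Lemma bm_Lf (psi : R -> R) M A : measurable_fun setT psi -> (forall x : R, `|psi x| <= M) ->
  @mseq _ T R A -> bm (fun w => Lf n psi (A w)).
Proof.
by move=> mp hp mA; apply: bm_sum => i; exact: (bm_comp mp hp (mA _)).
Qed.

Lemma bm_Fm A : @mseq _ T R A -> bm (fun w => dust_mass n (A w)).
Proof.
move=> mA; apply: bm_sub; first exact: bm_cst.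
exact: (bm_Lf measurable_bigmass norm_bigmass mA).
Qed.

Lemma mprop_itv (a b x : T -> R) : measurable_fun setT a -> measurable_fun setT b ->
  measurable_fun setT x -> mprop (fun w => a w < x w < b w).
Proof. by move=> *; apply: mprop_andb; exact: mprop_lt. Qed.

Lemma mU k j : measurable_fun setT (fun w => U k j w : R).
Proof. by []. Qed.

Lemma bm_block (psi : R -> R) M (A L : T -> nat -> R) (x : T -> R) (p : nat -> T -> bool) :
  measurable_fun setT psi -> (forall x : R, `|psi x| <= M) -> @mseq _ T R A -> @mseq _ T R L ->
  measurable_fun setT x -> (forall i, mprop (p i)) -> forall i : nat,
  bm (fun w => (if p i w then psi (A w i) else 0) * (inb (L w) (A w) (x w) i)%:R).
Proof.
move=> mp hp mA mL mx mpp i; apply: bm_mul.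
  apply: bm_if => //; last exact: bm_cst.
  exact: (bm_comp mp hp (mA _)).
by apply: bm_bool; apply: mprop_itv => //; apply: measurable_funD.
Qed.

(* The fresh uniform variable [X] meets block [i], of length [A i], with
   probability [A i], whatever the adapted left end point [L i]. *)
Lemma Ex_block (S : set (option (nat * nat))) k j (psi : R -> R) M (A L : T -> nat -> R) (p : nat -> T -> bool) : ~ S (Some (k, j)) ->
  measurable_fun setT psi -> (forall x : R, 0 <= psi x <= M) ->
  @mseq _ (TS S) R A -> @mseq _ (TS S) R L -> (forall i, @mprop _ (TS S) (p i)) ->
  forall i : nat,
  E (fun w => (if p i w then psi (A w i) else 0) * (inb (L w) (A w) (U k j w) i)%:R) =
  E (fun w => (if p i w then psi (A w i) else 0) * len (L w i) (L w i + A w i)).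
Proof.
move=> nS mp hp mA mL mpp i; apply: (freeze UU qm ind nS).
- apply: mfun_if; [exact: mpp|by apply: (measurableT_comp mp); exact: mA|exact: measurable_cst].
- exact: mL.
- by apply: measurable_funD; [exact: mL|exact: mA].
- by move=> w; case: ifP => // _; have /andP[] := hp (A w i).
Qed.

(** The form of [du], one minus a finite sum over intervals, lets each large interval contribute its
    length; what remains is the mass of the small entries. *)
Lemma Ex_du t A B : adapted t A -> adapted t B -> (\forall w \ae P, Om (A w)) ->
  E (fun w => du n (A w) (B w) (U 2%N t w)) = E (fun w => dust_mass n (A w)).
Proof.
move=> aA aB oA; have mA := adapted_mseq aA; have mB := adapted_mseq aB.
have mL := mseq_tleft mA mB.
have nS := @past_not_u t; have sub := @subset_refl _ (past t).
have psi01 (x : R) : 0 <= big1f n x <= 1 by rewrite ler0n lern1 leq_b1.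
have bT i : bm (fun w => (if true then big1f n (A w i) else 0) * (inb (tleft (A w) (B w)) (A w) (U 2%N t w) i)%:R).
  by apply: (bm_block (p := fun _ _ => true) measurable_big1 _ mA mL) => //; [move=> x; exact: norm_bool|move=> ?; exact: mprop_cst].
have bM i : bm (fun w => bigmass n (A w i)).
  exact: (bm_comp measurable_bigmass norm_bigmass (mA _)).
rewrite /du /dust_mass /Lf !Ex_sub; try exact: bm_cst; try by apply: bm_sum => i; first [exact: (bT i)|exact: (bM i)].
congr (_ - _); rewrite Ex_sum; last by move=> i; exact: (bT i).
rewrite Ex_sum; last by move=> i; exact: (bM i).
apply: eq_bigr => i _.
rewrite (Ex_block (p := fun _ _ => true) nS measurable_big1 psi01 (aA _ sub) (mseq_tleft (aA _ sub) (aB _ sub))); last by move=> ?; exact: mprop_cst.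
apply: Ex_eq_ae => //.
  apply: bm_mul; first exact: (bm_comp measurable_big1 (fun x => norm_bool _) (mA _)).
  split; first by apply: measurable_len => //; apply: measurable_funD.
  by exists 1 => w; rewrite ger0_norm ?len_ge0 // len_le1.
apply: filterS oA => w oAw.
rewrite len01 ?tleft_ge0 ?tright_le1 ?lerDl ?Om_ge0 // addrAC subrr add0r.
by rewrite /big1f /bigmass Om_le1 // andbT mulrC.
Qed.

Lemma Ex_dv t A B : adapted t A -> adapted t B ->
  (\forall w \ae P, Om (A w) /\ genericU (A w) (B w) (U 2%N t w)) ->
  E (fun w => dv n (A w) (B w) (U 2%N t w) (U 3%N t w)) = E (fun w => dust_mass n (A w)).
Proof.
move=> aA aB oA; have mA := adapted_mseq aA; have mB := adapted_mseq aB.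
have mL := mseq_hleft mA mB (@mU 2 t).
have nS := @past1_not_v t; have sub := @past_sub1 t.
have psi01 (x : R) : 0 <= big1f n x <= 1 by rewrite ler0n lern1 leq_b1.
have bT i : bm (fun w => (if true then big1f n (A w i) else 0) * (inb (hleft (A w) (B w) (U 2%N t w)) (A w) (U 3%N t w) i)%:R).
  by apply: (bm_block (p := fun _ _ => true) measurable_big1 _ mA mL) => //; [move=> x; exact: norm_bool|move=> ?; exact: mprop_cst].
have bM i : bm (fun w => bigmass n (A w i)).
  exact: (bm_comp measurable_bigmass norm_bigmass (mA _)).
rewrite /dv /dust_mass /Lf !Ex_sub; try exact: bm_cst; try by apply: bm_sum => i; first [exact: (bT i)|exact: (bM i)].
congr (_ - _); rewrite Ex_sum; last by move=> i; exact: (bT i).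
rewrite Ex_sum; last by move=> i; exact: (bM i).
apply: eq_bigr => i _.
rewrite (Ex_block (p := fun _ _ => true) nS measurable_big1 psi01 (aA _ sub)
   (mseq_hleft (aA _ sub) (aB _ sub) (@measurable_u1 _ _ _ U q t))); last by move=> ?; exact: mprop_cst.
apply: Ex_eq_ae => //.
  apply: bm_mul; first exact: (bm_comp measurable_big1 (fun x => norm_bool _) (mA _)).
  split; first by apply: measurable_len => //; apply: measurable_funD.
  by exists 1 => w; rewrite ger0_norm ?len_ge0 // len_le1.
apply: filterS oA => w [oAw gu].
rewrite /big1f /bigmass Om_le1 // andbT.
case: (ltP e (A w i)) => h; last by rewrite mul0r mulr0.
have A0 : 0 < A w i by apply: le_lt_trans h; rewrite invr_ge0.
have [h1 h2] := hleft_range oAw gu A0.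
have h3 : hleft (A w) (B w) (U 2%N t w) i <= hleft (A w) (B w) (U 2%N t w) i + A w i by rewrite lerDl ltW.
by rewrite (len01 h1 h3 h2) addrAC subrr add0r mulrC.
Qed.

(** An entry [x] is hit with probability at most [x] by each of [u] and [v], so its expected weight
    is at most [phi x * x] per draw, whence the factor [2]. *)
Lemma Ex_hitf t A B (phi : R -> R) M r : adapted t A -> adapted t B -> (\forall w \ae P, Om (A w)) ->
  measurable_fun setT phi -> (forall x : R, 0 <= phi x <= M) ->
  (forall x, phi x * x <= atl r x) ->
  E (fun w => hitf n phi (A w) (B w) (U 2%N t w) (U 3%N t w)) <=
  2 * E (fun w => Uf n (atl r) (A w) (B w)).
Proof.
move=> aA aB oA mphi hphi hr; have mA := adapted_mseq aA; have mB := adapted_mseq aB.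
have nphi x : `|phi x| <= M by have /andP[h1 h2] := hphi x; rewrite ger0_norm.
have natl x : `|atl r x| <= 1 by exact: norm_bool.
pose p i w := ~~ mt (A w) (B w) i.
have mp i : mprop (p i) by apply: mprop_negb; exact: mprop_mt.
have mpS S : past t `<=` S -> forall i, @mprop _ (TS S) (p i).
  by move=> sub i; apply: mprop_negb; apply: mprop_mt; [exact: (aA _ sub)|exact: (aB _ sub)].
have bW i : bm (fun w => if p i w then phi (A w i) else 0).
  by apply: bm_if => //; [exact: (bm_comp mphi nphi (mA _))|exact: bm_cst].
have bt i : bm (fun w => if p i w then atl r (A w i) else 0).
  apply: bm_if => //; last exact: bm_cst.
  exact: (bm_comp (measurable_atl r) natl (mA _)).
have main S k j (L : T -> nat -> R) : ~ S (Some (k, j)) -> past t `<=` S -> @mseq _ (TS S) R L ->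
  E (fun w => \sum_(i < n) (if p i w then phi (A w i) else 0) * (inb (L w) (A w) (U k j w) i)%:R) <=
  E (fun w => Uf n (atl r) (A w) (B w)).
  move=> nS sub mL.
  have mLT : @mseq _ T R L by move=> i; exact: (measurable_sub qm (mL i)).
  rewrite Ex_sum; last by move=> i; apply: (bm_block mphi nphi).
  rewrite /Uf Ex_sum; last by move=> i; exact: bt.
  apply: ler_sum => i _.
  rewrite (Ex_block nS mphi hphi (aA _ sub) mL (mpS _ sub)).
  apply: Ex_le_ae; [|exact: (bt i)|].
    apply: bm_mul; first exact: bW.
    split; first by apply: measurable_len => //; apply: measurable_funD.
    by exists 1 => w; rewrite ger0_norm ?len_ge0 // len_le1.
  apply: filterS oA => w oAw; rewrite /p; case: ifP => _; last by rewrite mul0r.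
  apply: le_trans (hr _); apply: ler_wpM2l; first by have /andP[] := hphi (A w i).
  apply: le_trans (len_le _) _; rewrite ?lerDl ?Om_ge0 //; lra.
have mLt := mseq_tleft mA mB; have mLh := mseq_hleft mA mB (@mU 2 t).
rewrite /hitf Ex_add; last 2 first.
- by apply: bm_sum => i; exact: (bm_block mphi nphi mA mLt (@mU 2 t) mp i).
- by apply: bm_sum => i; exact: (bm_block mphi nphi mA mLh (@mU 3 t) mp i).
have sub := @subset_refl _ (past t); have sub1 := @past_sub1 t.
have := main _ _ _ _ (@past_not_u t) sub (mseq_tleft (aA _ sub) (aB _ sub)).
have := main _ _ _ _ (@past1_not_v t) sub1 (mseq_hleft (aA _ sub1) (aB _ sub1) (@measurable_u1 _ _ _ U q t)).
lra.
Qed.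

Lemma Ex_itv_le (S : set (option (nat * nat))) k j (a b : T -> R) c : ~ S (Some (k, j)) -> mS S a -> mS S b -> 0 <= c ->
  (forall w, b w - a w = c) ->
  E (fun w => (a w < U k j w < b w)%R%:R) <= c.
Proof.
move=> nS ma mb c0 h.
have c1 : mS S (fun=> 1 : R) by exact: measurable_cst.
have := freeze UU qm ind nS c1 ma mb (fun=> ler01).
have -> : (fun w => 1 * (a w < U k j w < b w)%R%:R) = (fun w => (a w < U k j w < b w)%R%:R : R).
  by apply/funext => w; rewrite mul1r.
move=> ->; rewrite -[leRHS](Ex_cst P); apply: Ex_le => //; last first.
- by move=> w; rewrite mul1r -(h w); apply: len_le; rewrite -subr_ge0 h.
- exact: bm_cst.
- split; last by exists 1 => w; rewrite mul1r ger0_norm ?len_ge0 ?len_le1.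
  apply: measurable_funM; first exact: measurable_cst.
  by apply: measurable_len; [exact: (measurable_sub qm ma)|exact: (measurable_sub qm mb)].
Qed.

(** Each of the two windows of [v] in [Fm_step] has probability at most [2 e] and costs [e]. *)
Lemma Ex_Fm_step t A B : adapted t A -> adapted t B ->
  (\forall w \ae P, [/\ Om (A w), genericU (A w) (B w) (U 2%N t w) &
     genericV (A w) (B w) (U 2%N t w) (U 3%N t w)]) ->
  E (fun w => dust_mass n (new_seq (A w) (B w) (U 2%N t w) (U 3%N t w))) <=
  E (fun w => dust_mass n (A w)) + 4 * (e * e).
Proof.
move=> aA aB oA; have mA := adapted_mseq aA; have mB := adapted_mseq aB.
have e0 : 0 <= e by rewrite invr_ge0.
have sub1 := @past_sub1 t; have nS := @past1_not_v t.
have ma S : past1 t `<=` S -> mS S (fun w => A w (idx_a (A w) (B w) (U 2%N t w))).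
  move=> sub; have subp : past t `<=` S by move=> i pi; apply: sub; left.
  have mu : mS S (U 2%N t) by apply: measurable_source; apply: sub; right.
  exact: (mfun_sel (mnat_idx_a (aA _ subp) (aB _ subp) mu) (aA _ subp)).
have {}ma := ma _ (@subset_refl _ (past1 t)).
have cst (c : R) : mS (past1 t) (fun=> c) by exact: measurable_cst.
have ma2 : mS (past1 t) (fun w => A w (idx_a (A w) (B w) (U 2%N t w)) - 2 * e).
  by apply: measurable_funB.
pose i1 w : R := (0 < U 3%N t w < 2 * e)%R%:R.
pose i2 w : R := (A w (idx_a (A w) (B w) (U 2%N t w)) - 2 * e < U 3%N t w <
    A w (idx_a (A w) (B w) (U 2%N t w)))%R%:R.
have b1 : bm i1 by apply: bm_bool; apply: mprop_itv => //; exact: measurable_cst.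
have b2 : bm i2.
  by apply: bm_bool; apply: mprop_itv => //; [exact: (measurable_sub qm ma2)|exact: (measurable_sub qm ma)].
have E1 : E i1 <= 2 * e.
  by apply: (Ex_itv_le nS (cst 0) (cst (2 * e))) => [|w]; [rewrite mulr_ge0|rewrite subr0].
have E2 : E i2 <= 2 * e.
  by apply: (Ex_itv_le nS ma2 ma) => [|w]; [rewrite mulr_ge0|rewrite subKr].
have bF := bm_Fm mA.
have bI : bm (fun w => e * (i1 w + i2 w)) by apply: bm_mul; [exact: bm_cst|exact: bm_add].
apply: (@le_trans _ _ (E (fun w => dust_mass n (A w) + e * (i1 w + i2 w)))).
  apply: Ex_le_ae; first by apply: bm_Fm; apply: mseq_new.
    exact: bm_add.
  by apply: filterS oA => w [oAw gu gv]; exact: Fm_step.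
rewrite (Ex_add _ bF bI) (Ex_scale _ _ (bm_add b1 b2)) (Ex_add _ b1 b2).
rewrite lerD2l; have := ler_wpM2l e0 (lerD E1 E2); lra.
Qed.

End Estimates.

(** * Weights on dyadic scales *)

Section Scales.
Variable R : realType.
Variables k0 k1 : nat.

(* [phi] gives weight [2^k] to a piece of size about [2^-k], so that
   [phi x * x <= 1] while a uniform cut has the same rate at every scale. *)
Definition scale_ind (k : nat) (x : R) : R := ((2 ^+ k.+1)^-1 < x < (2 ^+ k)^-1)%R%:R.

Definition phi (x : R) : R := \sum_(k < k1) (k0 <= k)%N%:R * (2 ^+ k * scale_ind k x).

Lemma phi_ge0 x : 0 <= phi x.
Proof. by apply: sumr_ge0 => k _; rewrite !mulr_ge0 // ?ler0n // exprn_ge0. Qed.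

Lemma phi_le x : phi x <= 2 ^+ k1.
Proof.
rewrite /phi; elim: (k1) => [|m IH]; first by rewrite big_ord0 expr0.
rewrite big_ord_recr /= exprS.
have : (k0 <= m)%N%:R * (2 ^+ m * scale_ind m x) <= 2 ^+ m.
  have p0 : 0 <= 2 ^+ m :> R by rewrite exprn_ge0.
  rewrite /scale_ind; case: (_ <= _)%N; case: (_ && _); rewrite ?mul1r ?mul0r ?mulr1 ?mulr0 //.
lra.
Qed.

Lemma scale_sum_le m x : \sum_(k < m) scale_ind k x <= ((2 ^+ m)^-1 < x)%R%:R.
Proof.
elim: m => [|m IH]; first by rewrite big_ord0 ler0n.
rewrite big_ord_recr /=; apply: le_trans (lerD IH (lexx _)) _; rewrite /scale_ind.
have h : (2 ^+ m.+1)^-1 <= (2 ^+ m)^-1 :> R.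
  by rewrite lef_pV2 ?posrE ?exprn_gt0 // ler_eXn2l // ltr1n.
case: (ltP (2 ^+ m)^-1 x) => h1; case: (ltP (2 ^+ m.+1)^-1 x) => h2; case: (ltP x (2 ^+ m)^-1) => h3 /=;
  rewrite ?mulr1n ?mulr0n; lra.
Qed.

Lemma phi_mul_le x : phi x * x <= atl (2 ^+ k1)^-1 x.
Proof.
apply: le_trans (_ : \sum_(k < k1) scale_ind k x <= _); last first.
  apply: le_trans (scale_sum_le _ _) _; rewrite /atl ler_nat.
  by case: ltP => // /ltW ->.
rewrite /phi mulr_suml; apply: ler_sum => k _.
have p0 : 0 < 2 ^+ k :> R by rewrite exprn_gt0.
rewrite /scale_ind; case: (boolP (_ && _)) => [/andP[h1 h2]|_]; rewrite ?mulr1 ?mulr0 ?mul0r //.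
have x0 : 0 < x by apply: lt_trans h1; rewrite invr_gt0 exprn_gt0.
have : 2 ^+ k * x <= 1.
  by move: (ltW h2); rewrite -(ler_pM2l p0) mulfV ?gt_eqF.
case: (_ <= _)%N; rewrite ?mul1r // !mul0r => _; exact: ler01.
Qed.

Lemma phi_large n : (2 ^ k1 <= n)%N -> large n phi.
Proof.
move=> kn; split=> [r|r rn]; first exact: phi_ge0.
rewrite /phi big1 // => k _; rewrite /scale_ind.
suff -> : ((2 ^+ k.+1)^-1 < r) = false by rewrite !mulr0.
apply/negbTE; rewrite -leNgt; apply: le_trans rn _.
rewrite lef_pV2 ?posrE ?exprn_gt0 // ?ltr0n; last by apply: leq_trans kn; rewrite expn_gt0.
rewrite -natrX ler_nat; apply: leq_trans kn; rewrite leq_exp2l //; exact: ltn_ord.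
Qed.

Lemma measurable_phi : measurable_fun setT phi.
Proof.
apply: measurable_sum => k; apply: measurable_funM; first exact: measurable_cst.
apply: measurable_funM; first exact: measurable_cst.
by apply: mfun_bool; apply: mprop_andb; apply: mprop_lt => //; exact: measurable_cst.
Qed.

Lemma sum_scales : \sum_(k < k1) (k0 <= k)%N%:R = (k1 - k0)%:R :> R.
Proof.
elim: (k1) => [|m IH]; first by rewrite big_ord0.
rewrite big_ord_recr /= IH -natrD; congr _%:R.
by case: (leqP k0 m) => h /=; lia.
Qed.

End Scales.

(** * Sums over time *)

Section Sums.
Variables (R : realType) (d : measure_display) (T : measurableType d) (P : probability T R).
Variables (U : nat -> nat -> {mfun T >-> R}) (q : T -> nat).
Hypothesis UU : forall k j (A : set R), measurable A ->
       distribution P (U k j) A = uniform_prob (@ltr01 R) A.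
Hypothesis qm : forall k, measurable (q @^-1` [set k]).
Hypothesis ind : mutually_independent P (events U q).
Variable n : nat.
Hypothesis n0 : (0 < n)%N.

Local Notation TS S := (g_sigma_algebraType (gens (events U q) S)).
Local Notation mS S := (@measurable_fun _ _ (TS S) R setT).
Local Notation E := (Ex P).
Local Notation e := (n%:R^-1 : R).
Local Notation Y t w := (Yt U t w).
Local Notation Z t w := (Zt U t w).

Let ag := ae_good UU qm ind.
Let aY t := @adaptedY R d T U q t.
Let aZ t := @adaptedZ R d T U q t.
Let mY t : @mseq _ T R (Yt U t) := adapted_mseq qm (@aY t).
Let mZ t : @mseq _ T R (Zt U t) := adapted_mseq qm (@aZ t).
Let e0 : 0 <= e. Proof. by rewrite invr_ge0. Qed.
Let ne : n%:R * e = 1. Proof. by rewrite mulfV // pnatr_eq0 -lt0n. Qed.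

Lemma bm_du t A B : @mseq _ T R A -> @mseq _ T R B ->
  bm (fun w => du n (A w) (B w) (U 2%N t w)).
Proof.
move=> mA mB; apply: bm_sub; first exact: bm_cst.
apply: bm_sum => i; apply: bm_mul; first exact: (bm_comp (measurable_big1 n) (fun x => norm_bool _ _) (mA i)).
apply: bm_bool; apply: mprop_itv => //; first exact: mseq_tleft.
by apply: measurable_funD => //; exact: mseq_tleft.
Qed.

Lemma bm_dv t A B : @mseq _ T R A -> @mseq _ T R B ->
  bm (fun w => dv n (A w) (B w) (U 2%N t w) (U 3%N t w)).
Proof.
move=> mA mB; apply: bm_sub; first exact: bm_cst.
apply: bm_sum => i; apply: bm_mul; first exact: (bm_comp (measurable_big1 n) (fun x => norm_bool _ _) (mA i)).
apply: bm_bool; apply: mprop_itv => //; first exact: mseq_hleft.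
by apply: measurable_funD => //; exact: mseq_hleft.
Qed.

Definition dustt t w := dust n (Y t w) (Z t w) (U 2%N t w) (U 3%N t w).
Definition big_count t w := Nf n (big1f n) (Y t w) (Z t w).
Definition four_hit t w : R := (0 < U 2%N t w < mx (Y t w) (Z t w))%R%:R *
   (mx (Y t w) (Z t w) < U 3%N t w < 1 - Qmatch (Y t w) (Z t w))%R%:R.

Lemma bm_dust t : bm (dustt t).
Proof. by apply: bm_add; apply: bm_add; [exact: bm_du|exact: bm_dv|exact: bm_du|exact: bm_dv]. Qed.

Lemma bm_Nt t : bm (big_count t).
Proof. exact: (bm_Nf n (measurable_big1 n) (fun x => norm_bool _ _) (mY t) (mZ t)). Qed.

Lemma mfun_mx (d' : measure_display) (T' : measurableType d') A B : @mseq _ T' R A -> @mseq _ T' R B ->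
  measurable_fun setT (fun w => mx (A w) (B w)).
Proof. by move=> mA mB; apply: measurable_maxr; exact: mfun_unmatched_max. Qed.

Lemma mfun_mn (d' : measure_display) (T' : measurableType d') A B : @mseq _ T' R A -> @mseq _ T' R B ->
  measurable_fun setT (fun w => mn (A w) (B w)).
Proof. by move=> mA mB; apply: measurable_minr; exact: mfun_unmatched_max. Qed.

Lemma mfun_s (d' : measure_display) (T' : measurableType d') A B : @mseq _ T' R A -> @mseq _ T' R B ->
  measurable_fun setT (fun w => 1 - Qmatch (A w) (B w)).
Proof. by move=> mA mB; apply: measurable_funB; [exact: measurable_cst|exact: mfun_Qmatch]. Qed.

Lemma bm_It t : bm (four_hit t).
Proof.
have m1 := mfun_mx (mY t) (mZ t); have m2 := mfun_s (mY t) (mZ t).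
by apply: bm_mul; apply: bm_bool; apply: mprop_itv => //; exact: measurable_cst.
Qed.

Lemma Ex_dust t : E (dustt t) = 2 * (E (fun w => dust_mass n (Y t w)) + E (fun w => dust_mass n (Z t w))).
Proof.
have oY : \forall w \ae P, Om (Y t w) by apply: filterS ag => w [_ /(_ t)[]].
have oZ : \forall w \ae P, Om (Z t w) by apply: filterS ag => w [_ /(_ t)[]].
have gY : \forall w \ae P, Om (Y t w) /\ genericU (Y t w) (Z t w) (U 2%N t w).
  by apply: filterS ag => w [_ /(_ t)[? ? []]].
have gZ : \forall w \ae P, Om (Z t w) /\ genericU (Z t w) (Y t w) (U 2%N t w).
  by apply: filterS ag => w [_ /(_ t)[? ? []]].
have b1 := bm_du t (mY t) (mZ t); have b2 := bm_dv t (mY t) (mZ t).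
have b3 := bm_du t (mZ t) (mY t); have b4 := bm_dv t (mZ t) (mY t).
rewrite /dustt /dust (Ex_add _ (bm_add b1 b2) (bm_add b3 b4)) (Ex_add _ b1 b2) (Ex_add _ b3 b4).
rewrite (Ex_du UU qm ind n (@aY t) (@aZ t) oY) (Ex_du UU qm ind n (@aZ t) (@aY t) oZ).
rewrite (Ex_dv UU qm ind n (@aY t) (@aZ t) gY) (Ex_dv UU qm ind n (@aZ t) (@aY t) gZ); lra.
Qed.

Lemma Ex_Fm_le t (c : R) : E (fun w => dust_mass n (Y 0 w)) <= c -> E (fun w => dust_mass n (Z 0 w)) <= c ->
  E (fun w => dust_mass n (Y t w)) <= c + t%:R * (4 * (e * e)) /\
  E (fun w => dust_mass n (Z t w)) <= c + t%:R * (4 * (e * e)).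
Proof.
move=> hY hZ; elim: t => [|t [IY IZ]]; first by rewrite mul0r addr0.
have gY : \forall w \ae P, [/\ Om (Y t w), genericU (Y t w) (Z t w) (U 2%N t w) &
     genericV (Y t w) (Z t w) (U 2%N t w) (U 3%N t w)].
  by apply: filterS ag => w [_ /(_ t)[? ? []]].
have gZ : \forall w \ae P, [/\ Om (Z t w), genericU (Z t w) (Y t w) (U 2%N t w) &
     genericV (Z t w) (Y t w) (U 2%N t w) (U 3%N t w)].
  by apply: filterS ag => w [_ /(_ t)[? ? []]].
have := Ex_Fm_step UU qm ind n0 (@aY t) (@aZ t) gY.
have := Ex_Fm_step UU qm ind n0 (@aZ t) (@aY t) gZ.
rewrite -natr1 mulrDl mul1r => h1 h2.
by split; [apply: le_trans h2 _|apply: le_trans h1 _]; lra.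
Qed.

Lemma Ex_Fm0 K : E (fun w => dust_mass n (Y 0 w)) <= (3 / 4) ^+ K + K%:R * e /\
  E (fun w => dust_mass n (Z 0 w)) <= (3 / 4) ^+ K + K%:R * e.
Proof.
have main k (A : T -> nat -> R) : (forall w, A w = PD1_sample (fun j => U k j w)) ->
   @mseq _ T R A -> E (fun w => dust_mass n (A w)) <= (3 / 4) ^+ K + K%:R * e.
  move=> AE mA.
  apply: (@le_trans _ _ (E (fun w => remc U k K w + K%:R * e))).
    apply: Ex_le_ae; first exact: bm_Fm.
      by apply: bm_add; [exact: bm_remc|exact: bm_cst].
    apply: filterS2 (ae_U01_all UU qm ind) (ae_rem0 UU qm ind k) => w hw hr.
    have h01 i : 0 < U k i w < 1 by exact: (hw (k, i)).
    rewrite AE remcE //; apply: PD1_dust_le => //; exact: stick_rem_small.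
  rewrite (Ex_add _ (bm_remc U k K) (bm_cst _ _)) Ex_cst lerD2r; exact: (Ex_remc UU qm ind).
by split; [apply: (main 0%N)|apply: (main 1%N)].
Qed.

Lemma Ex_N0 K : E (big_count 0) <= 2 * (K%:R + n%:R * (3 / 4) ^+ K).
Proof.
pose c k w := K%:R + n%:R * remc U k K w.
have bc k : bm (c k) by apply: bm_add; [exact: bm_cst|apply: bm_mul; [exact: bm_cst|exact: bm_remc]].
have Ec k : E (c k) <= K%:R + n%:R * (3 / 4) ^+ K.
  rewrite /c (Ex_add _ (bm_cst _ _) (bm_mul (bm_cst _ _) (bm_remc _ _ _))) Ex_cst.
  rewrite (Ex_scale _ _ (bm_remc _ _ _)) lerD2l ler_wpM2l //; exact: (Ex_remc UU qm ind).
apply: (@le_trans _ _ (E (fun w => c 0%N w + c 1%N w))); last first.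
  by rewrite (Ex_add _ (bc _) (bc _)); have := Ec 0%N; have := Ec 1%N; lra.
apply: Ex_le_ae; [exact: bm_Nt|exact: bm_add|].
apply: filterS3 (ae_U01_all UU qm ind) (ae_rem0 UU qm ind 0) (ae_rem0 UU qm ind 1) => w hw hr0 hr1.
have h01 k i : 0 < U k i w < 1 by exact: (hw (k, i)).
apply: le_trans (Nf_big_le _ _ _) _; rewrite /c !remcE //.
by apply: lerD; apply: PD1_count_le => //; exact: stick_rem_small.
Qed.

Variable K : nat.
Hypothesis Ke : (3 / 4) ^+ K <= e.

(** Each side starts with expected small mass at most [(K + 1) e] and gains at most
    [n * 4 e^2 = 4 e], which gives [K + 5]; the factor [4] counts two draws on two sides. *)
Lemma Ex_dust_le t : (t <= n)%N -> E (dustt t) <= 4 * (K.+4.+1%:R * e).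
Proof.
move=> tn; have [hY hZ] := Ex_Fm0 K.
have hc : (3 / 4) ^+ K + K%:R * e <= K.+1%:R * e.
  have -> : K.+1%:R = K%:R + 1 :> R by rewrite natr1.
  by rewrite [leRHS]mulrDl mul1r addrC lerD2l.
have [h1 h2] := Ex_Fm_le t (le_trans hY hc) (le_trans hZ hc).
have te : t%:R * e <= n%:R * e by apply: ler_wpM2r => //; rewrite ler_nat.
rewrite ne in te.
have h3 : t%:R * (4 * (e * e)) <= 4 * e.
  have -> : t%:R * (4 * (e * e)) = t%:R * e * (4 * e) by ring.
  by rewrite -[leRHS]mul1r ler_wpM2r // mulr_ge0.
rewrite Ex_dust.
have -> : K.+4.+1%:R = K.+1%:R + 4 :> R by rewrite -natrD; congr _%:R; lia.
rewrite [(_ + 4) * _]mulrDl; lra.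
Qed.

Lemma Nt_telescope k : E (big_count k) + 2 * \sum_(t < k) E (four_hit t) <= E (big_count 0) + 5 * \sum_(t < k) E (dustt t).
Proof.
elim: k => [|k IH]; first by rewrite !big_ord0; lra.
rewrite !big_ord_recr /= !mulrDr.
have : E (fun w => big_count k.+1 w + 2 * four_hit k w) <= E (fun w => big_count k w + 5 * dustt k w).
  apply: Ex_le_ae.
  - by apply: bm_add; [exact: bm_Nt|apply: bm_mul; [exact: bm_cst|exact: bm_It]].
  - by apply: bm_add; [exact: bm_Nt|apply: bm_mul; [exact: bm_cst|exact: bm_dust]].
  by apply: filterS ag => w [_ /(_ k)[oY oZ g _ _]]; exact: Nf_big_step.
rewrite (Ex_add _ (bm_Nt _) (bm_mul (bm_cst _ _) (bm_It _))) (Ex_scale _ _ (bm_It _)).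
rewrite (Ex_add _ (bm_Nt _) (bm_mul (bm_cst _ _) (bm_dust _))) (Ex_scale _ _ (bm_dust _)).
lra.
Qed.

Lemma Nf_ge0 psi A B : (forall x : R, 0 <= psi x) -> 0 <= Nf n psi A B.
Proof. by move=> h; apply: addr_ge0; apply: sumr_ge0 => i _; case: ifP. Qed.

Lemma Ex_ge0 f : bm f -> (forall w, 0 <= f w) -> 0 <= E f.
Proof. by move=> bf h; rewrite -(Ex_cst P 0); apply: Ex_le => //; exact: bm_cst. Qed.

Lemma sum_dust_le : \sum_(t < n.+1) E (dustt t) <= 8 * K.+4.+1%:R.
Proof.
apply: (@le_trans _ _ (\sum_(t < n.+1) 4 * (K.+4.+1%:R * e))).
  by apply: ler_sum => t _; apply: Ex_dust_le; rewrite -ltnS.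
have nE : n.+1%:R = n%:R + 1 :> R by rewrite natr1.
rewrite sumr_const card_ord -[_ *+ _]mulr_natl nE mulrDl mul1r.
have -> : n%:R * (4 * (K.+4.+1%:R * e)) = 4 * K.+4.+1%:R * (n%:R * e) by ring.
rewrite ne mulr1.
have e1 : e <= 1 by rewrite invf_le1 ?ltr0n // ler1n.
have : K.+4.+1%:R * e <= K.+4.+1%:R by rewrite -[leRHS]mulr1 ler_wpM2l.
lra.
Qed.

Lemma Ex_N0_le : E (big_count 0) <= 2 * K.+4.+1%:R.
Proof.
apply: le_trans (Ex_N0 K) _.
have : n%:R * (3 / 4) ^+ K <= n%:R * e by apply: ler_wpM2l.
rewrite ne.
have -> : K.+4.+1%:R = K%:R + 5 :> R by rewrite -natrD; congr _%:R; lia.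
lra.
Qed.

(** From the telescoped count: twice the sum is at most [(2 + 5 * 8) (K + 5)]. It runs over [n.+1]
    steps because the second case looks one step ahead. *)
Lemma sum_It_le : \sum_(t < n.+1) E (four_hit t) <= 21 * K.+4.+1%:R.
Proof.
have := Nt_telescope n.+1; have := sum_dust_le; have := Ex_N0_le.
have : 0 <= E (big_count n.+1).
  by apply: Ex_ge0; [exact: bm_Nt|move=> w; apply: Nf_ge0 => x; rewrite ler0n].
lra.
Qed.

Lemma mprop_case1 (d' : measure_display) (T' : measurableType d') r A B : @mseq _ T' R A -> @mseq _ T' R B ->
  mprop (fun w => case1 r (A w) (B w)).
Proof.
move=> mA mB; have m1 := mfun_mx mA mB; have m2 := mfun_s mA mB.
apply: mprop_andb; apply: mprop_le => //; try exact: measurable_cst.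
exact: measurable_funB.
Qed.

(** [v] is integrated out first, with [u] frozen, and then [u]. The end points of both windows
    depend on the past alone, so the two lengths simply multiply. *)
Lemma Ex_two_hits t (c : T -> bool) (a b a' b' : T -> R) (l1 l2 : R) :
  (forall S, past t `<=` S -> @mprop _ (TS S) c) ->
  (forall S, past t `<=` S -> mS S a) -> (forall S, past t `<=` S -> mS S b) ->
  (forall S, past t `<=` S -> mS S a') -> (forall S, past t `<=` S -> mS S b') ->
  0 <= l1 -> 0 <= l2 ->
  (\forall w \ae P, c w -> [/\ 0 <= a w, b w <= 1 & l1 <= b w - a w]) ->
  (\forall w \ae P, c w -> [/\ 0 <= a' w, b' w <= 1 & l2 <= b' w - a' w]) ->
  l1 * l2 * E (fun w => (c w)%:R) <=
  E (fun w => (c w)%:R * (a w < U 2%N t w < b w)%R%:R * (a' w < U 3%N t w < b' w)%R%:R).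
Proof.
move=> mc ma mb ma' mb' l10 l20 h1 h2.
have sub := @subset_refl _ (past t); have sub1 := @past_sub1 t.
have mT f : mS (past t) f -> measurable_fun (setT : set T) f by exact: (measurable_sub qm).
have ta := mT _ (ma _ sub); have tb := mT _ (mb _ sub).
have ta' := mT _ (ma' _ sub); have tb' := mT _ (mb' _ sub).
have bc : bm (fun w => (c w)%:R : R).
  split; first by apply: mT; apply: mfun_bool; exact: mc.
  by exists 1 => w; exact: norm_bool.
have bi : bm (fun w => (a w < U 2%N t w < b w)%R%:R : R) by apply: bm_bool; exact: mprop_itv.
have blen x y : measurable_fun setT x -> measurable_fun setT y -> bm (fun w => len (x w) (y w) : R).
  move=> mx my; split; first exact: measurable_len.
  by exists 1 => w; rewrite ger0_norm ?len_ge0 // len_le1.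
have mW : mS (past1 t) (fun w => (c w)%:R * (a w < U 2%N t w < b w)%R%:R).
  apply: measurable_funM; first by apply: mfun_bool; exact: (mc _ sub1).
  have mu := @measurable_u1 _ _ _ U q t.
  by apply: mfun_bool; apply: mprop_andb; apply: mprop_lt; [exact: (ma _ sub1)| | |exact: (mb _ sub1)].
have W0 w : 0 <= (c w)%:R * (a w < U 2%N t w < b w)%R%:R :> R by rewrite mulr_ge0.
rewrite (freeze UU qm ind (@past1_not_v t) mW (ma' _ sub1) (mb' _ sub1) W0).
apply: (@le_trans _ _ (E (fun w => l2 * ((c w)%:R * (a w < U 2%N t w < b w)%R%:R)))); last first.
  apply: Ex_le_ae.
  - by apply: bm_mul; [exact: bm_cst|exact: bm_mul].
  - by apply: bm_mul; [exact: bm_mul|exact: blen].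
  apply: filterS h2 => w hw; rewrite mulrC; case: (c w) hw => /= hw; last by rewrite !mul0r.
  have [//|x1 x2 x3] := hw; rewrite ler_wpM2l ?mulr_ge0 // len01 //; lra.
have mW' : mS (past t) (fun w => (c w)%:R) by apply: mfun_bool; exact: (mc _ sub).
have W0' w : 0 <= (c w)%:R :> R by [].
rewrite (Ex_scale _ _ (bm_mul bc bi)) (freeze UU qm ind (@past_not_u t) mW' (ma _ sub) (mb _ sub) W0').
rewrite [l1 * l2]mulrC -mulrA ler_wpM2l // -(Ex_scale _ _ bc).
apply: Ex_le_ae.
- by apply: bm_mul; [exact: bm_cst|].
- by apply: bm_mul => //; exact: blen.
apply: filterS h1 => w hw; rewrite mulrC; case: (c w) hw => /= hw; last by rewrite !mul0r.
have [//|x1 x2 x3] := hw; rewrite !mul1r len01 //; lra.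
Qed.

Lemma Ex_case1 t r : 0 < r ->
  r * r * E (fun w => (case1 r (Y t w) (Z t w))%:R) <= E (four_hit t).
Proof.
move=> r0.
have mmx S : past t `<=` S -> mS S (fun w => mx (Y t w) (Z t w)).
  by move=> sub; apply: mfun_mx; [exact: (aY sub)|exact: (aZ sub)].
have ms S : past t `<=` S -> mS S (fun w => 1 - Qmatch (Y t w) (Z t w)).
  by move=> sub; apply: mfun_s; [exact: (aY sub)|exact: (aZ sub)].
have mc S : past t `<=` S -> @mprop _ (TS S) (fun w => case1 r (Y t w) (Z t w)).
  by move=> sub; apply: mprop_case1; [exact: (aY sub)|exact: (aZ sub)].
have := @Ex_two_hits t (fun w => case1 r (Y t w) (Z t w)) (fun=> 0) (fun w => mx (Y t w) (Z t w))
  (fun w => mx (Y t w) (Z t w)) (fun w => 1 - Qmatch (Y t w) (Z t w)) r r mc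
  (fun S _ => measurable_cst _) mmx mmx ms (ltW r0) (ltW r0).
move=> h; apply: le_trans (h _ _) _.
- apply: filterS ag => w [_ /(_ t)[oY oZ _ _ _]] /andP[c1 case2]; split=> //.
    have := mx_le oY oZ; have /andP[_] := @unmatched_mass_ge0 _ _ (Z t w) oY; lra.
  by rewrite subr0.
- apply: filterS ag => w [_ /(_ t)[oY oZ _ _ _]] /andP[c1 case2]; split=> //.
    by apply: ltW; exact: lt_le_trans c1.
  by have /andP[] := @unmatched_mass_ge0 _ _ (Z t w) oY.
have bI := bm_It t.
apply: Ex_le => //.
  apply: bm_mul.
    apply: bm_mul; first by apply: bm_bool; apply: mprop_case1.
    by apply: bm_bool; apply: mprop_itv => //; exact: mfun_mx.
  by apply: bm_bool; apply: mprop_itv => //; [exact: mfun_mx|exact: mfun_s].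
by move=> w; rewrite /four_hit; case: (case1 _ _ _); rewrite ?mul1r ?mul0r // mulr_ge0.
Qed.

Definition case2 r t w := (4 <= Nf n (atl r) (Y t w) (Z t w)) && ~~ case1 (r / 2) (Y t w) (Z t w).

Lemma bm_NR r t : bm (fun w => Nf n (atl r) (Y t w) (Z t w)).
Proof. exact: (bm_Nf n (measurable_atl r) (fun x => norm_bool _ _) (mY t) (mZ t)). Qed.

Lemma mprop_c2 (d' : measure_display) (T' : measurableType d') r A B : @mseq _ T' R A -> @mseq _ T' R B ->
  mprop (fun w => (4 <= Nf n (atl r) (A w) (B w)) && ~~ case1 (r / 2) (A w) (B w)).
Proof.
move=> mA mB; apply: mprop_andb; last by apply: mprop_negb; exact: mprop_case1.
apply: mprop_le; first exact: measurable_cst.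
have mU' A' B' : @mseq _ T' R A' -> @mseq _ T' R B' -> measurable_fun setT (fun w => Uf n (atl r) (A' w) (B' w)).
  move=> mA' mB'; apply: measurable_sum => i; apply: mfun_if.
  - by apply: mprop_negb; exact: mprop_mt.
  - by apply: (measurableT_comp (measurable_atl r)); exact: mA'.
  - exact: measurable_cst.
by apply: measurable_funD; exact: mU'.
Qed.

(** The windows of [case2_step] have lengths at least [r] for [u] and [r / 2] for [v], and hitting
    both leads to the first case at the next time. *)
Lemma Ex_case2 t r : 0 < r ->
  r * (r / 2) * E (fun w => (case2 r t w)%:R) <=
  E (fun w => (case1 (r / 2) (Y t.+1 w) (Z t.+1 w))%:R).
Proof.
move=> r0.
have mmn S : past t `<=` S -> mS S (fun w => mn (Y t w) (Z t w)).
  by move=> sub; apply: mfun_mn; [exact: (aY sub)|exact: (aZ sub)].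
have mmn' S : past t `<=` S -> mS S (fun w => mn (Y t w) (Z t w) + r / 2).
  by move=> sub; apply: measurable_funD; [exact: mmn|exact: measurable_cst].
have mc S : past t `<=` S -> @mprop _ (TS S) (case2 r t).
  by move=> sub; apply: mprop_c2; [exact: (aY sub)|exact: (aZ sub)].
have r20 : 0 <= r / 2 by lra.
have := @Ex_two_hits t (case2 r t) (fun=> 0) (fun w => mn (Y t w) (Z t w))
  (fun w => mn (Y t w) (Z t w)) (fun w => mn (Y t w) (Z t w) + r / 2) r (r / 2) mc
  (fun S _ => measurable_cst _) mmn mmn mmn' (ltW r0) r20.
move=> h; apply: le_trans (h _ _) _.
- apply: filterS ag => w [_ /(_ t)[oY oZ _ _ _]] /andP[N4 c1]; split=> //.
    by have [] := case2_mn oY oZ r0 N4 c1; lra.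
  by rewrite subr0; have [] := case2_mn oY oZ r0 N4 c1.
- apply: filterS ag => w [_ /(_ t)[oY oZ _ _ _]] /andP[N4 c1]; split=> //.
  + by have [] := case2_mn oY oZ r0 N4 c1; lra.
  + by have [] := case2_mn oY oZ r0 N4 c1; lra.
  + lra.
apply: Ex_le_ae.
- apply: bm_mul.
    apply: bm_mul; first by apply: bm_bool; apply: mprop_c2.
    by apply: bm_bool; apply: mprop_itv => //; exact: mfun_mn.
  apply: bm_bool; apply: mprop_itv => //; first exact: mfun_mn.
  by apply: measurable_funD; [exact: mfun_mn|exact: measurable_cst].
- by apply: bm_bool; apply: mprop_case1.
apply: filterS ag => w [_ /(_ t)[oY oZ g gn gn']].
case: (boolP (case2 r t w)) => [/andP[N4 c1]|_]; last by rewrite !mul0r ler0n.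
case: (boolP (0 < U 2%N t w < mn (Y t w) (Z t w))) => hu; last by rewrite mulr0 mul0r ler0n.
case: (boolP (mn (Y t w) (Z t w) < U 3%N t w < mn (Y t w) (Z t w) + r / 2)) => hv; last by rewrite !mulr0 ler0n.
by rewrite (case2_step oY oZ r0 N4 c1 g gn gn' hu hv) !mulr1.
Qed.

End Sums.

(** * Births at all scales *)

Section Final.
Variables (R : realType) (d : measure_display) (T : measurableType d) (P : probability T R).
Variables (U : nat -> nat -> {mfun T >-> R}) (q : T -> nat).
Hypothesis UU : forall k j (A : set R), measurable A ->
       distribution P (U k j) A = uniform_prob (@ltr01 R) A.
Hypothesis qm : forall k, measurable (q @^-1` [set k]).
Hypothesis ind : mutually_independent P (events U q).
Variable n : nat.
Hypothesis n0 : (0 < n)%N.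
Variable K : nat.
Hypothesis Ke : (3 / 4 : R) ^+ K <= n%:R^-1.

Local Notation TS S := (g_sigma_algebraType (gens (events U q) S)).
Local Notation mS S := (@measurable_fun _ _ (TS S) R setT).
Local Notation E := (Ex P).
Local Notation Y t w := (Yt U t w).
Local Notation Z t w := (Zt U t w).
Local Notation NR r t := (fun w => Nf n (atl r) (Y t w) (Z t w)).

Let ag := ae_good UU qm ind.
Let aY t := @adaptedY R d T U q t.
Let aZ t := @adaptedZ R d T U q t.
Let mY t : @mseq _ T R (Yt U t) := adapted_mseq qm (@aY t).
Let mZ t : @mseq _ T R (Zt U t) := adapted_mseq qm (@aZ t).

(** A side has at most [x / 2] pieces of size [2 / x], so the count is at most [4], or at most [x]
    in one of the two cases. Each pair of draws into windows of length at least [1 / x] costs a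
    factor [x^2]: one pair in the first case, two in the second. *)
Lemma Ex_NR_le t (x : R) : 1 <= x ->
  E (NR (2 / x) t) <= 4 + x * (x ^+ 2 * E (four_hit U t) + x ^+ 4 * E (four_hit U t.+1)).
Proof.
move=> x1; have x0 : 0 < x by apply: lt_le_trans x1.
set r := 2 / x; have r0 : 0 < r by rewrite divr_gt0.
have rx : r / 2 = x^-1 by rewrite /r mulrAC mulfV ?mul1r.
have b1 : bm (fun w => (case1 x^-1 (Y t w) (Z t w))%:R : R) by apply: bm_bool; apply: mprop_case1.
have b2 : bm (fun w => (case2 U n r t w)%:R : R) by apply: bm_bool; apply: mprop_c2.
have xi0 : 0 < x^-1 by rewrite invr_gt0.
have h1 : E (fun w => (case1 x^-1 (Y t w) (Z t w))%:R) <= x ^+ 2 * E (four_hit U t).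
  have := Ex_case1 UU qm ind t xi0.
  rewrite -(ler_pM2l (_ : 0 < x ^+ 2)) ?exprn_gt0 // mulrA.
  by rewrite -expr2 -exprMn mulfV ?gt_eqF // expr1n mul1r.
have h2 : E (fun w => (case2 U n r t w)%:R) <= x ^+ 4 * E (four_hit U t.+1).
  have g1 := Ex_case2 UU qm ind n t r0; rewrite rx in g1.
  have g2 := Ex_case1 UU qm ind t.+1 xi0.
  set C2 := E (fun w => (case2 U n r t w)%:R) in g1 *.
  have C20 : 0 <= C2 by apply: Ex_ge0 => // w; rewrite ler0n.
  have g3 : x^-1 * x^-1 * C2 <= E (fun w => (case1 x^-1 (Y t.+1 w) (Z t.+1 w))%:R).
    apply: le_trans g1; apply: ler_wpM2r => //; apply: ler_wpM2r; first exact: ltW.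
    by rewrite /r ler_peMl ?ler1n // ltW.
  have g4 : (x^-1 * x^-1) * (x^-1 * x^-1 * C2) <= E (four_hit U t.+1).
    by apply: le_trans g2; apply: ler_wpM2l => //; rewrite mulr_ge0 ?ltW.
  have x40 : 0 <= x ^+ 4 by rewrite exprn_ge0 // ltW.
  have := ler_wpM2l x40 g4.
  have -> : x ^+ 4 * (x^-1 * x^-1 * (x^-1 * x^-1 * C2)) = C2 by field; rewrite gt_eqF.
  by [].
apply: (@le_trans _ _ (E (fun w => 4 + x * ((case1 x^-1 (Y t w) (Z t w))%:R + (case2 U n r t w)%:R)))).
  apply: Ex_le_ae; first exact: bm_NR.
    by apply: bm_add; [exact: bm_cst|apply: bm_mul; [exact: bm_cst|exact: bm_add]].
  apply: filterS ag => w [_ /(_ t)[oY oZ _ _ _]].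
  have hb : Nf n (atl r) (Y t w) (Z t w) <= x.
    have := Uf_atl_le n (Zt U t w) oY r0; have := Uf_atl_le n (Yt U t w) oZ r0.
    have -> : r^-1 = x / 2 by rewrite /r invf_div.
    rewrite /Nf; lra.
  rewrite /case2 rx; case: (leP 4 (Nf n (atl r) (Y t w) (Z t w))) => N4 /=; last first.
    apply: le_trans (ltW N4) _; rewrite lerDl mulr_ge0 ?addr_ge0 ?ler0n // ltW //.
  case: (case1 _ _ _) => /=; rewrite ?addr0 ?add0r mulr1; lra.
rewrite (Ex_add _ (bm_cst _ _) (bm_mul (bm_cst _ _) (bm_add b1 b2))) Ex_cst (Ex_scale _ _ (bm_add b1 b2)).
by rewrite (Ex_add _ b1 b2) lerD2l ler_wpM2l ?lerD // ltW.
Qed.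

Lemma sum_NR_le (x : R) : 1 <= x ->
  \sum_(t < n) E (NR (2 / x) t) <= 4 * n%:R + 42 * (x ^+ 5 * K.+4.+1%:R).
Proof.
move=> x1; have x0 : 0 < x by apply: lt_le_trans x1.
pose SI := \sum_(t < n.+1) E (four_hit U t).
have I0 t : 0 <= E (four_hit U t) by apply: Ex_ge0; [exact: (bm_It U qm t)|move=> w; rewrite mulr_ge0].
have SI1 : \sum_(t < n) E (four_hit U t) <= SI by rewrite /SI big_ord_recr /= lerDl.
have SI2 : \sum_(t < n) E (four_hit U t.+1) <= SI by rewrite /SI big_ord_recl /= lerDr.
have SIb : SI <= 21 * K.+4.+1%:R by exact: (sum_It_le UU qm ind n0 Ke).
apply: (@le_trans _ _ (\sum_(t < n) (4 + x * (x ^+ 2 * E (four_hit U t) + x ^+ 4 * E (four_hit U t.+1))))).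
  by apply: ler_sum => t _; exact: Ex_NR_le.
rewrite big_split /= sumr_const card_ord -mulr_sumr big_split /= -!mulr_sumr.
rewrite -[4 *+ n]mulr_natr lerD2l.
have x5 : 0 < x ^+ 5 by rewrite exprn_gt0.
have x25 : x ^+ 2 <= x ^+ 4 by rewrite ler_weXn2l.
have h1 : x ^+ 2 * \sum_(t < n) E (four_hit U t) <= x ^+ 4 * SI.
  by apply: ler_pM => //; [rewrite exprn_ge0 // ltW|exact: sumr_ge0].
have h2 : x ^+ 4 * \sum_(t < n) E (four_hit U t.+1) <= x ^+ 4 * SI.
  by apply: ler_wpM2l => //; rewrite exprn_ge0 // ltW.
have h3 := ler_wpM2l (ltW x0) (lerD h1 h2).
apply: le_trans h3 _.
have -> : x * (x ^+ 4 * SI + x ^+ 4 * SI) = 2 * (x ^+ 5 * SI) by ring.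
have := ler_wpM2l (ltW x5) SIb.
have -> : x ^+ 5 * (21 * K.+4.+1%:R) = 21 * (x ^+ 5 * K.+4.+1%:R) by ring.
lra.
Qed.

Variables (k0 k1 : nat) (rho : R).
Hypothesis kn : (2 ^ k1 <= n)%N.
Hypothesis rho0 : 0 < rho.
Hypothesis krho : (2 ^+ k0)^-1 <= rho.

Local Notation ph := (@phi R k0 k1).
Local Notation M := (2 ^+ k1 : R).
Definition exceed t w := rho < mx (Y t w) (Z t w).
Definition birth t w : R := (0 < U 2%N t w < mx (Y t w) (Z t w))%R%:R *
  ((U 3%N t w < mx (Y t w) (Z t w))%R%:R * ph (mx (Y t w) (Z t w) - U 3%N t w)).

Lemma norm_phi x : `|ph x| <= M.
Proof. by rewrite ger0_norm ?phi_ge0 ?phi_le. Qed.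

Lemma bm_birth t : bm (birth t).
Proof.
have m1 := mfun_mx (mY t) (mZ t).
apply: bm_mul; first by apply: bm_bool; apply: mprop_itv => //; exact: measurable_cst.
apply: bm_mul; first by apply: bm_bool; apply: mprop_lt.
exact: (bm_comp (@measurable_phi R k0 k1) norm_phi (measurable_funB m1 (@mU _ _ _ U 3 t))).
Qed.

Lemma bm_exceed t : bm (fun w => (exceed t w)%:R : R).
Proof.
apply: bm_bool; apply: mprop_lt; first exact: measurable_cst.
by apply: mfun_mx.
Qed.

(** The factor [2^k] cancels the length [2^-(k+1)] of the window for [v] up to [1/2], so each of the
    [k1 - k0] scales contributes the same amount. *)
Lemma Ex_birth_ge t :
  (k1 - k0)%:R / 2 * (rho * E (fun w => (exceed t w)%:R)) <= E (birth t).
Proof.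
pose m w := mx (Y t w) (Z t w).
have mm S : past t `<=` S -> mS S m.
  by move=> sub; apply: mfun_mx; [exact: (aY sub)|exact: (aZ sub)].
have mc S : past t `<=` S -> @mprop _ (TS S) (exceed t).
  by move=> sub; apply: mprop_lt; [exact: measurable_cst|exact: mm].
have mmT := mfun_mx (mY t) (mZ t).
(* For [v] between these bounds the piece [m w - v] cut off has scale [k]. *)
pose lo k w := m w - (2 ^+ k)^-1; pose hi k w := m w - (2 ^+ k.+1)^-1.
pose term (k : nat) w : R := (exceed t w)%:R * (0 < U 2%N t w < m w)%R%:R *
  (lo k w < U 3%N t w < hi k w)%R%:R.
have p0 k : 0 < (2 ^+ k)^-1 :> R by rewrite invr_gt0 exprn_gt0.
have half k : (2 ^+ k)^-1 = 2 * (2 ^+ k.+1)^-1 :> R by rewrite exprS invfM mulrA mulfV ?mul1r.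
have bterm k : bm (term k).
  apply: bm_mul; last first.
    by apply: bm_bool; apply: mprop_itv => //; apply: measurable_funB => //; exact: measurable_cst.
  apply: bm_mul; first exact: bm_exceed.
  by apply: bm_bool; apply: mprop_itv => //; exact: measurable_cst.
have hterm (k : nat) : (k0 <= k)%N ->
    rho * (2 ^+ k.+1)^-1 * E (fun w => (exceed t w)%:R) <= E (term k).
  move=> k0k.
  have krho' : (2 ^+ k)^-1 <= rho.
    by apply: le_trans krho; rewrite lef_pV2 ?posrE ?exprn_gt0 // ler_eXn2l // ltr1n.
  apply: (@Ex_two_hits _ _ _ P U q UU qm ind t (exceed t) (fun=> 0) m (lo k) (hi k) _ _ mc
    (fun S _ => measurable_cst _) mm) => //.
  - by move=> S sub; apply: measurable_funB; [exact: mm|exact: measurable_cst].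
  - by move=> S sub; apply: measurable_funB; [exact: mm|exact: measurable_cst].
  - exact: ltW.
  - apply: filterS ag => w [_ /(_ t)[oY oZ _ _ _]] ex; split=> //; last by rewrite subr0 ltW.
    by apply: le_trans (mx_le oY oZ) _; have /andP[] := @unmatched_mass_ge0 _ _ (Z t w) oY.
  - apply: filterS ag => w [_ /(_ t)[oY oZ _ _ _]] ex; rewrite /lo /hi; split.
    + by rewrite subr_ge0; apply: le_trans krho' _; exact: ltW.
    + have := mx_le oY oZ; have /andP[_] := @unmatched_mass_ge0 _ _ (Z t w) oY.
      by have := p0 k.+1; rewrite /m; lra.
    + by rewrite (half k); have := p0 k.+1; lra.
apply: (@le_trans _ _ (E (fun w => \sum_(k < k1) ((k0 <= k)%N%:R * 2 ^+ k) * term k w))).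
  rewrite Ex_sum; last by move=> k; apply: bm_mul => //; exact: bm_cst.
  rewrite -sum_scales !mulr_suml; apply: ler_sum => k _.
  rewrite (Ex_scale _ _ (bterm _)).
  case: (leqP k0 k) => h; last by rewrite !mul0r.
  have pk : 0 < 2 ^+ k :> R by rewrite exprn_gt0.
  have := ler_wpM2l (ltW pk) (hterm k h).
  have -> : 2 ^+ k * (rho * (2 ^+ k.+1)^-1 * E (fun w => (exceed t w)%:R)) =
     1 / 2 * (rho * E (fun w => (exceed t w)%:R)).
    by rewrite exprS; field; rewrite gt_eqF.
  by rewrite !mul1r.
apply: Ex_le; [|exact: bm_birth|].
  by apply: bm_sum => k; apply: bm_mul => //; exact: bm_cst.
move=> w; rewrite /birth /term -/(m w).
case: (boolP (0 < U 2%N t w < m w)) => hu; last first.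
  by rewrite mul0r big1 // => k _; rewrite mulr0 mul0r mulr0.
rewrite mul1r; case: (boolP (U 3%N t w < m w)) => hv; last first.
  rewrite mul0r big1 // => k _; rewrite (_ : _ && _ = false) ?mulr0 //.
  apply/negbTE; apply: contra hv => /andP[_]; rewrite /hi; have := p0 k.+1; lra.
rewrite mul1r /phi; apply: ler_sum => k _; rewrite mulr1 -mulrA.
apply: ler_wpM2l; first by rewrite ler0n.
apply: ler_wpM2l; first by rewrite exprn_ge0.
have -> : (lo k w < U 3%N t w < hi k w)%R%:R = scale_ind k (m w - U 3%N t w).
  rewrite /scale_ind /lo /hi andbC; congr (_ && _)%:R; apply/idP/idP; lra.
by case: (exceed t w); rewrite ?mul1r // mul0r /scale_ind ler0n.
Qed.

Local Notation Psi t := (fun w => M * big_count U n t w - Nf n ph (Y t w) (Z t w)).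

Lemma bm_Nphi t : bm (fun w => Nf n ph (Y t w) (Z t w)).
Proof. exact: (bm_Nf n (@measurable_phi R k0 k1) norm_phi (mY t) (mZ t)). Qed.

Lemma bm_Psi t : bm (Psi t).
Proof.
by apply: bm_sub; [apply: bm_mul; [exact: bm_cst|exact: (bm_Nt U qm n t)]|exact: bm_Nphi].
Qed.

Lemma bm_hitf t A B : @mseq _ T R A -> @mseq _ T R B ->
  bm (fun w => hitf n ph (A w) (B w) (U 2%N t w) (U 3%N t w)).
Proof.
move=> mA mB; pose p i w := ~~ mt (A w) (B w) i.
have mp i : mprop (p i) by apply: mprop_negb; exact: mprop_mt.
apply: bm_add; apply: bm_sum => i.
  exact: (bm_block (@measurable_phi R k0 k1) norm_phi mA (mseq_tleft mA mB) (@mU _ _ _ U 2 t) mp i).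
exact: (bm_block (@measurable_phi R k0 k1) norm_phi mA (mseq_hleft mA mB (@mU _ _ _ U 2 t)) (@mU _ _ _ U 3 t) mp i).
Qed.

(** The weight of the hits is controlled by [Ex_hitf], because [phi x * x] is at most the indicator
    of [x >= 1 / M]. *)
Lemma Ex_birth_le t :
  E (birth t) + E (Psi t.+1) <= E (Psi t) + 2 * E (NR M^-1 t) + 3 * M * E (dustt U n t).
Proof.
pose H w := hitf n ph (Y t w) (Z t w) (U 2%N t w) (U 3%N t w) +
  hitf n ph (Z t w) (Y t w) (U 2%N t w) (U 3%N t w).
have bh1 := bm_hitf t (mY t) (mZ t); have bh2 := bm_hitf t (mZ t) (mY t).
have bH : bm H by exact: bm_add.
have phi01 x : 0 <= ph x <= M by rewrite phi_ge0 phi_le.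
have hH : E H <= 2 * E (NR M^-1 t).
  have oY : \forall w \ae P, Om (Y t w) by apply: filterS ag => w [_ /(_ t)[]].
  have oZ : \forall w \ae P, Om (Z t w) by apply: filterS ag => w [_ /(_ t)[]].
  have := Ex_hitf UU qm ind n (@aY t) (@aZ t) oY (@measurable_phi R k0 k1) phi01 (@phi_mul_le R k0 k1).
  have := Ex_hitf UU qm ind n (@aZ t) (@aY t) oZ (@measurable_phi R k0 k1) phi01 (@phi_mul_le R k0 k1).
  have bU1 := bm_Uf n (measurable_atl M^-1) (fun x => norm_bool _ _) (mY t) (mZ t).
  have bU2 := bm_Uf n (measurable_atl M^-1) (fun x => norm_bool _ _) (mZ t) (mY t).
  rewrite /H (Ex_add _ bh1 bh2) /Nf (Ex_add _ bU1 bU2); lra.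
have bd := bm_dust U qm n t.
have : E (fun w => birth t w + (M * big_count U n t.+1 w - Nf n ph (Y t.+1 w) (Z t.+1 w))) <=
    E (fun w => (M * big_count U n t w - Nf n ph (Y t w) (Z t w)) + H w + 3 * M * dustt U n t w).
  apply: Ex_le_ae.
  - by apply: bm_add; [exact: bm_birth|exact: bm_Psi].
  - apply: bm_add; first by apply: bm_add; [exact: bm_Psi|].
    by apply: bm_mul => //; exact: bm_cst.
  apply: filterS ag => w [_ /(_ t)[oY oZ g _ _]].
  apply: (Nf_phi_step oY oZ n0 g); first exact: phi_large.
  by move=> x; exact: phi_le.
rewrite (Ex_add _ (bm_birth t) (bm_Psi t.+1)).
rewrite (Ex_add _ (bm_add (bm_Psi t) bH) (bm_mul (bm_cst _ _) bd)) (Ex_add _ (bm_Psi t) bH) (Ex_scale _ _ bd).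
lra.
Qed.

Lemma Ex_Psi_ge0 t : 0 <= E (Psi t).
Proof.
apply: Ex_ge0; first exact: bm_Psi.
move=> w; rewrite /big_count -Nf_lin; apply: Nf_ge0 => x; rewrite /big1f.
have [_ ps] := @phi_large R k0 k1 n kn.
case: (ltP n%:R^-1 x) => h; first by rewrite mulr1 subr_ge0 phi_le.
by rewrite mulr0 ps // subrr.
Qed.

Lemma Ex_Psi0 : E (Psi 0) <= M * (2 * K.+4.+1%:R).
Proof.
rewrite (Ex_sub _ (bm_mul (bm_cst _ _) (bm_Nt U qm n 0)) (bm_Nphi 0)) (Ex_scale _ _ (bm_Nt U qm n 0)).
have : 0 <= E (fun w => Nf n ph (Y 0 w) (Z 0 w)).
  by apply: Ex_ge0; [exact: bm_Nphi|move=> w; apply: Nf_ge0 => x; exact: phi_ge0].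
have M0 : 0 <= M by rewrite exprn_ge0.
have := ler_wpM2l M0 (Ex_N0_le UU qm ind n0 Ke); lra.
Qed.

(** Telescoping [Ex_birth_le]: [8 n] and [84 (2 M)^5] are twice the bound of [sum_NR_le] at
    [x = 2 M]; [26 M] is [2 M] from the initial potential plus [3 M * 8] from the dust. *)
Lemma sum_exceed_le :
  (k1 - k0)%:R / 2 * (rho * \sum_(t < n) E (fun w => (exceed t w)%:R)) <=
  8 * n%:R + (84 * (2 * M) ^+ 5 + 26 * M) * K.+4.+1%:R.
Proof.
have M0 : 0 < M by rewrite exprn_gt0.
have M1 : 1 <= M by rewrite exprn_ege1 // ler1n.
have tel k : \sum_(t < k) E (birth t) + E (Psi k) <=
    E (Psi 0) + 2 * \sum_(t < k) E (NR M^-1 t) + 3 * M * \sum_(t < k) E (dustt U n t).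
  elim: k => [|k IH]; first by rewrite !big_ord0; lra.
  rewrite !big_ord_recr /= !mulrDr; have := Ex_birth_le k; lra.
have h1 : (k1 - k0)%:R / 2 * (rho * \sum_(t < n) E (fun w => (exceed t w)%:R)) <= \sum_(t < n) E (birth t).
  by rewrite !mulr_sumr; apply: ler_sum => t _; exact: Ex_birth_ge.
have x2 : 1 <= 2 * M by lra.
have g := sum_NR_le x2.
have Mi : 2 / (2 * M) = M^-1 by rewrite invfM mulrA mulfV ?mul1r.
rewrite Mi in g.
have g2 : \sum_(t < n) E (dustt U n t) <= 8 * K.+4.+1%:R.
  apply: le_trans (sum_dust_le UU qm ind n0 Ke).
  rewrite big_ord_recr /= lerDl.
  rewrite -(Ex_cst P 0); apply: Ex_le_ae; [exact: bm_cst|exact: (bm_dust U qm n n)|].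
  by apply: filterS ag => w [_ /(_ n)[oY oZ gg _ _]]; exact: dust_ge0.
have M30 : 0 <= 3 * M by lra.
have {}g2 := ler_wpM2l M30 g2.
have := tel n; have := Ex_Psi_ge0 n; have := Ex_Psi0.
have := g2; have -> : 3 * M * (8 * K.+4.+1%:R) = 24 * (M * K.+4.+1%:R) :> R by ring.
have -> : (84 * (2 * M) ^+ 5 + 26 * M) * K.+4.+1%:R =
  84 * ((2 * M) ^+ 5 * K.+4.+1%:R) + 26 * (M * K.+4.+1%:R) by ring.
have -> : M * (2 * K.+4.+1%:R) = 2 * (M * K.+4.+1%:R) by ring.
lra.
Qed.
End Final.

(** * Numerical estimates *)

Section Numbers.
Variable R : realType.

Lemma expn2_ge_lin l : (16 * l <= 2 ^ l + 48)%N.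
Proof.
elim: l => [//|l IH]; case: (ltnP l 4) => h; first by move: l h {IH}; do 4!case=> //.
have h2 : (16 <= 2 ^ l)%N by rewrite (@leq_exp2l 2 4).
rewrite expnS; move: IH h2; set x := (2 ^ l)%N; lia.
Qed.

(** With [m] about [log2 t0], discarding about [log2 m] large scales leaves a fixed fraction of the
    [m %/ 10] available ones; the additive [300] takes care of small [m]. *)
Lemma scales_count m l : (2 ^ l <= m.+1)%N -> (m.+1 <= 40 * (m %/ 10 - l.+1) + 300)%N.
Proof. by move=> h; have := expn2_ge_lin l; have := divn_eq m 10; have := ltn_pmod m (isT : 0 < 10)%N; lia. Qed.

(** Both the fifth power of [2^(m/10)] and, up to the factor [11], the number [3 (m + 1) + 5] are at
    most [2^(m/2)], and the square of the latter is at most [n]. *)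
Lemma error_le (m n : nat) : (2 ^ m <= n)%N ->
  (84 * (2 * 2 ^+ (m %/ 10)) ^+ 5 + 26 * 2 ^+ (m %/ 10)) * (3 * m.+1).+4.+1%:R <=
  ((84 * 32 + 26) * 11) * n%:R :> R.
Proof.
move=> mn; pose h := m./2; pose k := (m %/ 10)%N; pose H := 2 ^+ h : R.
have hm : (h.*2 <= m <= h.*2.+1)%N by rewrite /h; have := odd_double_half m; lia.
have p2 (a b : nat) : (a <= b)%N -> 2 ^+ a <= 2 ^+ b :> R by move=> ab; rewrite ler_weXn2l // ler1n.
have k5 : (k * 5 <= h)%N by rewrite /k /h; have := odd_double_half m; have := divn_eq m 10; lia.
have M5 : (2 ^+ k) ^+ 5 <= H by rewrite -exprM; exact: p2.
have M1 : 2 ^+ k <= H by apply: p2; lia.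
have H0 : 0 <= H by rewrite exprn_ge0.
have HH : H * H <= n%:R.
  rewrite -exprD addnn; apply: (@le_trans _ _ (2 ^+ m)); first by apply: p2; lia.
  by rewrite -natrX ler_nat.
have Kl : (3 * m.+1).+4.+1%:R <= 11 * H.
  rewrite /H -natrX -natrM ler_nat; have := ltn_expl h (isT : 1 < 2)%N; lia.
rewrite -/k exprMn.
have -> : 2 ^+ 5 = 32 :> R by rewrite -natrX.
have l1 : 84 * (32 * (2 ^+ k) ^+ 5) + 26 * 2 ^+ k <= (84 * 32 + 26) * H by lra.
apply: (@le_trans _ _ ((84 * 32 + 26) * H * (11 * H))).
  apply: ler_pM => //; by rewrite addr_ge0 // !mulr_ge0 ?exprn_ge0.
have -> : (84 * 32 + 26) * H * (11 * H) = ((84 * 32 + 26) * 11) * (H * H) by ring.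
by apply: ler_wpM2l HH; lra.
Qed.

Lemma ln_le_log2 (m n : nat) : (0 < n)%N -> (n < 2 ^ m.+1)%N -> ln (n%:R : R) <= m.+1%:R.
Proof.
move=> n0 nm; apply: (@le_trans _ _ (ln (2 ^+ m.+1 : R))).
  by rewrite ler_ln ?posrE ?exprn_gt0 ?ltr0n // -natrX ler_nat ltnW.
rewrite lnXn // -[ln _ *+ _]mulr_natl ler_piMr //.
have := @le_ln1Dx R 1; rewrite -natr1 => -> //; lra.
Qed.

End Numbers.

(** * The uniform time *)

Section Time.
Variables (R : realType) (d : measure_display) (T : measurableType d) (P : probability T R).
Variables (U : nat -> nat -> {mfun T >-> R}) (q : T -> nat).
Hypothesis UU : forall k j (A : set R), measurable A ->
       distribution P (U k j) A = uniform_prob (@ltr01 R) A.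
Hypothesis qm : forall k, measurable (q @^-1` [set k]).
Hypothesis ind : mutually_independent P (events U q).
Variable n : nat.
Hypothesis n0 : (0 < n)%N.
Hypothesis qU : forall k, (k < n)%N -> P (q @^-1` [set k]) = (n%:R^-1)%:E.

Local Notation TS S := (g_sigma_algebraType (gens (events U q) S)).
Local Notation E := (Ex P).

(** The event at time [t] belongs to the sigma-algebra of the past, of which [q] is independent. *)
Lemma Ex_uniform_time (b : nat -> T -> bool) :
  (forall t, @mprop _ (TS (past t)) (b t)) -> (forall t, mprop (b t)) ->
  E (fun w => (b (q w) w)%:R) <= n%:R^-1 * \sum_(t < n) E (fun w => (b t w)%:R).
Proof.
move=> mb mbT.
have mq t : mprop (fun w => q w == t).
  by apply: (mprop_ext (P := fun w => q w = t)); [move=> w; split=> /eqP|exact: qm].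
have Eq t : (t < n)%N -> E (fun w => (q w == t)%:R) = n%:R^-1.
  move=> tn; apply: EFin_inj; rewrite Ex_bool // -(qU tn); congr (P _).
  by apply/seteqP; split=> w /eqP.
have Eqb t : (t < n)%N -> E (fun w => (q w == t)%:R * (b t w)%:R) = n%:R^-1 * E (fun w => (b t w)%:R).
  move=> tn; apply: EFin_inj.
  under [X in Ex P X]funext do rewrite -natrM mulnb.
  rewrite Ex_bool; last exact: mprop_andb.
  rewrite EFinM -(Eq t tn) (Ex_bool P (mq t)) (Ex_bool P (mbT t)) muleC.
  have nS : ~ past t None by [].
  have -> : [set w | (q w == t) && b t w] = [set w | b t w] `&` [set w | q w == t].
    by apply/seteqP; split=> w /=; [case/andP|case=> -> ->].
  apply: (independent_gens ind (events_measurable qm) (@events_setT _ _ _ U q)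
    (@events_setI _ _ _ U q) nS); last exact: (mb t).
  by exists [set t] => //; apply/seteqP; split=> w /eqP.
have b1 t : bm (fun w => (q w == t)%:R : R) by exact: bm_bool.
have b2 t : bm (fun w => (b t w)%:R : R) by exact: bm_bool.
have b3 t : bm (fun w => (q w == t)%:R * (b t w)%:R : R) by exact: bm_mul.
have b4 : bm (fun w => \sum_(t < n) ((q w == t)%:R * (b t w)%:R) : R) by apply: bm_sum => t.
have b5 : bm (fun w => \sum_(t < n) (q w == t)%:R : R) by apply: bm_sum => t.
have b6 := bm_sub (bm_cst T (1 : R)) b5.
(* The last term is the indicator of [q >= n]; its expectation is [1 - n / n = 0]. *)
apply: (@le_trans _ _ (E (fun w => \sum_(t < n) ((q w == t)%:R * (b t w)%:R) +
    (1 - \sum_(t < n) (q w == t)%:R)))).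
  apply: Ex_le.
  - by apply: bm_bool; apply: (mprop_sel (P := fun t w => b t w)).
  - exact: bm_add.
  move=> w; case: (ltnP (q w) n) => h.
    have sum1 (F : nat -> R) : \sum_(t < n) (q w == t)%:R * F t = F (q w).
      rewrite (bigD1 (Ordinal h)) //= eqxx mul1r big1 ?addr0 // => i.
      by rewrite -val_eqE /= eq_sym => /negbTE ->; rewrite mul0r.
    have := sum1 (fun=> 1); under eq_bigr do rewrite mulr1; move=> ->.
    by rewrite (sum1 (fun t => (b t w)%:R)) subrr addr0.
  rewrite !big1 ?add0r ?subr0 ?lern1 ?leq_b1 //.
    by move=> i _; rewrite gtn_eqF // (leq_trans _ h).
  by move=> i _; rewrite gtn_eqF ?mul0r // (leq_trans _ h).
rewrite (Ex_add _ b4 b6) (Ex_sub _ (bm_cst _ _) b5) Ex_cst !Ex_sum //.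
rewrite (eq_bigr (fun t : 'I_n => n%:R^-1 * E (fun w => (b t w)%:R))); last by move=> t _; exact: Eqb.
rewrite [X in _ + (_ - X)](eq_bigr (fun t : 'I_n => n%:R^-1)); last by move=> t _; exact: Eq.
by rewrite sumr_const card_ord -mulr_sumr -(mulr_natl n%:R^-1 n) mulfV ?pnatr_eq0 -?lt0n // subrr addr0.
Qed.

Lemma exceed_time_le (rho : R) : 0 < rho ->
  rho * E (fun w => (exceed U rho (q w) w)%:R) * ln (n%:R : R) <=
  301 + 40 * (2 * (8 + (84 * 32 + 26) * 11)).
Proof.
move=> rho0; set p := E _.
have mE t : mprop (exceed U rho t).
  apply: mprop_lt; first exact: measurable_cst.
  by apply: mfun_mx; apply: adapted_mseq; [exact: qm|exact: adaptedY|exact: qm|exact: adaptedZ].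
have mE' t : @mprop _ (TS (past t)) (exceed U rho t).
  apply: mprop_lt; first exact: measurable_cst.
  by apply: mfun_mx; [exact: (@adaptedY _ _ _ U q)|exact: (@adaptedZ _ _ _ U q)].
have bE : bm (fun w => (exceed U rho (q w) w)%:R : R).
  by apply: bm_bool; apply: (mprop_sel (P := fun t w => exceed U rho t w)).
have p0 : 0 <= p by apply: Ex_ge0.
have p1 : p <= 1.
  by rewrite -(Ex_cst P 1); apply: Ex_le => //; [exact: bm_cst|move=> w; rewrite lern1 leq_b1].
have rp1 : rho * p <= 1.
  case: (ltP rho 1) => h; first by apply: mulr_ile1 => //; exact: ltW.
  suff -> : p = 0 by rewrite mulr0.
  rewrite -(Ex_cst P 0); apply: Ex_eq_ae => //; first exact: bm_cst.
  apply: filterS (ae_good UU qm ind) => w [_ /(_ (q w))[oY oZ _ _ _]].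
  rewrite /exceed ltNge (le_trans (mx_le oY oZ)) //.
  by have /andP[] := @unmatched_mass_ge0 _ _ (Zt U (q w) w) oY; lra.
pose m := trunc_log 2 n.
have mn : (2 ^ m <= n)%N by exact: trunc_logP.
have nm : (n < 2 ^ m.+1)%N by exact: trunc_log_ltn.
have lnm : ln (n%:R : R) <= m.+1%:R by exact: ln_le_log2.
have ln0 : 0 <= ln (n%:R : R) by rewrite ln_ge0 // ler1n.
apply: (@le_trans _ _ (rho * p * m.+1%:R)).
  by apply: ler_wpM2l => //; rewrite mulr_ge0 // ltW.
(* For such small [rho] the claim follows from [p <= 1]. *)
case: (leP (rho * m.+1%:R) 1) => rm.
  rewrite mulrAC; apply: (@le_trans _ _ 1); last lra.
  by apply: mulr_ile1 => //; rewrite mulr_ge0 // ltW.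
(* Now [rho > 1 / (m + 1)], so every scale from [l.+1] on lies below [rho], and only about
   [log log t0] scales are lost. *)
pose l := trunc_log 2 m.+1.
have lm : (2 ^ l <= m.+1)%N by exact: trunc_logP.
have ml : (m.+1 < 2 ^ l.+1)%N by exact: trunc_log_ltn.
pose k1 := (m %/ 10)%N.
have Ke : (3 / 4 : R) ^+ (3 * m.+1) <= n%:R^-1.
  apply: le_trans (expr34_le _ _) _.
  by rewrite lef_pV2 ?posrE ?exprn_gt0 ?ltr0n // -natrX ler_nat ltnW.
have kn : (2 ^ k1 <= n)%N.
  by apply: leq_trans mn; rewrite leq_exp2l // leq_div.
have krho : (2 ^+ l.+1)^-1 <= rho.
  apply: (@le_trans _ _ m.+1%:R^-1).
    by rewrite lef_pV2 ?posrE ?exprn_gt0 ?ltr0n // -natrX ler_nat ltnW.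
  by rewrite -[leLHS]mul1r ler_pdivrMr ?ltr0n // ltW.
have S1 := sum_exceed_le UU qm ind n0 Ke kn rho0 krho.
have S2 := error_le R mn.
have S3 := Ex_uniform_time mE' mE; rewrite -/p in S3.
set S := \sum_(t < n) _ in S1 S3.
have nR : 0 < n%:R :> R by rewrite ltr0n.
have {}S3 : n%:R * p <= S by rewrite -ler_pdivlMl.
pose D := (k1 - l.+1)%N%:R : R.
have D0 : 0 <= D by rewrite ler0n.
have Dp : D * (rho * p) <= 2 * (8 + (84 * 32 + 26) * 11).
  rewrite -(ler_pM2l nR).
  have -> : n%:R * (D * (rho * p)) = D * rho * (n%:R * p) by ring.
  apply: (@le_trans _ _ (D * rho * S)); first by apply: ler_wpM2l => //; rewrite mulr_ge0 // ltW.
  have -> : D * rho * S = 2 * (D / 2 * (rho * S)) by field.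
  rewrite /D; lra.
have cnt : m.+1%:R <= 40 * D + 300.
  by rewrite /D -natrM -natrD ler_nat; exact: scales_count.
have rp0 : 0 <= rho * p by rewrite mulr_ge0 // ltW.
have := ler_wpM2l rp0 cnt.
have -> : rho * p * (40 * D + 300) = 40 * (D * (rho * p)) + 300 * (rho * p) by ring.
lra.
Qed.

End Time.

(** The rows [U 0] and [U 1] drive the stick breaking of the two initial states; [U 2] and [U 3] are
    the draws [u] and [v]. Multiplying the bound out keeps it meaningful at [t0 = 1], where the
    logarithm vanishes. *)
Theorem theorem3p5 (R : realType) :
  exists C : R, forall (t0 : nat) (rho : R), (0 < t0)%N -> 0 < rho ->
  forall (d : measure_display) (T : measurableType d) (P : probability T R)
    (U : nat -> nat -> {mfun T >-> R}) (q : T -> nat),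
    (* every U k j is uniform on [0,1] *)
    (forall k j (A : set R), measurable A ->
       distribution P (U k j) A = uniform_prob (@ltr01 R) A) ->
    (* q is uniform on {0,...,t0-1} *)
    (forall k, measurable (q @^-1` [set k])) ->
    (forall k, (k < t0)%N -> P (q @^-1` [set k]) = (t0%:R^-1)%:E) ->
    (* all the U k j and q are mutually independent *)
    mutually_independent P
      (fun i : option (nat * nat) => match i with
        | Some (k, j) => [set U k j @^-1` A | A in [set A : set R | measurable A]]
        | None => [set q @^-1` B | B in [set: set nat]]
        end) ->
    let Yt := fun w t => (chain (fun j => U 0%N j w) (fun j => U 1%N j w)
                                (fun j => U 2%N j w) (fun j => U 3%N j w) t).1 in
    let Zt := fun w t => (chain (fun j => U 0%N j w) (fun j => U 1%N j w)
                                (fun j => U 2%N j w) (fun j => U 3%N j w) t).2 in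
    (P [set w | (rho < Num.max (unmatched_max (Yt w (q w)) (Zt w (q w)))
                              (unmatched_max (Zt w (q w)) (Yt w (q w))))%R]
       * (rho * ln (t0%:R))%:E <= C%:E)%E.
Proof.
exists (301 + 40 * (2 * (8 + (84 * 32 + 26) * 11))).
move=> t0 rho t00 rho0 d T P U q UU qm qU ind; cbv zeta.
have mE : mprop (fun w => exceed U rho (q w) w).
  apply: (mprop_sel (P := fun t w => exceed U rho t w)) => // t.
  apply: mprop_lt; first exact: measurable_cst.
  by apply: mfun_mx; apply: adapted_mseq; [exact: qm|exact: adaptedY|exact: qm|exact: adaptedZ].
rewrite (_ : [set w | _] = [set w | exceed U rho (q w) w]) // -Ex_bool //.
rewrite -EFinM lee_fin mulrCA mulrA.
exact: exceed_time_le.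
Qed.
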